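(* Let $B$ be an $n\times n$ skew-symmetrizable integer matrix, and let $\mathcal{S}$ be its mutation-equivalence class. Consider the conditions: (i) $\mathcal{S}$ contains a matrix $B^0$ such that the Cartan matrix $A$ with $A_{ii}=2$ and $A_{ij}=-|B^0_{ij}|$ for $i\neq j$ is positive; (ii) for every $B'\in\mathcal{S}$ and all $i\neq j$, $|B'_{ij}B'_{ji}|\le 3$; (iii) every chordless cycle in $\Gamma(B)$ is cyclically oriented, and $B$ has a positive quasi-Cartan companion. Then condition (iii) holds if and only if condition (i) holds, and if and only if condition (ii) holds.
   Context: All matrices are square integer matrices. A matrix $B$ is skew-symmetrizable if $DB$ is skew-symmetric for some diagonal matrix $D$ with positive diagonal entries; a matrix $A$ is symmetrizable if $DA$ is symmetric for such a $D$. A quasi-Cartan matrix is a symmetrizable matrix with all diagonal entries equal to $2$; it is positive if $DA$ is positive definite (equivalently, all principal minors of $A$ are positive). A (generalized) Cartan matrix is a quasi-Cartan matrix with non-positive off-diagonal entries. A quasi-Cartan companion of a skew-symmetrizable $B$ is a quasi-Cartan matrix $A$ with $|A_{ij}|=|B_{ij}|$ for all $i\ne j$. Mutation in direction $k$ sends a skew-symmetrizable $B$ to $B'=\mu_k(B)$ with $B'_{ij}=-B_{ij}$ if $i=k$ or $j=k$, and $B'_{ij}=B_{ij}+\operatorname{sgn}(B_{ik})[B_{ik}B_{kj}]_+$ otherwise, where $[x]_+=\max(x,0)$ and $\operatorname{sgn}(0)=0$. Mutations are involutive; the mutation-equivalence class of $B$ is the set of matrices obtained from $B$ by sequences of mutations.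 $\Gamma(B)$ is the directed graph on vertices $1,\dots,n$ with an arrow $i\to j$ whenever $B_{ij}>0$. A chordless cycle in $\Gamma(B)$ is an induced subgraph whose underlying undirected graph is a cycle, i.e. its vertices can be labeled by $\mathbb{Z}/p\mathbb{Z}$, $p\ge 3$, so that the edges among them are exactly $\{i,i+1\}$; it is cyclically oriented if, for a suitable such labeling, all its edges are oriented $i\to i+1$. (It is known, by work of Fomin–Zelevinsky, that (i) and (ii) are equivalent, and equivalent to the cluster algebra associated to $\mathcal{S}$ being of finite type.) *)

(* Defs.v *)
From mathcomp Require Import all_boot all_order all_algebra.

Set Implicit Arguments.
Unset Strict Implicit.
Unset Printing Implicit Defensive.

Import Order.TTheory GRing.Theory Num.Theory.
Local Open Scope ring_scope.

Definition skew_symmetrizable (n : nat) (B : 'M[int]_n) : Prop :=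
  exists d : 'rV[int]_n, (forall i, 0 < d 0 i) /\
    (diag_mx d *m B)^T = - (diag_mx d *m B).

Definition symmetrizes (n : nat) (d : 'rV[int]_n) (A : 'M[int]_n) : Prop :=
  (forall i, 0 < d 0 i) /\ (diag_mx d *m A)^T = diag_mx d *m A.

Definition symmetrizable (n : nat) (A : 'M[int]_n) : Prop :=
  exists d : 'rV[int]_n, symmetrizes d A.

Definition quasi_cartan (n : nat) (A : 'M[int]_n) : Prop :=
  symmetrizable A /\ (forall i, A i i = 2).

Definition posdef (R : realFieldType) (n : nat) (M : 'M[R]_n) : Prop :=
  forall x : 'cV[R]_n, x != 0 -> 0 < (x^T *m M *m x) 0 0.

(* A symmetrizer is unique up to a positive factor on each indecomposable block
   of A, so positivity does not depend on which symmetrizer d is chosen. *)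
Definition positive (R : realFieldType) (n : nat) (A : 'M[int]_n) : Prop :=
  exists d : 'rV[int]_n, symmetrizes d A /\
    posdef (map_mx (intr : int -> R) (diag_mx d *m A)).

Definition quasi_cartan_companion (n : nat) (B A : 'M[int]_n) : Prop :=
  quasi_cartan A /\ (forall i j, i != j -> `|A i j| = `|B i j|).

Definition cartan_counterpart (n : nat) (B : 'M[int]_n) : 'M[int]_n :=
  \matrix_(i, j) if i == j then 2 else - `|B i j|.

Definition mutate (n : nat) (B : 'M[int]_n) (k : 'I_n) : 'M[int]_n :=
  \matrix_(i, j)
    if (i == k) || (j == k) then - B i j
    else B i j + Num.sg (B i k) * Num.max (B i k * B k j) 0.

Definition mutation_equivalent (n : nat) (B B' : 'M[int]_n) : Prop :=
  exists ks : seq 'I_n, B' = foldl (@mutate n) B ks.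

Definition Gamma (n : nat) (B : 'M[int]_n) : rel 'I_n :=
  fun i j => 0 < B i j.

(* 'I_p with the cyclic successor ordS plays the role of Z/pZ with i |-> i + 1.
   A subset C of the vertices stands for the subgraph it induces. *)
Definition cycle_labeling (T : finType) (g : rel T) (C : {set T})
    (p : nat) (c : 'I_p -> T) : Prop :=
  [/\ (3 <= p)%N, injective c, C = [set c a | a : 'I_p] &
      forall a b : 'I_p,
        (g (c a) (c b) || g (c b) (c a)) = (b == ordS a) || (a == ordS b)].

Definition chordless_cycle (T : finType) (g : rel T) (C : {set T}) : Prop :=
  exists (p : nat) (c : 'I_p -> T), cycle_labeling g C c.

Definition cyclically_oriented (T : finType) (g : rel T) (C : {set T}) : Prop :=
  exists (p : nat) (c : 'I_p -> T),
    cycle_labeling g C c /\ (forall a, g (c a) (c (ordS a))).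

(* Main.v *)
Require Import Defs.
From mathcomp Require Import all_boot all_order all_algebra.
From mathcomp Require Import zify ring lra.
Import Order.TTheory GRing.Theory Num.Theory.
Local Open Scope ring_scope.
Set Implicit Arguments.
Unset Strict Implicit.
Unset Printing Implicit Defensive.

(** (iii) => (ii).  A positive companion [A] has an odd number of positive entries around each
    chordless cycle, for otherwise a sign change produces a vector on which the form is not
    positive.  If moreover all chordless cycles are cyclically oriented, a mutation of [B] is
    accompanied by an integral change of variables taking [A] to a positive companion of the
    mutated matrix, and inspecting how chordless cycles arise under mutation shows that they
    stay cyclically oriented.  Positive companions have [|B_ij B_ji| < 4].  As mutations are
    involutive, the same invariant gives (i) => (iii), starting from the Cartan counterpart of
    [B0], which has no chordless cycles at all.

    (ii) => (i), by induction on the support of [B].  Deleting a vertex [k] gives, after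
    mutations away from [k], a forest with positive Cartan matrix.  Give [B] the companion that
    is Cartan on the forest and skew at [k], and let [z] be an integral vector orthogonal to the
    forest with [z_k > 0].  Mutations at sources of the forest adjacent to [k] change a single
    coordinate [z_u] to [z_u + B_uk z_k] and preserve the value [e] of the form at [z], divided
    by [d_k z_k].
    If the companion is positive, these mutations lead to a matrix in which [k] is a sink, and
    whose Cartan counterpart is then positive.  Otherwise [e <= 0]; minimising [sum |z_u|] and
    using that, by induction, the weights at [k] in each direction add up to at most 3, one more
    mutation at [k] halves [|z_k|].  Iterating forces [e = 0], and then infinite descent on the
    integral radical vector gives a contradiction. *)

(** * Chordless cycles *)

(** Orientation and sign are tied together: after a mutation each chordless cycle is either oriented
    and odd, or unoriented and even. From (iii), positivity excludes the second kind. Under (ii) no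
    positive companion is available at first; orientedness is proved on its own, within the same
    induction on the support, and the alternative then yields odd signs. Odd signs thus replace
    positivity: they survive mutation and fix a companion up to signs of basis vectors, so the
    adapted companion can be restored after every detour. The bound 3 drives the descent: each
    direction at [k] can supply at most [3 z_k / 2], while [e <= 0] asks both together for at least
    [2 z_k]. So each supplies between one half and three halves of [z_k], which is why the new
    coordinate is at most half as large. The value of the form stays, so [|e| / z_k] grows at least
    fourfold per round, although it never exceeds 1. All this is done over the rationals, where
    denominators can be cleared; elimination carries positivity over to any ordered field. *)

Section Cycles.
Variable n : nat.
Implicit Types (B A : 'M[int]_n) (l Z : seq 'I_n) (i j k x y : 'I_n).

Definition sym_support B := forall i j, (B i j != 0) = (B j i != 0).

Fixpoint induced_path B l :=
  if l is x :: l' then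
    [&& induced_path B l', x \notin l' &
        all (fun y => (B x y != 0) == (y == head x l')) l']
  else true.

(* [k :: l] is a chordless cycle, cut open at the vertex [k]. *)
Definition ear B k l :=
  [&& induced_path B l, (1 < size l)%N, k \notin l &
      all (fun y => (B k y != 0) == ((y == head k l) || (y == last k l))) l].

Definition ecycle B Z := if Z is k :: l then ear B k l else false.

Fixpoint pprod (f : 'I_n -> 'I_n -> int) x l : int :=
  if l is y :: l' then f x y * pprod f y l' else 1.

Definition cprod f Z := if Z is k :: l then pprod f k (rcons l k) else 1.

(** Both directions occur at [x]; when [Z] is a chordless cycle this says that its orientation runs
    through [x]. It depends on the vertex set only, not on where the cycle is cut open. *)
Definition passes B Z x := has (fun y => 0 < B x y) Z && has (fun y => B x y < 0) Z.

(** The condition is local at the cut vertex; since every rotation of a chordless cycle is again an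
    ear, it holds at all vertices of the cycle. *)
Definition oriented B := forall k l, ear B k l -> B k (head k l) * B k (last k l) < 0.

Definition sgn_edge A x y : int := Num.sg (- A x y).

(* With the sign convention of [sgn_edge], negative entries of [A] count as [+1]. *)
Definition odd_signs B A := forall k l, ear B k l -> cprod (sgn_edge A) (k :: l) = -1.

Lemma pprod_cat f x l1 l2 :
  pprod f x (l1 ++ l2) = pprod f x l1 * pprod f (last x l1) l2.
Proof. by elim: l1 x => [|y l1 IH] x /=; rewrite ?mul1r // IH mulrA. Qed.

Lemma pprod_rcons f x l y : pprod f x (rcons l y) = pprod f x l * f (last x l) y.
Proof. by rewrite -cats1 pprod_cat /= mulr1. Qed.

Lemma cprod_rot1 f Z : cprod f (rot 1 Z) = cprod f Z.
Proof.
case: Z => [|k [|y l]] //; rewrite rot1_cons //.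
by rewrite /= (pprod_rcons _ _ (rcons l k)) last_rcons mulrC.
Qed.

Lemma rot_ind (P : seq 'I_n -> Prop) Z (i : nat) :
  (forall Y, P Y -> P (rot 1 Y)) -> P Z -> P (rot i Z).
Proof.
move=> H HZ; have [Hi|Hi] := leqP i (size Z); last by rewrite rot_oversize // ltnW.
elim: i Hi => [_|i IH Hi]; first by rewrite rot0.
by rewrite -[i.+1]add1n rotD //; apply/H/IH/ltnW.
Qed.

Lemma cprod_rot f Z (i : nat) : cprod f (rot i Z) = cprod f Z.
Proof. by apply: (@rot_ind (fun Y => cprod f Y = cprod f Z)) => // Y; rewrite cprod_rot1. Qed.

Lemma passes_mem B Z1 Z2 x : Z1 =i Z2 -> passes B Z1 x = passes B Z2 x.
Proof. by move=> E; rewrite /passes !(eq_has_r E). Qed.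

Lemma induced_path_uniq B l : induced_path B l -> uniq l.
Proof. by elim: l => //= x l IH /and3P[/IH -> -> _]. Qed.

Lemma induced_path_catl B l1 l2 : induced_path B (l1 ++ l2) -> induced_path B l1.
Proof.
elim: l1 => //= x l1 IH /and3P[/IH -> ]; rewrite mem_cat negb_or => /andP[-> _].
rewrite all_cat => /andP[H _] /=; case: l1 H {IH} => //=.
Qed.

Lemma induced_path_catr B l1 l2 : induced_path B (l1 ++ l2) -> induced_path B l2.
Proof. by elim: l1 => //= x l1 IH /and3P[/IH]. Qed.

Lemma induced_path_rcons B l k : sym_support B ->
  induced_path B l -> k \notin l ->
  all (fun y => (B k y != 0) == (y == last k l)) l -> induced_path B (rcons l k).
Proof.
move=> sB; elim: l => [|x l IH] //= /and3P[Hl xl Hx].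
rewrite inE negb_or => /andP[kx kl] /andP[/eqP Hkx Hk].
apply/and3P; split.
- apply: IH => //; case: l Hk {Hl xl Hx kl Hkx} => //=.
- by rewrite mem_rcons inE negb_or eq_sym kx.
- apply/allP => y; rewrite mem_rcons inE => /orP[/eqP->|yl].
    rewrite sB Hkx; case: l xl kl {Hl Hx Hkx Hk IH} => [|z l] /= xl kl; first by rewrite !eqxx.
    have -> : (x == last z l) = false.
      by apply/negbTE; apply: contraNneq xl => ->; rewrite mem_last.
    by apply/eqP; apply/esym/negbTE; move: kl; rewrite inE negb_or => /andP[].
  have := allP Hx _ yl; case: l yl {Hx Hl xl kl Hkx Hk IH} => //=.
Qed.

Lemma ear_rot1 B k y l : sym_support B -> ear B k (y :: l) -> ear B y (rcons l k).
Proof.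
move=> sB /and4P[/=/and3P[Hl yl Hy] sl]; rewrite inE negb_or => /andP[ky kl].
move=> /andP[Hky Hk]; have l0 : l != [::] by case: l sl {Hl yl Hy kl Hk Hky}.
apply/and4P; split.
- apply: induced_path_rcons => //; apply/allP => z zl.
  have := allP Hk _ zl; rewrite (_ : z == y = false) /=; last first.
    by apply/negbTE; apply: contraNneq yl => <-.
  by case: l l0 {Hl yl Hy kl sl zl Hk Hky}.
- by rewrite size_rcons; case: l l0 {Hl yl Hy kl sl Hk Hky}.
- by rewrite mem_rcons inE negb_or yl eq_sym ky.
- rewrite last_rcons; apply/allP => z; rewrite mem_rcons inE => /orP[/eqP->|zl].
    by rewrite eqxx orbT sB (eqP Hky) eqxx.
  have := allP Hy _ zl; rewrite (_ : z == k = false) ?orbF; last first.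
    by apply/negbTE; apply: contraNneq kl => <-.
  by case: l l0 {Hl yl Hy kl sl zl Hk Hky}.
Qed.

Lemma ecycle_rot B Z (i : nat) : sym_support B -> ecycle B Z -> ecycle B (rot i Z).
Proof.
move=> sB; apply: (@rot_ind (fun Y => ecycle B Y)) => -[|k [|y l]] // H.
by rewrite rot1_cons; apply: ear_rot1.
Qed.

Lemma ecycle_to B Z x : sym_support B -> ecycle B Z -> x \in Z ->
  exists2 l, ear B x l & exists i : nat, rot i Z = x :: l.
Proof.
move=> sB HZ xZ; case: (rot_to xZ) => i l E; exists l; last by exists i.
by have := ecycle_rot i sB HZ; rewrite E.
Qed.

Lemma ear_head B k l : ear B k l -> head k l \in l.
Proof. by case/and4P=> _; case: l => //= x l _ _ _; rewrite mem_head. Qed.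
Lemma ear_last B k l : ear B k l -> last k l \in l.
Proof. by case/and4P=> _; case: l => //= x l _ _ _; rewrite mem_last. Qed.
Lemma ear_adj B k l y : ear B k l -> y \in l ->
  (B k y != 0) = ((y == head k l) || (y == last k l)).
Proof. by case/and4P=> _ _ _ /allP H /H/eqP. Qed.
Lemma ear_adj_head B k l : ear B k l -> B k (head k l) != 0.
Proof. by move=> H; rewrite (ear_adj H (ear_head H)) eqxx. Qed.
Lemma ear_adj_last B k l : ear B k l -> B k (last k l) != 0.
Proof. by move=> H; rewrite (ear_adj H (ear_last H)) eqxx orbT. Qed.

Lemma ear_passes B k l : B k k = 0 -> ear B k l ->
  passes B (k :: l) k = (B k (head k l) * B k (last k l) < 0).
Proof.
move=> B0 H; have hh := ear_head H; have hl := ear_last H.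
have ah := ear_adj_head H; have al := ear_adj_last H.
apply/andP/idP => [[/hasP[x xl Hx] /hasP[y yl Hy]]|Hlt].
  have E w : w \in k :: l -> B k w != 0 -> w = head k l \/ w = last k l.
    rewrite inE => /orP[/eqP->|wl]; first by rewrite B0 eqxx.
    by rewrite (ear_adj H wl) => /orP[]/eqP; [left|right].
  have /E : x \in k :: l by []. have /E : y \in k :: l by [].
  move=> /(_ ltac:(lia)) Ey /(_ ltac:(lia)) Ex.
  by case: Ex Ey => ?; case=> ?; subst; nia.
have [h|h] : 0 < B k (head k l) \/ B k (head k l) < 0 by lia.
  by split; apply/hasP; [exists (head k l)|exists (last k l)]; rewrite ?inE ?hh ?hl ?orbT //; nia.
by split; apply/hasP; [exists (last k l)|exists (head k l)]; rewrite ?inE ?hh ?hl ?orbT //; nia.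
Qed.

Lemma oriented_passes B Z x : sym_support B -> (forall i, B i i = 0) -> oriented B ->
  ecycle B Z -> x \in Z -> passes B Z x.
Proof.
move=> sB B0 oB HZ xZ; have [l El [i Ei]] := ecycle_to sB HZ xZ.
have -> : passes B Z x = passes B (x :: l) x.
  by apply: passes_mem => w; rewrite -Ei mem_rot.
by rewrite ear_passes //; apply: oB.
Qed.

End Cycles.

(** * Mutation of companions *)

Section Mutation.
Variables (n : nat) (d : 'I_n -> int).
Hypothesis d_gt0 : forall i, 0 < d i.
Implicit Types (B A : 'M[int]_n) (i j k : 'I_n).

Definition skew_by B := forall i j, d i * B i j = - (d j * B j i).

Lemma skew_diag B i : skew_by B -> B i i = 0.
Proof. by move/(_ i i); have := d_gt0 i; nia. Qed.

Lemma skew_sgn B i j : skew_by B ->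
  (0 < B i j) = (B j i < 0) /\ (B i j == 0) = (B j i == 0).
Proof.
move=> /(_ i j); have := d_gt0 i; have := d_gt0 j => dj di E.
by split; apply/idP/idP => H; nia.
Qed.

Lemma skew_gt0 B i j : skew_by B -> (0 < B i j) = (B j i < 0).
Proof. by case/(skew_sgn i j). Qed.

Lemma skew_lt0 B i j : skew_by B -> (B i j < 0) = (0 < B j i).
Proof. by move=> s; rewrite (skew_gt0 _ _ s). Qed.

Lemma skew_eq0 B i j : skew_by B -> (B i j == 0) = (B j i == 0).
Proof. by case/(skew_sgn i j). Qed.

Lemma skew_sym B : skew_by B -> sym_support B.
Proof. by move=> s i j; rewrite (skew_eq0 _ _ s). Qed.

Lemma mutate_row B k j : mutate B k k j = - B k j.
Proof. by rewrite mxE eqxx. Qed.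

Lemma mutate_col B k i : mutate B k i k = - B i k.
Proof. by rewrite mxE eqxx orbT. Qed.

Lemma mutateE B k i j : i != k -> j != k ->
  mutate B k i j = B i j + Num.sg (B i k) * Num.max (B i k * B k j) 0.
Proof. by move=> /negbTE ik /negbTE jk; rewrite mxE ik jk. Qed.

Lemma mutate_pos B k i j : i != k -> j != k -> 0 < B i k * B k j ->
  mutate B k i j = B i j + Num.sg (B i k) * (B i k * B k j).
Proof. by move=> ik jk H; rewrite mutateE // max_l // ltW. Qed.

Lemma mutate_npos B k i j : i != k -> j != k -> B i k * B k j <= 0 ->
  mutate B k i j = B i j.
Proof. by move=> ik jk H; rewrite mutateE // max_r // mulr0 addr0. Qed.

Lemma mutate_skew B k : skew_by B -> skew_by (mutate B k).
Proof.
move=> s i j; have [->|ik] := eqVneq i k.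
  by rewrite mutate_row mutate_col; have := s k j; lia.
have [->|jk] := eqVneq j k.
  by rewrite mutate_row mutate_col; have := s i k; lia.
have di := d_gt0 i; have dj := d_gt0 j; have dk := d_gt0 k.
have sij := s i j; have sik := s i k; have sjk := s j k.
have [gik eik] := skew_sgn i k s; have [gjk ejk] := skew_sgn j k s.
have [H|H] := ltP 0 (B i k * B k j).
  rewrite !mutate_pos //; last by nia.
  have E1 : d i * (B i k * B k j) = d j * (B j k * B k i).
    rewrite mulrA sik mulrA sjk; ring.
  have -> : Num.sg (B j k) = - Num.sg (B i k) by nia.
  have [->|->] : Num.sg (B i k) = 1 \/ Num.sg (B i k) = -1 by nia.
    by nia.
  by nia.
by rewrite !mutate_npos //; nia.
Qed.

Lemma mutateK B k : skew_by B -> mutate (mutate B k) k = B.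
Proof.
move=> s; apply/matrixP => i j; have [->|ik] := eqVneq i k.
  by rewrite !mutate_row opprK.
have [->|jk] := eqVneq j k; first by rewrite !mutate_col opprK.
have [H|H] := ltP 0 (B i k * B k j).
  have H' : 0 < mutate B k i k * mutate B k k j by rewrite mutate_col mutate_row mulrNN.
  rewrite (mutate_pos ik jk H') mutate_pos // mutate_col mutate_row mulrNN sgrN; ring.
have H' : mutate B k i k * mutate B k k j <= 0 by rewrite mutate_col mutate_row mulrNN.
by rewrite (mutate_npos ik jk H') mutate_npos.
Qed.

(** The symmetrizer [d] is shared with [B]; [skew_by_abs] shows that this loses nothing. *)
Definition companion B A := [/\ forall i, A i i = 2,
  forall i j, d i * A i j = d j * A j i & forall i j, i != j -> `|A i j| = `|B i j|].

Lemma companion_sg B A i j : companion B A -> Num.sg (A i j) = Num.sg (A j i).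
Proof.
case=> _ /(_ i j) E _; have : Num.sg (d i * A i j) = Num.sg (d j * A j i) by rewrite E.
by rewrite !sgrM (gtr0_sg (d_gt0 i)) (gtr0_sg (d_gt0 j)) !mul1r.
Qed.

(** Matrix of the form of [A] after the basis vectors [e_i] with [0 < B i k] are reflected in [e_k].
    Reflections are isometries, so only mixed pairs, one vector reflected and one not, change their
    product. *)
Definition mutate_companion A B k : 'M[int]_n :=
  \matrix_(i, j)
    if (i == k) && (j == k) then 2
    else if i == k then (if 0 < B k j then A k j else - A k j)
    else if j == k then (if 0 < B k i then A i k else - A i k)
    else A i j - (if 0 < B i k * B k j then A i k * A k j else 0).

Lemma companion_eq0 B A i j : i != j -> companion B A -> (A i j == 0) = (B i j == 0).
Proof. by move=> ij [_ _ /(_ _ _ ij)]; lia. Qed.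

Lemma mutate_companion_col A B k i : skew_by B -> companion B A -> i != k ->
  mutate_companion A B k i k = A i k - (if 0 < B i k then 2 * A i k else 0).
Proof.
move=> s c ik; have := companion_eq0 ik c.
have [g e] := skew_sgn i k s.
rewrite mxE (negbTE ik) eqxx /=; move: g e.
by case: (ltP 0 (B k i)); case: (ltP 0 (B i k)); lia.
Qed.

Lemma mutate_companion_row A B k j : skew_by B -> companion B A -> j != k ->
  mutate_companion A B k k j = A k j - (if 0 < B j k then 2 * A k j else 0).
Proof.
move=> s c jk; have kj : k != j by rewrite eq_sym.
have := companion_eq0 kj c; have [g e] := skew_sgn j k s.
rewrite mxE (negbTE jk) eqxx /=; move: g e.
by case: (ltP 0 (B k j)); case: (ltP 0 (B j k)); lia.
Qed.

Lemma mutate_companion_diag A B k i : skew_by B -> companion B A -> mutate_companion A B k i i = 2.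
Proof.
move=> s [c _ _]; rewrite mxE; case: eqVneq => //= ik; rewrite c.
have [g e] := skew_sgn i k s; have -> : 0 < B i k * B k i = false by nia.
by rewrite subr0.
Qed.

Lemma mutate_companion_sym A B k : skew_by B -> companion B A ->
  forall i j, d i * mutate_companion A B k i j = d j * mutate_companion A B k j i.
Proof.
move=> s c i j; have [c1 c2 c3] := c; have [->|ik] := eqVneq i k.
  have [->//|jk] := eqVneq j k.
  rewrite mutate_companion_row // mutate_companion_col //; have := c2 k j; case: ifP; lia.
have [->|jk] := eqVneq j k.
  rewrite mutate_companion_row // mutate_companion_col //; have := c2 i k; case: ifP; lia.
rewrite !mxE (negbTE ik) (negbTE jk) /=.
have -> : (0 < B j k * B k i) = (0 < B i k * B k j).
  by have [g e] := skew_sgn i k s; have [g' e'] := skew_sgn j k s; nia.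
case: ifP => _; last by rewrite !subr0.
rewrite !mulrBr c2; congr (_ - _).
by rewrite mulrA (c2 i k) mulrAC (c2 k j) -mulrA.
Qed.

(** Both [A i j - A i k * A k j] and the mutated entry of [B] must be differences rather than sums
    of absolute values; otherwise the mutated companion would not match the mutated matrix. *)
Definition good_triangles B A := forall i j k, i != j -> i != k -> j != k ->
  0 < B i k * B k j -> B i j != 0 -> 0 < A i j * (A i k * A k j) /\ B i j * B i k < 0.

Lemma triangle_ear B i j k : skew_by B -> i != j -> i != k -> j != k ->
  B i j != 0 -> B k i != 0 -> B k j != 0 -> ear B k [:: i; j].
Proof.
move=> s ij ik jk bij bki bkj; rewrite /ear /= !inE negb_or ![k == _]eq_sym.
by rewrite ij ik jk bij bki bkj !eqxx orbT.
Qed.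

(** The three vertices form a chordless cycle: its orientation gives the sign condition on [B], its
    oddness the one on [A]. *)
Lemma oriented_good B A : skew_by B -> companion B A ->
  oriented B -> odd_signs B A -> good_triangles B A.
Proof.
move=> s c oB aB i j k ij ik jk H bij; have [c1 c2 c3] := c.
have [gik eik] := skew_sgn i k s; have [gjk ejk] := skew_sgn j k s.
have [gij eij] := skew_sgn i j s.
have E : ear B k [:: i; j] by apply: triangle_ear => //; nia.
have := ear_rot1 (skew_sym s) E => E2; have /= o2 := oB _ _ E2.
have := aB _ _ E; rewrite /cprod /= /sgn_edge => O; split; last by nia.
rewrite -sgr_gt0 !sgrM (companion_sg k j c) -(companion_sg k i c).
suff -> : Num.sg (A i j) * (Num.sg (A k i) * Num.sg (A j k)) = 1 by [].
by rewrite -[RHS]opprK -O !sgrN; ring.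
Qed.

Lemma mutate_companion_comp A B k : skew_by B -> companion B A -> good_triangles B A ->
  companion (mutate B k) (mutate_companion A B k).
Proof.
move=> s c g; split; first by move=> i; apply: mutate_companion_diag.
  exact: mutate_companion_sym.
have [c1 c2 c3] := c; move=> i j ij; have [ik|ik] := eqVneq i k.
  subst i; have jk : j != k by rewrite eq_sym.
  rewrite mutate_companion_row // mutate_row; have := c3 _ _ ij; case: ifP; lia.
have [jk|jk] := eqVneq j k.
  subst j; rewrite mutate_companion_col // mutate_col; have := c3 _ _ ij; case: ifP; lia.
rewrite [in LHS]mxE (negbTE ik) (negbTE jk) /=; case: ltP => H; last first.
  by rewrite mutate_npos // subr0 c3.
rewrite mutate_pos //; have kj : k != j by rewrite eq_sym.
have E : `|A i k * A k j| = B i k * B k j by rewrite normrM !c3 // -normrM ger0_norm // ltW.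
have [b0|b0] := eqVneq (B i j) 0.
  have -> : A i j = 0 by apply/eqP; rewrite (companion_eq0 ij c) b0.
  by rewrite b0; nia.
have [g1 g2] := g _ _ _ ij ik jk H b0; have := c3 _ _ ij => E2.
have [s1|s1] : Num.sg (B i k) = 1 \/ Num.sg (B i k) = -1 by nia.
  rewrite s1; nia.
rewrite s1; nia.
Qed.

(** * The quadratic form of a companion under mutation *)

Section Form.
Variable F : realFieldType.
Implicit Types x y : 'I_n -> F.

Definition lin A x i : F := \sum_j (A i j)%:~R * x j.
Definition qform A x : F := \sum_i (d i)%:~R * x i * lin A x i.
Definition pd A := forall x, (exists i, x i != 0) -> 0 < qform A x.

(* [mutL] is the substitution under which the form of [A] becomes that of the mutated companion. *)
Definition in_sum A B k x : F := \sum_(i | 0 < B i k) (A k i)%:~R * x i.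
Definition mutL A B k x : 'I_n -> F :=
  fun j => if j == k then x k - in_sum A B k x else x j.
Definition mutLinv A B k x : 'I_n -> F :=
  fun j => if j == k then x k + in_sum A B k x else x j.

Lemma in_sum_eq A B k x y : skew_by B -> (forall j, j != k -> x j = y j) -> in_sum A B k x = in_sum A B k y.
Proof.
move=> s E; apply: eq_bigr => i Hi; rewrite E //; apply: contraTneq Hi => ->.
by rewrite (skew_diag _ s).
Qed.

Lemma mutLK A B k x : skew_by B -> forall j, mutL A B k (mutLinv A B k x) j = x j.
Proof.
move=> s j; rewrite {1}/mutL; case: eqVneq => [->|jk]; last by rewrite /mutLinv (negbTE jk).
rewrite (@in_sum_eq A B k _ x) //; last by move=> i; rewrite /mutLinv => /negbTE ->.
by rewrite /mutLinv eqxx addrK.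
Qed.

Lemma lin_mutL A B k x j :
  lin A (mutL A B k x) j = lin A x j - (A j k)%:~R * in_sum A B k x.
Proof.
rewrite /lin (bigD1 k) //= [X in _ = X - _](bigD1 k) //= {1}/mutL eqxx mulrBr.
rewrite -!addrA; congr (_ + _); rewrite addrC; congr (_ - _).
by apply: eq_bigr => i; rewrite /mutL => /negbTE ->.
Qed.

Lemma in_sumE A B k x : in_sum A B k x = \sum_i (if 0 < B i k then (A k i)%:~R else 0) * x i.
Proof.
rewrite /in_sum big_mkcond; apply: eq_bigr => i _; case: ifP => //; by rewrite mul0r.
Qed.

Lemma lin_mutate_k A B k x : skew_by B -> companion B A ->
  lin (mutate_companion A B k) x k = lin A (mutL A B k x) k.
Proof.
move=> s c; have [c1 c2 c3] := c; rewrite lin_mutL c1 in_sumE mulr_sumr /lin -sumrB.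
apply: eq_bigr => i _; rewrite mulrA -mulrBl; congr (_ * _).
have [->|ik] := eqVneq i k.
  by rewrite mutate_companion_diag // (skew_diag _ s) ltxx mulr0 subr0 c1.
rewrite mutate_companion_row //; case: ifP => _; last by rewrite !subr0 mulr0 subr0.
by rewrite rmorphB /= rmorphM.
Qed.

(** With [lin_mutate_k] this is the congruence [D A' = L^T (D A) L] for the substitution [L] given
    by [mutL], read row by row after cancelling [D]. *)
Lemma lin_mutate A B k x j : skew_by B -> companion B A -> j != k ->
  lin (mutate_companion A B k) x j = lin A (mutL A B k x) j -
    (if 0 < B j k then (A j k)%:~R else 0) * lin A (mutL A B k x) k.
Proof.
move=> s c jk; have [c1 c2 c3] := c; rewrite !lin_mutL c1 in_sumE !mulr_sumr /lin -!sumrB.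
rewrite mulr_sumr -sumrB; apply: eq_bigr => i _.
have -> : forall a b e f g : F, a * x i - b * (e * x i) - f * (g * x i - 2%:~R * (e * x i)) =
  (a - b * e - f * (g - 2%:~R * e)) * x i by move=> *; ring.
congr (_ * _).
have -> : (if 0 < B i k then (A k i)%:~R else 0) = (if 0 < B i k then A k i else 0)%:~R :> F by case: ifP.
have -> : (if 0 < B j k then (A j k)%:~R else 0) = (if 0 < B j k then A j k else 0)%:~R :> F by case: ifP.
rewrite -!rmorphM -!rmorphB -!rmorphM -!rmorphB /=.
congr (_%:~R); have [->|ik] := eqVneq i k.
  rewrite mutate_companion_col // (skew_diag _ s) ltxx c1; case: ifP => _; lia.
have ki : k != i by rewrite eq_sym.
have [g e] := skew_sgn i k s; have [g' e'] := skew_sgn j k s.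
have ei := companion_eq0 ki c; have ej := companion_eq0 jk c.
rewrite mxE (negbTE ik) (negbTE jk) /=.
have [h1|h1] := ltP 0 (B i k); have [h2|h2] := ltP 0 (B j k).
- have -> : 0 < B j k * B k i = false by nia.
  lia.
- have [h3|h3] := eqVneq (B j k) 0.
    have -> : A j k = 0 by lia.
    by rewrite h3 !mul0r ltxx; lia.
  have -> : 0 < B j k * B k i by nia.
  lia.
- have [h3|h3] := eqVneq (B k i) 0.
    have -> : A k i = 0 by lia.
    by rewrite h3 !mulr0 ltxx; lia.
  have -> : 0 < B j k * B k i by nia.
  lia.
- have -> : 0 < B j k * B k i = false by nia.
  lia.
Qed.

Lemma qform_mutate A B k x : skew_by B -> companion B A ->
  qform (mutate_companion A B k) x = qform A (mutL A B k x).
Proof.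
move=> s c; have [c1 c2 c3] := c; set v := lin A (mutL A B k x).
transitivity (\sum_j ((d j)%:~R * x j * v j) - (d k)%:~R * v k * in_sum A B k x).
  rewrite in_sumE mulr_sumr -sumrB; apply: eq_bigr => j _.
  have [->|jk] := eqVneq j k.
    by rewrite lin_mutate_k // (skew_diag _ s) ltxx mul0r mulr0 subr0.
  rewrite lin_mutate // -/v mulrBr; congr (_ - _); case: ifP => _; last by rewrite !mul0r !mulr0.
  have : (d j)%:~R * (A j k)%:~R = (d k)%:~R * (A k j)%:~R :> F by rewrite -!rmorphM /= c2.
  move=> E; rewrite mulrA [_ * (A j k)%:~R]mulrAC E; ring.
rewrite /qform (bigD1 k) //= [in RHS](bigD1 k) //= -/v {1}/mutL eqxx.
rewrite -[X in _ = _ + X](@eq_bigr _ _ _ _ _ _ (fun j => (d j)%:~R * x j * v j)); last first.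
  by move=> i /negbTE ik; rewrite /mutL ik.
ring.
Qed.

Lemma pd_mutate A B k : skew_by B -> companion B A -> pd A -> pd (mutate_companion A B k).
Proof.
move=> s c p x [i xi]; rewrite qform_mutate //; apply: p.
have [ik|ik] := eqVneq i k; last by exists i; rewrite /mutL (negbTE ik).
case: (boolP [exists j, (j != k) && (x j != 0)]) => [/existsP[j /andP[jk xj]]|].
  by exists j; rewrite /mutL (negbTE jk).
rewrite negb_exists => /forallP H; exists k; rewrite /mutL eqxx /in_sum big1 ?subr0 -?ik //.
move=> j Hj; have := H j; rewrite negb_and !negbK => /orP[/eqP jk|/eqP ->]; last by rewrite mulr0.
by move: Hj; rewrite jk ik (skew_diag _ s).
Qed.

End Form.
End Mutation.

Lemma mul_lt0_same (u a b : int) : u * a < 0 -> u * b < 0 -> 0 < a * b.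
Proof.
case: (ltgtP u 0) => [u0|u0|->]; last by rewrite mul0r ltxx.
  by rewrite !nmulr_rlt0 // => *; apply: mulr_gt0.
by rewrite !pmulr_rlt0 // => *; rewrite nmulr_rgt0.
Qed.

(** * Transfer between matrices that agree on a vertex set *)

Section Subgraphs.
Variable n : nat.
Implicit Types (C : 'M[int]_n) (l Z : seq 'I_n) (k x y w z : 'I_n).

Lemma eq_induced_path C C' l :
  {in l &, forall u v, (C u v != 0) = (C' u v != 0)} -> induced_path C l = induced_path C' l.
Proof.
elim: l => //= x l IH E; rewrite IH; last first.
  by move=> u v ul vl; apply: E; rewrite inE ?ul ?vl orbT.
congr [&& _, _ & _]; apply: eq_in_all => y yl; rewrite E ?mem_head //.
by rewrite inE yl orbT.
Qed.

Lemma eq_ear C C' k l :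
  {in k :: l &, forall u v, (C u v != 0) = (C' u v != 0)} -> ear C k l = ear C' k l.
Proof.
move=> E; rewrite /ear (@eq_induced_path C C'); last first.
  by move=> u v ul vl; apply: E; rewrite inE ?ul ?vl orbT.
congr [&& _, _, _ & _]; apply: eq_in_all => y yl; rewrite E ?mem_head //.
by rewrite inE yl orbT.
Qed.

Lemma eq_pprod (f g : 'I_n -> 'I_n -> int) x l :
  {in x :: l &, forall u v, f u v = g u v} -> pprod f x l = pprod g x l.
Proof.
elim: l x => //= y l IH x E; rewrite E ?mem_head ?inE ?eqxx ?orbT //; congr (_ * _).
by apply: IH => u v ul vl; apply: E; rewrite inE ?ul ?vl orbT.
Qed.

Lemma eq_cprod (f g : 'I_n -> 'I_n -> int) Z :
  {in Z &, forall u v, f u v = g u v} -> cprod f Z = cprod g Z.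
Proof.
case: Z => //= k l E; apply: eq_pprod => u v; rewrite !inE !mem_rcons !inE !orbA !orbb.
by move=> ul vl; apply: E; rewrite inE.
Qed.

Lemma eq_passes C C' Z x : {in Z, forall y, C x y = C' x y} -> passes C Z x = passes C' Z x.
Proof. by move=> E; congr (_ && _); apply: eq_in_has => y yZ; rewrite E. Qed.

Lemma passes_two C Z x a b : passes C Z x ->
  (forall y, y \in Z -> C x y != 0 -> y = a \/ y = b) -> C x a * C x b < 0.
Proof.
move=> /andP[/hasP[y yZ Hy] /hasP[y' yZ' Hy']] H.
by case: (H _ yZ ltac:(lia)) => ?; case: (H _ yZ' ltac:(lia)) => ?; subst; nia.
Qed.

Lemma pprod_ipath C (f g : 'I_n -> 'I_n -> int) x l : induced_path C (x :: l) ->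
  {in x :: l &, forall u v, C u v != 0 -> f u v = g u v} -> pprod f x l = pprod g x l.
Proof.
elim: l x => //= y l IH x /andP[Hi /and3P[_ Hx _]] E.
rewrite (E x y) ?mem_head ?inE ?eqxx ?orbT //; last by rewrite (eqP Hx) eqxx.
congr (_ * _); apply: IH => // u v ul vl; apply: E; rewrite inE ?ul ?vl orbT //.
Qed.

Lemma induced_path_last C l y v : sym_support C -> induced_path C (rcons l y) -> v \in l ->
  (C y v != 0) = (v == last y l).
Proof.
move=> sC; elim: l => //= x l IH /and3P[Hi xl /allP Hx].
rewrite inE => /orP[/eqP->|vl]; last first.
  by rewrite IH //; case: (l) vl.
have := Hx y; rewrite mem_rcons mem_head => /(_ isT)/eqP; rewrite sC => ->.
case: l {IH Hx} Hi xl => [|a l] /= Hi xl; first by rewrite !eqxx.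
have [_ ay _] := and3P Hi.
rewrite mem_rcons inE negb_or eq_sym in ay; have [/negbTE -> _] := andP ay.
apply/esym/negbTE; apply: contraNneq xl => ->.
by rewrite -rcons_cons mem_rcons inE mem_last orbT.
Qed.

(** * Wheels: a chordless cycle with a hub [k] outside it *)

Section Wheel.
Variables (C : 'M[int]_n) (f : 'I_n -> 'I_n -> int) (k : 'I_n).
Hypothesis sC : sym_support C.
Hypothesis C0 : forall i, C i i = 0.
Hypothesis fC : forall x y, f x y = f y x.
Hypothesis f1 : forall x y, x != y -> C x y != 0 -> f x y * f x y = 1.
Hypothesis Hk : forall l, ear C k l ->
  (forall x, x \in k :: l -> passes C (k :: l) x) /\ cprod f (k :: l) = -1.

(** The spoke sign twisted by the spoke direction. The two spokes of an oriented sector have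
    opposite directions, so the twist absorbs the -1 of an odd sector and arc products telescope. *)
Let h w := f k w * Num.sg (C k w).

Lemma spoke_sign_sq w : C k w != 0 -> h w * h w = 1.
Proof.
move=> Hw; have kw : k != w by apply: contraNneq Hw => <-; rewrite C0.
have := f1 kw Hw; rewrite /h => E; have E2 : Num.sg (C k w) * Num.sg (C k w) = 1.
  by rewrite -sgrM gtr0_sg //; nia.
by rewrite mulrACA E E2.
Qed.

Lemma arc w seg y : ear C k (w :: rcons seg y) ->
  [/\ pprod f w (rcons seg y) = h w * h y, C y k * C y (last w seg) < 0
    & C w k * C w (head y seg) < 0].
Proof.
move=> E; have [Hp Hc] := Hk E.
have kw : C k w != 0 by apply: (ear_adj_head E).
have ky : C k y != 0 by have := ear_adj_last E; rewrite /= last_rcons.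
have nkw : k != w by apply: contraNneq kw => <-; rewrite C0.
have nky : k != y by apply: contraNneq ky => <-; rewrite C0.
have Pk : C k w * C k y < 0.
  by have := Hp k (mem_head _ _); rewrite (ear_passes (C0 k) E) /= last_rcons.
have [Hi _ kl _] := and4P E.
have wy : w != y.
  by have := induced_path_uniq Hi; rewrite /= mem_rcons inE negb_or => /andP[/andP[]].
split.
- move: Hc; rewrite /cprod rcons_cons /= pprod_rcons last_rcons (fC y k) => Hc.
  have a1 := f1 nkw kw; have a2 := f1 nky ky.
  have sg1 : Num.sg (C k w) * Num.sg (C k y) = -1 by rewrite -sgrM ltr0_sg.
  rewrite /h mulrACA sg1 mulrN1.
  set p := pprod _ _ _ in Hc *; have : f k w * f k w * (f k y * f k y) * p = - (f k w * f k y).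
    by rewrite -[RHS]mulrN1 -Hc; ring.
  by rewrite a1 a2 !mul1r.
- have yZ : y \in k :: w :: rcons seg y by rewrite !inE mem_rcons mem_head !orbT.
  have Py := Hp y yZ.
  apply: (passes_two Py) => v; rewrite inE => /orP[/eqP->|vl]; first by left.
  move=> Cyv; right; move: Hi vl; rewrite -rcons_cons mem_rcons inE => Hi /orP[/eqP vy|vl].
    by move: Cyv; rewrite vy C0 eqxx.
  by move: Cyv; rewrite (induced_path_last sC Hi vl) => /eqP.
- have Pw := Hp w; rewrite !inE eqxx orbT in Pw; have {}Pw := Pw isT.
  apply: (passes_two Pw) => v; rewrite inE => /orP[/eqP->|]; first by left.
  rewrite inE => /orP[/eqP ->|vl]; first by rewrite C0 eqxx.
  have [_ _ /allP Hw] := and3P Hi; rewrite (eqP (Hw _ vl)) => /eqP ->; right.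
  by case: (seg).
Qed.

(** Telescopes [arc] over successive spokes: [seg] holds the rim vertices met since the last spoke
    [w], [R] those still to come. The last hypothesis lets [z] be adjacent to [w], as happens on a
    closed rim, provided another spoke separates them; otherwise the final sector would have a
    chord. *)
Lemma arc_run R w seg z : C k w != 0 -> C k z != 0 -> all (fun y => C k y == 0) seg ->
  induced_path C (w :: seg ++ R) -> z \notin w :: seg ++ R -> k \notin w :: seg ++ R -> k != z ->
  all (fun y => (C z y != 0) == (y == last w (seg ++ R))) (seg ++ R) ->
  (seg ++ R = [::] -> C z w != 0) ->
  (seg ++ R <> [::] -> C z w != 0 -> has (fun y => C k y != 0) R) ->
  pprod f w (rcons (seg ++ R) z) = h w * h z /\ C z k * C z (last w (seg ++ R)) < 0.
Proof.
move=> kw + + + + + kz; elim: R w seg kw => [|y R IH] w seg kw kz' Hseg Hi zl kl Hz Hz1 Hz2.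
  rewrite cats0 in Hi zl kl Hz Hz1 Hz2 *.
  suff E : ear C k (w :: rcons seg z) by case: (arc E).
  rewrite -rcons_cons; apply/and4P; split.
  - apply: induced_path_rcons => //=; apply/andP; split; last first.
      by case: (seg) Hz.
    case: seg Hi Hz Hz1 Hz2 {Hseg zl kl} => [|a seg] Hi Hz Hz1 Hz2 /=.
      by rewrite eqxx Hz1.
    have -> : (w == last a seg) = false.
      apply/negbTE; have /andP[] := induced_path_uniq Hi.
      by move=> H _; apply: contraNneq H => ->; rewrite mem_last.
    by case: (boolP (C z w != 0)) => // Hzw; have := Hz2 ltac:(done) Hzw.
  - by rewrite /= size_rcons.
  - by rewrite mem_rcons inE negb_or kz.
  - rewrite /= last_rcons eqxx kw /=; apply/allP => y; rewrite mem_rcons inE => /orP[/eqP->|ys].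
      by rewrite kz' eqxx orbT.
    rewrite (eqP (allP Hseg _ ys)) eqxx /=; apply/eqP; apply/esym/negbTE; rewrite negb_or.
    apply/andP; split.
      by have /andP[H _] := induced_path_uniq Hi; apply: contraNneq H => <-.
    by apply: contraNneq zl => <-; rewrite inE ys orbT.
have [ky|ky] := eqVneq (C k y) 0.
  have E : seg ++ y :: R = rcons seg y ++ R by rewrite cat_rcons.
  rewrite E in Hi zl kl Hz Hz1 Hz2 *; apply: IH => //.
    by rewrite all_rcons ky eqxx.
  by move=> h1 h2; have := Hz2 h1 h2; rewrite /= ky eqxx.
have Ei : induced_path C (w :: rcons seg y).
  by move: Hi; rewrite -cat_rcons -cat_cons => /induced_path_catl.
have uw := induced_path_uniq Hi.
have E : ear C k (w :: rcons seg y).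
  apply/and4P; split => //.
  - by rewrite /= size_rcons.
  - move: kl; rewrite -cat_rcons -cat_cons mem_cat negb_or => /andP[] //.
  - rewrite /= last_rcons eqxx kw /=; apply/allP => v; rewrite mem_rcons inE => /orP[/eqP->|vs].
      by rewrite ky eqxx orbT.
    rewrite (eqP (allP Hseg _ vs)) eqxx /=; apply/eqP; apply/esym/negbTE; rewrite negb_or.
    have := induced_path_uniq Ei; rewrite /= mem_rcons inE negb_or rcons_uniq.
    move=> /andP[/andP[_ ws] /andP[ys _]].
    by apply/andP; split; [apply: contraNneq ws => <-|apply: contraNneq ys => <-].
have [A1 _ _] := arc E.
have [] := IH y [::] ky kz' isT.
- by move: Hi; rewrite -cat_cons => /induced_path_catr.
- by apply: contraNN zl => /= H; rewrite -cat_cons mem_cat H orbT.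
- by apply: contraNN kl => /= H; rewrite -cat_cons mem_cat H orbT.
- move: Hz; rewrite all_cat last_cat /= => /andP[_ /andP[_]] //.
- move=> /= ER; move: Hz; rewrite ER all_cat last_cat /= => /andP[_ /andP[/eqP -> _]].
  exact: eqxx.
- move=> /= R0 zy; move: Hz; rewrite all_cat last_cat /= => /andP[_ /andP[/eqP]].
  rewrite zy => /esym/eqP Ey _; have := induced_path_catr (l1 := w :: seg) Hi.
  move=> /induced_path_uniq /= /andP[+ _]; rewrite {1}Ey; case: (R) R0 => // a R' _.
  by rewrite /= mem_last.
move=> A2 A3; split; last by rewrite last_cat.
rewrite -cat_rcons rcons_cat pprod_cat A1 last_rcons A2.
by rewrite mulrA -(mulrA (h w)) (spoke_sign_sq ky) mulr1.
Qed.

(** Arc products telescope around the rim to [h z * h z = 1]. In each of the two sectors at [z] the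
    rim edge is opposed to the spoke, so both rim edges at [z] point the same way. The last two
    hypotheses exclude a hub with just two adjacent spokes, where the long side has a chord. *)
Lemma wheel z l s1 y1 r : ear C z l -> k \notin z :: l -> C k z != 0 ->
  l = s1 ++ y1 :: r -> all (fun y => C k y == 0) s1 -> C k y1 != 0 -> r <> [::] ->
  (s1 = [::] -> has (fun y => C k y != 0) r) ->
  cprod f (z :: l) = 1 /\ ~~ passes C (z :: l) z.
Proof.
move=> E kl kz El Hs ky r0 Hsr; have [Hi sl zl /allP Hz] := and4P E.
have nkz : k != z by move: kl; rewrite inE negb_or => /andP[].
have kl' : k \notin l by move: kl; rewrite inE negb_or => /andP[].
have ul := induced_path_uniq Hi.
have lastr : last z l \in r.
  by rewrite El last_cat /=; case: (r) r0 => // a r' _; rewrite /= mem_last.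
have notr v : v \in rcons s1 y1 -> v \in r = false.
  move=> Hv; apply/negbTE; move: ul; rewrite El -cat_rcons cat_uniq => /and3P[_ /hasPn H _].
  by apply/negP => vr; have := H _ vr; rewrite Hv.
have E1 : ear C k (z :: rcons s1 y1).
  apply/and4P; split.
  - apply/and3P; split; first by move: Hi; rewrite El -cat_rcons => /induced_path_catl.
      by apply: contraNN zl; rewrite El -cat_rcons mem_cat => ->.
    apply/allP => v vs; have /Hz /eqP -> : v \in l by rewrite El -cat_rcons mem_cat vs.
    have -> : (v == last z l) = false.
      by apply/negbTE; apply: contraTneq lastr => <-; rewrite notr.
    by rewrite orbF El; case: (s1).
  - by rewrite /= size_rcons.
  - apply: contraNN kl; rewrite El -cat_rcons !inE mem_cat => /orP[->|->] //.
    by rewrite orbT.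
  - rewrite /= last_rcons eqxx kz /=; apply/allP => v; rewrite mem_rcons inE => /orP[/eqP->|vs].
      by rewrite ky eqxx orbT.
    rewrite (eqP (allP Hs _ vs)) eqxx /=; apply/eqP; apply/esym/negbTE; rewrite negb_or.
    apply/andP; split; first by apply: contraNneq zl => <-; rewrite El mem_cat vs.
    move: ul; rewrite El -cat_rcons cat_uniq rcons_uniq => /and3P[/andP[H _] _ _].
    by apply: contraNneq H => <-.
have [A1 _ A3] := arc E1.
have Hyr v : v \in r -> (C z v != 0) = (v == last z l).
  move=> vr; have /Hz /eqP -> : v \in l by rewrite El mem_cat inE vr !orbT.
  suff -> : (v == head z l) = false by [].
  apply/negbTE; apply: contraTneq vr => ->; rewrite notr // El.
  by case: (s1) => [|a s]; rewrite /= ?inE ?eqxx.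
have Elast : last y1 r = last z l by rewrite El last_cat.
have [|||||||B1 B2] := @arc_run r y1 [::] z ky kz isT.
- by move: Hi; rewrite El => /induced_path_catr.
- by apply: contraNN zl; rewrite El mem_cat => ->; rewrite orbT.
- by apply: contraNN kl'; rewrite El mem_cat => ->; rewrite orbT.
- exact: nkz.
- by apply/allP => v vr; rewrite /= Hyr // Elast.
- by [].
- move=> _ zy; case: (s1 =P [::]) => [/Hsr //|s10]; move: zy.
  have /Hz /eqP -> : y1 \in l by rewrite El mem_cat mem_head orbT.
  have -> : (y1 == last z l) = false.
    by apply/negbTE; apply: contraTneq lastr => <-; rewrite notr // mem_rcons mem_head.
  move: ul; rewrite El; case: (s1) s10 => // a s _ /=.
  by rewrite mem_cat inE !negb_or orbF eq_sym => /andP[/and3P[_ /negbTE -> _] _].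
rewrite /= in B1 B2; split.
  rewrite /cprod El rcons_cat rcons_cons -cat_rcons pprod_cat last_rcons A1 B1.
  by rewrite mulrA -(mulrA (h z)) (spoke_sign_sq ky) mulr1 (spoke_sign_sq kz).
rewrite (ear_passes (C0 z) E) -leNgt.
have -> : head z l = head y1 s1 by rewrite El; case: (s1).
by rewrite -Elast; apply/ltW/(mul_lt0_same A3 B2).
Qed.

End Wheel.
End Subgraphs.

(** * How mutation changes chordless cycles *)

Lemma int_ge2 (a b : int) : 0 < a -> a < b -> 2 <= b.
Proof. by lia. Qed.

Section CycleMutation.
Variables (n : nat) (d : 'I_n -> int).
Hypothesis d_gt0 : forall i, 0 < d i.
Variables (B A : 'M[int]_n) (k : 'I_n).
Implicit Types (i j x y u v w : 'I_n) (l Z : seq 'I_n).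
Hypothesis s : skew_by d B.
Hypothesis c : companion d B A.
Hypothesis oB : oriented B.
Hypothesis aB : odd_signs B A.
Hypothesis wt : forall i j, i != j -> `|B i j * B j i| < 4.

Let B' := mutate B k.
Let A' := mutate_companion A B k.
Let f := sgn_edge A.
Let f' := sgn_edge A'.

Let s' : skew_by d B'. Proof. exact: mutate_skew. Qed.
Let g : good_triangles B A. Proof. exact: oriented_good. Qed.
Let c' : companion d B' A'. Proof. exact: mutate_companion_comp. Qed.
Let sB := skew_sym d_gt0 s.
Let sB' := skew_sym d_gt0 s'.
Let B0 i : B i i = 0. Proof. exact: skew_diag. Qed.
Let B'0 i : B' i i = 0. Proof. exact: skew_diag. Qed.

Lemma skew_sg i j : Num.sg (B j i) = - Num.sg (B i j).
Proof.
have : Num.sg (d i * B i j) = - Num.sg (d j * B j i) by rewrite s sgrN.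
by rewrite !sgrM (gtr0_sg (d_gt0 i)) (gtr0_sg (d_gt0 j)) !mul1r => ->; rewrite opprK.
Qed.

Lemma mutate_same i j : i != k -> j != k -> B i k * B k j <= 0 -> B' i j = B i j /\ A' i j = A i j.
Proof.
move=> ik jk H; split; first exact: mutate_npos.
by rewrite mxE (negbTE ik) (negbTE jk) /= ltNge H /= subr0.
Qed.

Lemma pair_old i j : i != j -> i != k -> j != k -> 0 < B i k * B k j -> B i j != 0 ->
  Num.sg (B i j) = - Num.sg (B i k) /\ Num.sg (A i j) = Num.sg (A i k) * Num.sg (A k j).
Proof.
move=> ij ik jk H b0; have [g1 g2] := g ij ik jk H b0; split.
  have : Num.sg (B i j) * Num.sg (B i k) = -1 by rewrite -sgrM ltr0_sg.
  have [h|[h|h]] : B i k = 0 \/ 0 < B i k \/ B i k < 0 by lia.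
  - by rewrite h sgr0 mulr0.
  - by rewrite (gtr0_sg h) mulr1.
  - by rewrite (ltr0_sg h) mulrN1; lia.
have : Num.sg (A i j) * Num.sg (A i k * A k j) = 1 by rewrite -sgrM gtr0_sg.
rewrite -(sgrM (A i k)); have [h|[h|h]] : A i k * A k j = 0 \/ 0 < A i k * A k j \/ A i k * A k j < 0 by lia.
- by rewrite h sgr0 mulr0.
- by rewrite (gtr0_sg h) mulr1.
- by rewrite (ltr0_sg h) mulrN1; lia.
Qed.

(* The bound [wt] rules out that the new edge points the wrong way round. *)
Lemma pair_new i j : i != j -> i != k -> j != k -> 0 < B i k * B k j -> B' i j != 0 ->
  Num.sg (B' i j) = Num.sg (B i k) /\ Num.sg (A' i j) = - (Num.sg (A i k) * Num.sg (A k j)).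
Proof.
move=> ij ik jk H b0; have Eb : B' i j = B i j + Num.sg (B i k) * (B i k * B k j).
  exact: mutate_pos.
have H' : 0 < B j k * B k i.
  have := s j k; have := s k i; have := d_gt0 i; have := d_gt0 j; have := d_gt0 k.
  have [g1 e1] := skew_sgn d_gt0 i k s; have [g2 e2] := skew_sgn d_gt0 j k s; nia.
have Eb' : B' j i = B j i + Num.sg (B j k) * (B j k * B k i).
  by apply: mutate_pos => //.
have Ea : A' i j = A i j - A i k * A k j by rewrite mxE (negbTE ik) (negbTE jk) /= H.
have kj : k != j by rewrite eq_sym.
have [_ _ cn] := c; have [_ _ cn'] := c'.
have Na : `|A i k * A k j| = B i k * B k j by rewrite normrM !cn // -normrM ger0_norm // ltW.
have [b1|b1] := eqVneq (B i j) 0.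
  have a1 : A i j = 0 by apply/eqP; rewrite (companion_eq0 ij c) b1.
  split; first by rewrite Eb b1 add0r sgrM sgr_id (gtr0_sg H) mulr1.
  by rewrite Ea a1 sub0r sgrN sgrM.
have [o1 o2] := pair_old ij ik jk H b1.
have nB : `|B i j| < B i k * B k j.
  have o1' : B j i != 0 by rewrite -sB.
  have ji : j != i by rewrite eq_sym.
  have [p1 _] := pair_old ji jk ik H' o1'.
  have w := wt ij; have E1 := numEsg (B i j); have E2 := numEsg (B j i).
  rewrite ltNge; apply/negP => le1.
  have lt1 : B i k * B k j < `|B i j|.
    rewrite lt_neqAle le1 andbT; apply: contraNneq b0 => E; rewrite Eb E1 o1 -E; apply/eqP; ring.
  (* The symmetrizer scales both sides alike, so the transposed entry also exceeds a positive
     product. Both absolute values are then at least 2, against the bound 4 on their product. *)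
  have lt2 : B j k * B k i < `|B j i|.
    have E3 : `|B j i| * d j = `|B i j| * d i.
      have := s i j => Es; have : `|d i * B i j| = `|d j * B j i| by rewrite Es normrN.
      by rewrite !normrM !(gtr0_norm (d_gt0 _)) mulrC => ->; rewrite mulrC.
    have E4 : B j k * B k i * d j = B i k * B k j * d i.
      have e1 := s j k; have e2 := s i k.
      have -> : B j k * B k i * d j = (d j * B j k) * B k i by ring.
      have -> : B i k * B k j * d i = (d i * B i k) * B k j by ring.
      by rewrite e1 e2; ring.
    rewrite -(ltr_pM2r (d_gt0 j)) E3 E4 ltr_pM2r //.
  move: w; rewrite normrM => w.
  have : 2 * 2 <= `|B i j| * `|B j i|.
    by apply: ler_pM => //; [apply: int_ge2 H lt1|apply: int_ge2 H' lt2].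
  by rewrite leNgt w.
split.
  rewrite Eb; have := numEsg (B i j); rewrite o1 => E1; rewrite E1.
  have -> : - Num.sg (B i k) * `|B i j| + Num.sg (B i k) * (B i k * B k j) =
    Num.sg (B i k) * (B i k * B k j - `|B i j|) by ring.
  by rewrite sgrM sgr_id [X in _ * X]gtr0_sg ?mulr1 // subr_gt0.
rewrite Ea -sgrM; set p := A i k * A k j; have E1 := numEsg (A i j).
rewrite o2 -sgrM cn // -/p in E1; have E2 := numEsg p; rewrite Na in E2.
have -> : A i j - p = Num.sg p * (`|B i j| - B i k * B k j) by rewrite mulrBr -E1 -E2.
by rewrite sgrM sgr_id [X in _ * X]ltr0_sg ?mulrN1 // subr_lt0.
Qed.

Lemma mutated_sgn_sym x y : f' x y = f' y x.
Proof. by rewrite /f' /sgn_edge !sgrN (companion_sg d_gt0 x y c'). Qed.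

Lemma mutated_sgn_sq x y : x != y -> B' x y != 0 -> f' x y * f' x y = 1.
Proof.
move=> xy; rewrite -(companion_eq0 xy c') => a0; rewrite /f' /sgn_edge -sgrM gtr0_sg //.
by nia.
Qed.

Lemma sg_gt0E (a b : int) : Num.sg a = Num.sg b -> (0 < a) = (0 < b).
Proof. by move=> E; rewrite -sgr_gt0 E sgr_gt0. Qed.
Lemma sg_lt0E (a b : int) : Num.sg a = Num.sg b -> (a < 0) = (b < 0).
Proof. by move=> E; rewrite -sgr_lt0 E sgr_lt0. Qed.

Lemma passes_sub (C C' : 'M[int]_n) Z Z' w : passes C Z w ->
  (forall a, a \in Z -> C w a != 0 -> exists2 b, b \in Z' & Num.sg (C' w b) = Num.sg (C w a)) ->
  passes C' Z' w.
Proof.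
move=> /andP[/hasP[a aZ Ha] /hasP[a' aZ' Ha']] H; apply/andP; split; apply/hasP.
  have [|b bZ E] := H a aZ; first by rewrite gt_eqF.
  by exists b => //; rewrite (sg_gt0E E).
have [|b bZ E] := H a' aZ'; first by rewrite lt_eqF.
by exists b => //; rewrite (sg_lt0E E).
Qed.

Lemma passes_intro (C : 'M[int]_n) Z x a b : a \in Z -> b \in Z ->
  Num.sg (C x a) * Num.sg (C x b) = -1 -> passes C Z x.
Proof.
move=> aZ bZ; rewrite -sgrM => /eqP; rewrite sgr_cp0 => H.
have [h|h|h] := ltgtP (C x a) 0.
- by apply/andP; split; apply/hasP; [exists b|exists a] => //; rewrite -(nmulr_rlt0 _ h).
- by apply/andP; split; apply/hasP; [exists a|exists b] => //; rewrite -(pmulr_rlt0 _ h).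
- by move: H; rewrite h mul0r ltxx.
Qed.

Lemma sg2 (a : int) : a != 0 -> Num.sg a * Num.sg a = 1.
Proof. by move=> a0; rewrite -sgrM gtr0_sg // -expr2 exprn_even_gt0. Qed.

Lemma row_sg w : w != k -> B k w != 0 -> Num.sg (A' k w) = Num.sg (B k w) * Num.sg (A k w).
Proof.
move=> wk b0; rewrite mxE (negbTE wk) eqxx /=; case: ltP => h.
  by rewrite (gtr0_sg h) mul1r.
have h' : B k w < 0 by rewrite lt_neqAle b0 h.
by rewrite sgrN (ltr0_sg h') mulN1r.
Qed.

Lemma spokes_sg y x : y != k -> x != k -> B k y * B k x < 0 ->
  f' k y * f' x k = - (Num.sg (A k y) * Num.sg (A k x)).
Proof.
move=> yk xk H; rewrite (mutated_sgn_sym x k) /f' /sgn_edge !sgrN mulrNN.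
have h1 : B k y != 0 by apply: contraTneq H => ->; rewrite mul0r.
have h2 : B k x != 0 by apply: contraTneq H => ->; rewrite mulr0.
by rewrite !row_sg // mulrACA -sgrM (ltr0_sg H) mulN1r.
Qed.

Lemma nz_k w : (B' k w != 0) = (B k w != 0).
Proof. by rewrite /B' mutate_row oppr_eq0. Qed.

Lemma opp_path y x : B k y * B k x < 0 -> 0 < B y k * B k x.
Proof.
move=> H; rewrite -sgr_gt0 sgrM (skew_sg k y) mulNr -sgrM oppr_gt0 sgr_lt0 //.
Qed.

(** Apart from triangles, such a cycle comes from a chordless cycle of [B] missing [k]: the edge
    between the two neighbours of [k] is cancelled, and the path through [k] takes over its
    direction and its sign. *)
Lemma ear_at_k l : ear B' k l ->
  (forall x, x \in k :: l -> passes B' (k :: l) x) /\ cprod f' (k :: l) = -1.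
Proof.
case: l => [|y l1] E; first by have := and4P E => -[].
have [Hi sl kl _] := and4P E; have /and3P[Hi1 yl1 /allP Hy] := Hi.
pose x := last y l1.
have l10 : l1 <> [::] by move=> e; rewrite e in sl.
have xl1 : x \in l1 by rewrite /x; case: (l1) l10 => // a l _; rewrite /= mem_last.
have xl : x \in y :: l1 by rewrite inE xl1 orbT.
have yl : y \in y :: l1 by rewrite mem_head.
have nk w : w \in y :: l1 -> w != k by move=> wl; apply: contraNneq kl => <-.
have xy : x != y by apply: contraNneq yl1 => <-.
have adj w : w \in y :: l1 -> (B k w != 0) = (w == y) || (w == x).
  by move=> wl; rewrite -nz_k (ear_adj E wl).
have bky : B k y != 0 by rewrite adj // eqxx.
have bkx : B k x != 0 by rewrite adj // eqxx orbT.
have unatt w : w \in y :: l1 -> w != y -> w != x -> B k w = 0 /\ B w k = 0.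
  move=> wl wy wx; have : ~~ (B k w != 0) by rewrite adj // negb_or wy wx.
  by rewrite negbK => /eqP h; split => //; apply/eqP; rewrite (skew_eq0 d_gt0 _ _ s) h.
have same u v : u \in y :: l1 -> v \in y :: l1 ->
    ~~ ((u == x) && (v == y)) -> ~~ ((u == y) && (v == x)) -> B u k * B k v <= 0.
  move=> ul vl; have [->|ux] := eqVneq u x; have [->|vy] := eqVneq v y => //= _.
  - have [->|vx] := eqVneq v x => _; last by rewrite (unatt v vl vy vx).1 mulr0.
    by rewrite -sgr_le0 sgrM (skew_sg k x) mulNr sg2.
  - have [->|uy] := eqVneq u y => _; last by rewrite (unatt u ul uy ux).2 mul0r.
    by rewrite -sgr_le0 sgrM (skew_sg k y) mulNr sg2.
  - have [->|uy] := eqVneq u y => /= vx; last by rewrite (unatt u ul uy ux).2 mul0r.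
    by rewrite (unatt v vl vy vx).1 mulr0.
(* Were the two spokes both outgoing or both incoming, the mutation would only reverse them, and the
   cycle would be a chordless cycle of [B] that is not oriented at [k]. *)
have t2 : B k y * B k x < 0.
  rewrite ltNge le_eqVlt negb_or eq_sym mulf_neq0 //=; apply/negP => H.
  suff : ear B k (y :: l1) by move=> /oB /= ; rewrite -/x ltNge ltW.
  rewrite -(@eq_ear _ B') // => u v; rewrite inE => /orP[/eqP->|ul].
    by rewrite nz_k.
  rewrite inE => /orP[/eqP->|vl]; first by rewrite sB' nz_k sB.
  suff hs : B u k * B k v <= 0 by rewrite (mutate_same (nk _ ul) (nk _ vl) hs).1.
  have neg a b : 0 < B k a * B k b -> B a k * B k b <= 0.
    move=> h; apply: ltW; rewrite -sgr_lt0 sgrM (skew_sg k a) mulNr -sgrM oppr_lt0 sgr_gt0 //.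
  case: (boolP ((u == x) && (v == y))) => [/andP[/eqP-> /eqP->]|h1].
    by apply: neg; rewrite mulrC.
  case: (boolP ((u == y) && (v == x))) => [/andP[/eqP-> /eqP->]|h2]; first exact: neg.
  exact: same.
have Hyx := opp_path t2; have Hxy : 0 < B x k * B k y by apply: opp_path; rewrite mulrC.
have yx : y != x by rewrite eq_sym.
have pk : passes B' (k :: y :: l1) k.
  by rewrite (ear_passes (B'0 k) E) /= /B' !mutate_row mulrNN.
have Skx := sg2 bkx; have Sky := sg2 bky.
have akx : A k x != 0 by rewrite (companion_eq0 _ c) // eq_sym nk.
have aky : A k y != 0 by rewrite (companion_eq0 _ c) // eq_sym nk.
have Sax := sg2 akx; have Say := sg2 aky.
have sp := spokes_sg (nk _ yl) (nk _ xl) t2.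
have Bkneg w : Num.sg (B' w k) = - Num.sg (B w k) by rewrite /B' mutate_col sgrN.
have bwk w : B k w != 0 -> Num.sg (B w k) * Num.sg (B w k) = 1 by move=> h; rewrite sg2 // -sB.
case El: l1 => [|h l2] //; have [l20|l20] := eqVneq l2 [::].
  subst l2; have xh : x = h by rewrite /x El.
  rewrite -xh in El *.
  have b'yx : B' y x != 0 by have := Hy x xl1; rewrite El /= eqxx => /eqP.
  have b'xy : B' x y != 0 by rewrite sB'.
  have [p1 p2] := pair_new yx (nk _ yl) (nk _ xl) Hyx b'yx.
  have [q1 q2] := pair_new xy (nk _ xl) (nk _ yl) Hxy b'xy.
  split.
    move=> w; rewrite !inE => /or3P[]/eqP ->.
    - by move: pk; rewrite El.
    - apply: (@passes_intro _ _ _ k x); rewrite ?inE ?eqxx ?orbT // p1 Bkneg mulNr bwk //.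
    - apply: (@passes_intro _ _ _ k y); rewrite ?inE ?eqxx ?orbT // q1 Bkneg mulNr bwk //.
  rewrite /cprod /= mulr1 mulrCA sp {1}/f' /sgn_edge sgrN p2 opprK (companion_sg d_gt0 y k c).
  by rewrite mulrN -mulrACA -!expr2 !sqr_sg akx aky.
have l2l : x \in l2 by rewrite /x El /=; case: (l2) l20 => // a l _; rewrite /= mem_last.
have xh : x != h.
  by move: Hi1; rewrite El => /andP[_ /andP[+ _]]; apply: contraNneq => <-.
have b'yx : B' y x = 0.
  by apply/eqP; rewrite -[_ == 0]negbK (eqP (Hy _ xl1)) El /= xh.
(* The mutation adds a nonzero term and the result vanishes, so the edge was there before. *)
have byx : B y x != 0.
  apply/eqP => b0; move: b'yx; rewrite /B' mutate_pos ?nk // b0 add0r => /eqP.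
  rewrite mulf_eq0 sgr_eq0 (gt_eqF Hyx) orbF => /eqP h0.
  by move: Hyx; rewrite h0 mul0r ltxx.
have bxy : B x y != 0 by rewrite sB.
have [o1 o2] := pair_old yx (nk _ yl) (nk _ xl) Hyx byx.
have [r1 r2] := pair_old xy (nk _ xl) (nk _ yl) Hxy bxy.
have sm u v : u \in y :: l1 -> v \in y :: l1 -> ~~ ((u == x) && (v == y)) ->
    ~~ ((u == y) && (v == x)) -> B' u v = B u v /\ A' u v = A u v.
  by move=> ul vl h1 h2; apply: mutate_same; rewrite ?nk //; apply: same.
have E2 : ear B y l1.
  apply/and4P; split => //.
  - rewrite -(@eq_induced_path _ B') // => u v ul vl.
    have ny a : a \in l1 -> (a == y) = false by move=> al; apply/negbTE; apply: contraNneq yl1 => <-.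
    by rewrite (sm u v _ _ _ _).1 ?inE ?ul ?vl ?orbT // ny ?andbF.
  - by rewrite El; case: (l2) l20.
  - apply/allP => w wl; have [->|wx] := eqVneq w x.
      by rewrite byx orbT.
    rewrite -(sm y w _ _ _ _).1 ?inE ?eqxx ?wl ?orbT ?(negbTE yx) ?(negbTE wx) ?andbF //.
    by rewrite (eqP (Hy _ wl)) orbF.
have pB w : w \in y :: l1 -> passes B (y :: l1) w.
  by apply: oriented_passes => //; exact: skew_sym.
split.
  move=> w; rewrite -El inE => /orP[/eqP -> //|wl]; apply: (passes_sub (pB w wl)) => a al ba.
  case: (boolP ((w == x) && (a == y))) => [/andP[/eqP-> /eqP->]|h1].
    by exists k; rewrite ?mem_head // Bkneg r1.
  case: (boolP ((w == y) && (a == x))) => [/andP[/eqP-> /eqP->]|h2].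
    by exists k; rewrite ?mem_head // Bkneg o1.
  by exists a; [rewrite in_cons al orbT|rewrite (sm w a _ _ _ _).1].
rewrite -El; have := aB E2; rewrite /cprod -/f !rcons_cons /= !pprod_rcons -/x => <-.
have -> : pprod f' y l1 = pprod f y l1.
  apply: (@pprod_ipath _ B') => // u v ul vl buv; rewrite /f' /f /sgn_edge (sm u v _ _ _ _).2 //.
    by apply: contraNN buv => /andP[/eqP-> /eqP->]; rewrite (skew_eq0 d_gt0 _ _ s') b'yx.
  by apply: contraNN buv => /andP[/eqP-> /eqP->]; rewrite b'yx.
rewrite mulrCA sp /f /sgn_edge sgrN r2 (companion_sg d_gt0 x k c).
by congr (_ * _); rewrite mulrC.
Qed.

(** Orientation and oddness hold or fail together. Positivity excludes the second alternative by its
    sign, known orientedness excludes it by its unpassed vertex. *)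
Definition cycle_dichotomy Z :=
  ((forall x, x \in Z -> passes B' Z x) /\ cprod f' Z = -1) \/
  (cprod f' Z = 1 /\ exists2 x, x \in Z & ~~ passes B' Z x).

Lemma cycle_dichotomy_rot Z (i : nat) : cycle_dichotomy (rot i Z) -> cycle_dichotomy Z.
Proof.
rewrite /cycle_dichotomy cprod_rot.
have Ep x : passes B' (rot i Z) x = passes B' Z x by apply: passes_mem => y; rewrite mem_rot.
case=> [[H E]|[E [x xZ Hx]]]; [left|right]; split => //.
  by move=> x xZ; rewrite -Ep H // mem_rot.
by exists x; [rewrite mem_rot in xZ|rewrite -Ep].
Qed.

(** Here [k] sees just the two ends of one edge of the cycle. If the edge is new, it shortcuts a
    chordless cycle of [B] through [k]. If it is old, the mutation reverses it and flips its sign,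
    which destroys orientation and oddness together. *)
Lemma ear_two_adjacent u l : ear B' u l -> k \notin u :: l ->
  (forall w, w \in l -> w != last u l -> B k w = 0) -> 0 < B u k * B k (last u l) ->
  cycle_dichotomy (u :: l).
Proof.
set v := last u l => E kul Hun Huv.
have [Hi sl ul _] := and4P E.
have vl : v \in l := ear_last E.
have hl : head u l \in l := ear_head E.
have nk w : w \in u :: l -> w != k by move=> wl; apply: contraNneq kul => <-.
have uu : u \in u :: l by rewrite mem_head.
have vu : v \in u :: l by rewrite in_cons vl orbT.
have uv : u != v by apply: contraNneq ul => ->.
have nvu : v != u by rewrite eq_sym.
have hv : head u l != v.
  rewrite /v; case: (l) (induced_path_uniq Hi) sl => // a [|b l'] //= /andP[H _] _.
  by apply: contraNneq H => ->; rewrite mem_last.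
have un w : w \in l -> w != v -> B k w = 0 /\ B w k = 0.
  move=> wl wv; have h := Hun w wl wv; split => //.
  by apply/eqP; rewrite (skew_eq0 d_gt0 _ _ s) h.
have sm p q : p \in u :: l -> q \in u :: l -> ~~ ((p == u) && (q == v)) ->
    ~~ ((p == v) && (q == u)) -> B' p q = B p q /\ A' p q = A p q.
  move=> pl ql h1 h2; apply: mutate_same; rewrite ?nk //.
  have sq a : B a k * B k a <= 0.
    by rewrite -sgr_le0 sgrM (skew_sg k a) mulNr -expr2 oppr_le0 sqr_ge0.
  move: pl ql; rewrite !in_cons => /predU1P[pu|pl] /predU1P[qu|ql].
  - by rewrite pu qu sq.
  - have [qv|qv] := eqVneq q v; first by move: h1; rewrite pu qv !eqxx.
    by rewrite (un q ql qv).1 mulr0.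
  - have [pv|pv] := eqVneq p v; first by move: h2; rewrite qu pv !eqxx.
    by rewrite (un p pl pv).2 mul0r.
  - have [pv|pv] := eqVneq p v; last by rewrite (un p pl pv).2 mul0r.
    have [qv|qv] := eqVneq q v; first by rewrite pv qv sq.
    by rewrite (un q ql qv).1 mulr0.
have nul w : w \in l -> (w == u) = false by move=> wl; apply/negbTE; apply: contraNneq ul => <-.
have sml p q : p \in l -> q \in l -> B' p q = B p q /\ A' p q = A p q.
  by move=> pl ql; apply: sm; rewrite ?in_cons ?pl ?ql ?orbT // ?nul // ?andbF.
have b'uv : B' u v != 0 := ear_adj_last E.
have b'vu : B' v u != 0 by rewrite sB'.
have Hvu : 0 < B v k * B k u.
  by rewrite -sgr_gt0 sgrM (skew_sg k v) (skew_sg u k) mulrNN mulrC -sgrM sgr_gt0.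
have [p1 p2] := pair_new uv (nk _ uu) (nk _ vu) Huv b'uv.
have [q1 q2] := pair_new nvu (nk _ vu) (nk _ uu) Hvu b'vu.
have Ep : pprod f' u l = pprod f u l.
  have smh : f' u (head u l) = f u (head u l).
    by rewrite /f' /f /sgn_edge (sm u _ _ _ _ _).2 ?mem_head ?in_cons ?hl ?orbT ?(negbTE hv) ?(negbTE uv) ?andbF.
  case: (l) Hi sml smh => //= a l' Hi' sml' ->; congr (_ * _).
  apply: (@pprod_ipath _ B') => // x y xl yl _.
  by rewrite /f' /f /sgn_edge (sml' x y xl yl).2.
have bku : B k u != 0 by apply: contraTneq Hvu => ->; rewrite mulr0.
have bkv : B k v != 0 by apply: contraTneq Huv => ->; rewrite mulr0.
have Ec : cprod f' (u :: l) = pprod f u l * f' v u by rewrite /cprod pprod_rcons Ep.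
have [b0|b0] := eqVneq (B u v) 0.
  left.
  have E2 : ear B k (u :: l).
    apply/and4P; split => //.
    - have Hl : induced_path B l.
        by rewrite -(@eq_induced_path _ B') // => p q pl ql; rewrite (sml p q pl ql).1.
      apply/and3P; split => //; apply/allP => w wl; have [->|wv] := eqVneq w v.
        by rewrite b0 eqxx [v == _]eq_sym (negbTE hv).
      rewrite -(sm u w _ _ _ _).1 ?mem_head ?in_cons ?wl ?orbT ?(negbTE wv) ?(negbTE uv) ?andbF //.
      by rewrite (ear_adj E wl) -/v (negbTE wv) orbF.
    - by rewrite /= ltnS ltnW.
    - apply/allP => w; rewrite in_cons => /predU1P[->|wl]; first by rewrite bku eqxx.
      rewrite /= nul //= -/v; have [->|wv] := eqVneq w v; first by rewrite bkv.
      by rewrite (un w wl wv).1 eqxx.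
  split.
    move=> w wl.
    have pw : passes B (k :: u :: l) w.
      by apply: oriented_passes => //; rewrite in_cons wl orbT.
    apply: (passes_sub pw) => a; rewrite in_cons => /predU1P[->|al] ba.
      move: wl; rewrite in_cons => /predU1P[->|wl]; first by exists v.
      have [->|wv] := eqVneq w v; first by exists u.
      by move: ba; rewrite (un w wl wv).2 eqxx.
    exists a => //; rewrite (sm w a _ _ _ _).1 //.
      by apply: contraNN ba => /andP[/eqP-> /eqP->]; rewrite b0.
    by apply: contraNN ba => /andP[/eqP-> /eqP->]; rewrite (skew_eq0 d_gt0 _ _ s) b0.
  rewrite Ec -(aB E2) /cprod rcons_cons /= pprod_rcons -/v -/f mulrCA; congr (_ * _).
  by rewrite /f' /f /sgn_edge !sgrN q2 opprK mulrNN mulrC.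
have [o1 o2] := pair_old uv (nk _ uu) (nk _ vu) Huv b0.
have b1 : B v u != 0 by rewrite sB.
have [r1 r2] := pair_old nvu (nk _ vu) (nk _ uu) Hvu b1.
have E2 : ear B u l.
  rewrite -(@eq_ear _ B') // => p q pl ql.
  case: (boolP ((p == u) && (q == v))) => [/andP[/eqP-> /eqP->]|h1]; first by rewrite b0 b'uv.
  case: (boolP ((p == v) && (q == u))) => [/andP[/eqP-> /eqP->]|h2]; first by rewrite b1 b'vu.
  by rewrite (sm p q pl ql h1 h2).1.
right; split.
  rewrite Ec -[RHS]opprK -(aB E2) /cprod pprod_rcons -/v -/f -mulrN; congr (_ * _).
  by rewrite /f' /f /sgn_edge !sgrN q2 r2.
exists u; rewrite ?mem_head // (ear_passes (B'0 u) E) -/v -leNgt.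
have := oB E2; rewrite -/v => h; apply: ltW; rewrite -sgr_gt0 sgrM p1.
have -> : B' u (head u l) = B u (head u l).
  by apply: (sm u _ _ _ _ _).1; rewrite ?mem_head ?in_cons ?hl ?orbT ?(negbTE hv) ?(negbTE uv) ?andbF.
rewrite -[Num.sg (B u k)]opprK -o1 mulrN -sgrM oppr_gt0 sgr_lt0 //.
Qed.

Lemma split_has (p : pred 'I_n) l : has p l ->
  exists s1 y r, [/\ l = s1 ++ y :: r, all (fun x => ~~ p x) s1 & p y].
Proof.
elim: l => //= a l IH; case: (boolP (p a)) => [pa _|pa /= /IH[s1 [y [r [-> h1 h2]]]]].
  by exists [::], a, l.
by exists (a :: s1), y, r; split => //=; rewrite pa.
Qed.

(** If [k] is off the cycle and no directed path through [k] joins two of its vertices, nothing on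
    it changes. Otherwise [k] sees just two adjacent vertices, or it is the hub of a wheel of the
    mutated matrix, whose sectors [ear_at_k] controls. *)
Lemma mutate_cycle Z : ecycle B' Z -> cycle_dichotomy Z.
Proof.
move=> E; case: (boolP (k \in Z)) => [kZ|kZ].
  have [l El [i Ei]] := ecycle_to sB' E kZ; apply: (@cycle_dichotomy_rot _ i); rewrite Ei.
  by left; apply: ear_at_k.
have nk w : w \in Z -> w != k by move=> wZ; apply: contraNneq kZ => <-.
case: (boolP (has (fun u => has (fun v => 0 < B u k * B k v) Z) Z)) => [|/hasPn H]; last first.
  have sm u v : u \in Z -> v \in Z -> B' u v = B u v /\ A' u v = A u v.
    move=> uZ vZ; apply: mutate_same; rewrite ?nk //.
    by have /hasPn /(_ _ vZ) := H _ uZ; rewrite -leNgt.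
  have E2 : ecycle B Z.
    case: (Z) E sm => // z l E sm; rewrite /= -(@eq_ear _ B') // => u v uZ vZ.
    by rewrite (sm u v uZ vZ).1.
  left; split.
    move=> x xZ; rewrite (@eq_passes _ B' B); last by move=> y yZ; rewrite (sm x y xZ yZ).1.
    exact: oriented_passes.
  rewrite (@eq_cprod _ f' f); last first.
    by move=> u v uZ vZ; rewrite /f' /f /sgn_edge (sm u v uZ vZ).2.
  by case: (Z) E2 => // z l; apply: aB.
move=> /hasP[u uZ /hasP[v vZ Huv]].
have [l El [i Ei]] := ecycle_to sB' E uZ; apply: (@cycle_dichotomy_rot _ i); rewrite Ei.
have memZ w : (w \in u :: l) = (w \in Z) by rewrite -Ei mem_rot.
have kul : k \notin u :: l by rewrite memZ.
have nuv : v != u.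
  apply: contraTneq Huv => ->; rewrite -leNgt -sgr_le0 sgrM (skew_sg k u) mulNr -expr2.
  by rewrite oppr_le0 sqr_ge0.
have vl : v \in l by move: vZ; rewrite -memZ in_cons (negbTE nuv).
have bku : B k u != 0.
  by rewrite -sB; apply: contraTneq Huv => ->; rewrite mul0r.
have bkv : B k v != 0 by apply: contraTneq Huv => ->; rewrite mulr0.
have hl : has (fun w => B' k w != 0) l by apply/hasP; exists v; rewrite ?nz_k.
have [s1 [y1 [r [E1 Hs Hy]]]] := split_has hl.
have Hs' w : w \in s1 -> B k w = 0.
  by move=> ws; have := allP Hs _ ws; rewrite nz_k negbK => /eqP.
have [r0|/eqP r0] := eqVneq r [::].
  have Ely : last u l = y1 by rewrite E1 r0 last_cat.
  apply: ear_two_adjacent => //; rewrite Ely.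
    move=> w; rewrite E1 r0 mem_cat inE => /orP[/Hs' //|/eqP->]; by rewrite eqxx.
  suff <- : v = y1 by [].
  move: vl; rewrite E1 r0 mem_cat inE => /orP[/Hs' b0|/eqP->] //.
  by move: bkv; rewrite b0 eqxx.
case: (boolP ((s1 == [::]) && ~~ has (fun w => B' k w != 0) r)) => [/andP[/eqP s10 Hr]|Hc].
  rewrite s10 /= in E1.
  have Hr' w : w \in r -> B k w = 0.
    by move=> wr; have := hasPn Hr _ wr; rewrite nz_k negbK => /eqP.
  have vy : v = y1.
    by move: vl; rewrite E1 in_cons => /predU1P[//|/Hr' b0]; move: bkv; rewrite b0 eqxx.
  have Er : ear B' y1 (rcons r u) by apply: ear_rot1 => //; rewrite -E1.
  apply: (@cycle_dichotomy_rot _ 1); rewrite E1 rot1_cons /=.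
  apply: ear_two_adjacent => //; rewrite ?last_rcons.
  - by apply: contraNN kul; rewrite E1 !(in_cons, mem_rcons); case/or3P=> ->; rewrite ?orbT.
  - by move=> w; rewrite mem_rcons in_cons => /predU1P[->|/Hr' //]; rewrite eqxx.
  - by rewrite -vy -sgr_gt0 sgrM (skew_sg k v) (skew_sg u k) mulrNN mulrC -sgrM sgr_gt0.
right; have [||||||Hc1 Hc2] := @wheel _ B' f' k sB' B'0 mutated_sgn_sym mutated_sgn_sq ear_at_k u l s1 y1 r El kul.
- by rewrite nz_k.
- exact: E1.
- by apply/allP => w ws; rewrite -[_ == 0]negbK; apply: (allP Hs).
- exact: Hy.
- exact: r0.
- by move=> s10; move: Hc; rewrite s10 eqxx /= negbK.
split => //; exists u => //; exact: mem_head.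
Qed.

End CycleMutation.

(** * Positive companions *)

Lemma norm_ge1 (a : int) : a != 0 -> 1 <= `|a|.
Proof. by lia. Qed.

Section Positive.
Variables (n : nat) (d : 'I_n -> int).
Hypothesis d_gt0 : forall i, 0 < d i.
Implicit Types (B A : 'M[int]_n) (i j k x y u v : 'I_n) (l Z : seq 'I_n).

Definition zlin A (x : 'I_n -> int) i : int := \sum_j A i j * x j.
Definition zform A (x : 'I_n -> int) : int := \sum_i d i * x i * zlin A x i.

Lemma lin_int (F : realFieldType) A (x : 'I_n -> int) i :
  lin A (fun j => (x j)%:~R) i = (zlin A x i)%:~R :> F.
Proof. by rewrite /lin /zlin rmorph_sum; apply: eq_bigr => j _; rewrite rmorphM. Qed.

Lemma qform_int (F : realFieldType) A (x : 'I_n -> int) :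
  qform d A (fun j => (x j)%:~R) = (zform A x)%:~R :> F.
Proof.
by rewrite /qform /zform rmorph_sum; apply: eq_bigr => j _; rewrite lin_int !rmorphM.
Qed.

Lemma pd_int (F : realFieldType) A (x : 'I_n -> int) i : pd d F A -> x i != 0 -> 0 < zform A x.
Proof.
move=> p xi; rewrite -(ltr0z F) -qform_int; apply: p; exists i; by rewrite intr_eq0.
Qed.

(** A path is a tree, so its signs form a coboundary: the solution on the tail is flipped when the
    first edge demands it. *)
Lemma path_gauge C (f : 'I_n -> 'I_n -> int) x l : sym_support C ->
  (forall u v, f u v = f v u) -> (forall u, C u u = 0) ->
  (forall u v, C u v != 0 -> f u v * f u v = 1) ->
  induced_path C (x :: l) -> exists e : 'I_n -> int,
  [/\ e x = 1, forall v, v \in x :: l -> e v * e v = 1,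
      {in x :: l &, forall u v, C u v != 0 -> f u v = e u * e v}
    & e (last x l) = pprod f x l].
Proof.
move=> sC fC C0 f1; elim: l x => [|y l IH] x Hi.
  exists (fun=> 1); split=> // u v; rewrite !inE => /eqP-> /eqP->; by rewrite C0 eqxx.
have /and3P[Hi' xl /allP Hx] := Hi.
have [e [ey e1 ee el]] := IH _ Hi'.
have Cxy : C x y != 0 by rewrite (eqP (Hx _ (mem_head _ _))) eqxx.
have nx v : v \in y :: l -> (v == x) = false by move=> vl; apply/negbTE; apply: contraNneq xl => <-.
exists (fun v => if v == x then 1 else f x y * e v); split.
- by rewrite eqxx.
- move=> v; rewrite in_cons => /predU1P[->|vl]; first by rewrite eqxx mulr1.
  by rewrite nx // mulrACA f1 // e1.
- move=> u v; rewrite !in_cons => /predU1P[->|ul] /predU1P[->|vl]; rewrite ?C0 ?eqxx //.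
  + rewrite (nx v) // mul1r (eqP (Hx _ vl)) /= => /eqP ->; by rewrite ey mulr1.
  + rewrite (nx u) // sC (eqP (Hx _ ul)) /= => /eqP ->; by rewrite ey !mulr1 fC.
  + by rewrite !nx // => cuv; rewrite mulrACA f1 // mul1r ee.
- by rewrite /= nx ?mem_last // el.
Qed.

Lemma sgn_edge1 B A u v : skew_by d B -> companion d B A -> B u v != 0 ->
  sgn_edge A u v * sgn_edge A u v = 1.
Proof.
move=> s c b; have uv : u != v by apply: contraNneq b => <-; rewrite (skew_diag d_gt0 _ s).
by rewrite /sgn_edge sg2 // oppr_eq0 (companion_eq0 uv c).
Qed.

Lemma sgn_edge_sym B A u v : companion d B A -> sgn_edge A u v = sgn_edge A v u.
Proof. by move=> c; rewrite /sgn_edge !sgrN (companion_sg d_gt0 u v c). Qed.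

Lemma cprod_pm1 B A k l : skew_by d B -> companion d B A -> ear B k l ->
  cprod (sgn_edge A) (k :: l) = 1 \/ cprod (sgn_edge A) (k :: l) = -1.
Proof.
move=> s c E; suff : cprod (sgn_edge A) (k :: l) * cprod (sgn_edge A) (k :: l) = 1.
  by move: (cprod _ _) => t /eqP; rewrite -expr2 sqrf_eq1 => /orP[/eqP|/eqP]; [left|right].
have sB := skew_sym d_gt0 s; have := E; case: l E => [|y l'] E; first by case/and4P.
case/and4P => Hi _ _ _.
have [e [ey e1 ee el]] := path_gauge sB (fun u v => sgn_edge_sym u v c)
  (fun u => skew_diag d_gt0 u s) (fun u v => @sgn_edge1 _ _ u v s c) Hi.
rewrite /cprod rcons_cons /= pprod_rcons -el.
have h1 := e1 _ (mem_last y l').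
have h2 := sgn_edge1 s c (ear_adj_head E).
have h3 : sgn_edge A (last y l') k * sgn_edge A (last y l') k = 1.
  by apply: (sgn_edge1 s c); rewrite sB; apply: (ear_adj_last E).
move: h1 h2 h3 => /=; set a := sgn_edge A k y; set b := e _; set g := sgn_edge A _ k => h1 h2 h3.
have -> : a * (b * g) * (a * (b * g)) = (a * a) * ((b * b) * (g * g)) by ring.
by rewrite h1 h2 h3.
Qed.

(** The test vector is [g] on [S] and zero elsewhere. Only two neighbours per vertex are asked for,
    and chords are allowed, because the lemma also has to serve directed closed walks. *)
Lemma pd_balanced (F : realFieldType) A (S : {set 'I_n}) (g : 'I_n -> int) k :
  (forall i, A i i = 2) -> k \in S -> (forall i, i \in S -> g i * g i = 1) ->
  (forall i j, i \in S -> j \in S -> j != i -> g i * (A i j * g j) = - `|A i j|) ->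
  (forall i, i \in S -> exists a b, [/\ a \in S, b \in S, a != i & [/\ b != i, a != b, A i a != 0 & A i b != 0]]) ->
  ~ pd d F A.
Proof.
move=> c1 kS g1 gS nb p; pose X v := if v \in S then g v else 0.
have : 0 < zform A X.
  apply: (@pd_int F _ _ k) => //; rewrite /X kS; apply/eqP => h.
  by have := g1 k kS; rewrite h mul0r.
rewrite ltNge => /negP[]; apply: sumr_le0 => i _; rewrite -mulrA; apply: mulr_ge0_le0; first exact: ltW.
case: (boolP (i \in S)) => iS; last by rewrite /X (negbTE iS) mul0r.
have [a [b [aS bS ai [bi ab Aa Ab]]]] := nb i iS.
have term j : j \in S -> j != i -> X i * (A i j * X j) = - `|A i j|.
  by move=> jS ji; rewrite /X iS jS gS.
rewrite /zlin mulr_sumr (bigD1 i) //= (bigD1 a) //= (bigD1 b) /=; last by rewrite bi eq_sym ab.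
have -> : X i * (A i i * X i) = 2 by rewrite c1 mulrCA /X iS g1 // mulr1.
rewrite !term //.
have le0 : \sum_(j | (j != i) && (j != a) && (j != b)) X i * (A i j * X j) <= 0.
  apply: sumr_le0 => j /andP[/andP[ji _] _]; case: (boolP (j \in S)) => jS.
    by rewrite term // oppr_le0.
  by rewrite {2}/X (negbTE jS) !mulr0.
move: (norm_ge1 Aa) (norm_ge1 Ab) le0; set t := \sum_(j | _) _; clearbody t; clear; lia.
Qed.

(* Around an even cycle a sign change turns all off-diagonal entries negative; every row sum
   over the cycle is then at most 2 - 1 - 1. *)
Lemma pd_odd (F : realFieldType) B A : skew_by d B -> companion d B A -> pd d F A -> odd_signs B A.
Proof.
move=> s c p k l E; have [|//] := cprod_pm1 s c E => Ev; exfalso.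
have sB := skew_sym d_gt0 s; have [c1 c2 c3] := c.
have B0 u := skew_diag d_gt0 u s.
have [y [l' El]] : exists y l', l = y :: l'.
  by case: (l) E => [|y l'] => [/and4P[]|_] //; exists y, l'.
have /and4P[Hi _ kl _] := E; rewrite El in Hi kl.
have [e [ey e1 ee el]] := path_gauge sB (fun u v => sgn_edge_sym u v c)
  B0 (fun u v => @sgn_edge1 _ _ u v s c) Hi.
pose Z := k :: l; pose f := sgn_edge A.
have Bky : B k y != 0 by have := ear_adj_head E; rewrite El.
have f2 := sgn_edge1 s c Bky; rewrite -/f in f2.
pose g v := if v == k then f k y else e v.
have gk : g k = f k y by rewrite /g eqxx.
have gl v : v \in y :: l' -> g v = e v.
  by move=> vl; rewrite /g ifN //; apply: contraNneq kl => <-.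
have g1 v : v \in Z -> g v * g v = 1.
  rewrite /Z El in_cons => /predU1P[->|vl]; first by rewrite gk.
  by rewrite gl // e1.
have gkl v : v \in y :: l' -> B k v != 0 -> f k v = g k * g v.
  move=> vl; have vl' : v \in l by rewrite El.
  rewrite (ear_adj E vl') El /= gk gl // => /orP[/eqP->|/eqP->]; first by rewrite ey mulr1.
  move: Ev; rewrite El /cprod rcons_cons /= pprod_rcons -el -/f => Ev.
  have h : f (last y l') k * f (last y l') k = 1.
    by apply: (sgn_edge1 s c); rewrite sB; have := ear_adj_last E; rewrite El.
  rewrite [LHS](sgn_edge_sym _ _ c) -/f -[RHS]mulr1 -h mulrA -[f k y * _ * _]mulrA Ev mul1r //.
have gg : {in Z &, forall u v, B u v != 0 -> f u v = g u * g v}.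
  move=> u v; rewrite /Z El !in_cons => /predU1P[->|ul] /predU1P[->|vl].
  - by rewrite B0 eqxx.
  - exact: gkl.
  - by rewrite sB => /(gkl _ ul); rewrite /f (sgn_edge_sym _ _ c) mulrC.
  - by move=> h; rewrite !gl //; apply: ee.
apply: (@pd_balanced F A [set v in Z] g k c1 _ _ _ _ p) => [|i|i j|i]; rewrite ?inE ?eqxx //.
- exact: g1.
- move=> iZ jZ ji; have ij : i != j by rewrite eq_sym.
  have [b0|b0] := eqVneq (B i j) 0.
    have -> : A i j = 0 by apply/eqP; rewrite (companion_eq0 ij c) b0.
    by rewrite mul0r mulr0 normr0 oppr0.
  by rewrite mulrCA -(gg i j iZ jZ b0) /f /sgn_edge sgrN mulrN normrEsg mulrC.
move=> iZ; have [li Eli [m Em]] := ecycle_to sB (E : ecycle B Z) iZ.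
have mZ v : (v \in i :: li) = (v \in Z) by rewrite -Em mem_rot.
pose a := head i li; pose b := last i li.
have Bia : B i a != 0 := ear_adj_head Eli. have Bib : B i b != 0 := ear_adj_last Eli.
have ia : i != a by apply: contraNneq Bia => <-; rewrite B0.
have ib : i != b by apply: contraNneq Bib => <-; rewrite B0.
have ab : a != b.
  have /and4P[h1 h2 _ _] := Eli; rewrite /a /b; case: (li) (induced_path_uniq h1) h2 => // t [|t' li'] //=.
  by move=> /andP[h _] _; apply: contraNneq h => ->; rewrite mem_last.
exists a, b; rewrite ![_ \in [set v in Z]]in_set -!mZ !in_cons (ear_head Eli) (ear_last Eli) !orbT.
by rewrite ![_ == i]eq_sym !(companion_eq0 _ c).
Qed.

(** The test vector, 2 at [k] and [- A u k] at the leaves, is twice the projection of [e_k]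
    orthogonal to the leaves, which are orthogonal to each other. Only the coordinate at [k]
    contributes to its form, with the factor [4 - sum]. *)
Lemma pd_star (F : realFieldType) B A k (O : {set 'I_n}) : companion d B A -> pd d F A ->
  k \notin O -> {in O &, forall u v, u != v -> B u v = 0} -> \sum_(u in O) `|B k u * B u k| < 4.
Proof.
move=> c p kO HO; have [c1 c2 c3] := c.
pose X v := if v == k then 2 else if v \in O then - A v k else 0.
have Xk : X k = 2 by rewrite /X eqxx.
have XO u : u \in O -> X u = - A u k.
  by move=> uO; rewrite /X uO ifN //; apply: contraNneq kO => <-.
have X0 u : u != k -> u \notin O -> X u = 0 by move=> uk uO; rewrite /X (negbTE uk) (negbTE uO).
have : 0 < zform A X by apply: (@pd_int F _ _ k) => //; rewrite Xk.
have nOk u : u \in O -> u != k by move=> uO; apply: contraNneq kO => <-.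
have E u : u \in O -> zlin A X u = 0.
  move=> uO; rewrite /zlin (bigD1 k) //= (bigD1 u) ?nOk //= Xk XO // c1 big1.
    by rewrite addr0 mulrN mulrC subrr.
  move=> j /andP[jk ju]; case: (boolP (j \in O)) => jO; last by rewrite X0 // mulr0.
  have : `|A u j| = 0 by rewrite c3 1?eq_sym // HO // 1?eq_sym // normr0.
  by move/normr0_eq0 => ->; rewrite mul0r.
have Ek : zlin A X k = 4 - \sum_(u in O) A k u * A u k.
  rewrite /zlin (bigD1 k) //= c1 Xk; congr (_ + _); rewrite (bigID (mem O)) /= [X in _ + X]big1 ?addr0.
    rewrite -sumrN; apply: eq_big => [u|u /andP[uk uO]].
      by case: (boolP (u \in O)) => uO; rewrite ?andbF // nOk.
    by rewrite XO // mulrN.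
  by move=> u /andP[uk uO]; rewrite X0 // mulr0.
rewrite /zform (bigD1 k) //= big1 ?addr0; last first.
  move=> u uk; case: (boolP (u \in O)) => uO; first by rewrite E // mulr0.
  by rewrite X0 // mulr0 mul0r.
rewrite Xk Ek -mulrA pmulr_rgt0 // pmulr_rgt0 // subr_gt0.
have -> // : \sum_(u in O) A k u * A u k = \sum_(u in O) `|B k u * B u k|.
apply: eq_bigr => u uO; rewrite normrM -!c3 ?nOk 1?eq_sym ?nOk // -normrM ger0_norm //.
by rewrite -sgr_ge0 sgrM (companion_sg d_gt0 k u c) -expr2 sqr_ge0.
Qed.

Lemma pd_weight (F : realFieldType) B A : companion d B A -> pd d F A ->
  forall i j, i != j -> `|B i j * B j i| < 4.
Proof.
move=> c p i j ij; have := @pd_star F B A i [set j] c p; rewrite big_set1; apply.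
  by rewrite inE.
by move=> u v; rewrite !inE => /eqP-> /eqP->; rewrite eqxx.
Qed.

(** The mutated companion is positive, so its cycles are odd, and only the oriented alternative of
    [mutate_cycle] remains. *)
Lemma oriented_mutate (F : realFieldType) B A k : skew_by d B -> companion d B A -> pd d F A -> oriented B ->
  [/\ skew_by d (mutate B k), companion d (mutate B k) (mutate_companion A B k),
      pd d F (mutate_companion A B k) & oriented (mutate B k)].
Proof.
move=> s c p o; have a := pd_odd s c p; have w := pd_weight c p.
have c' := mutate_companion_comp d_gt0 k s c (oriented_good d_gt0 s c o a).
have s' := mutate_skew d_gt0 k s; have p' := pd_mutate d_gt0 k s c p.
split => // z l E; have := pd_odd s' c' p' E => Ec.
have [[H _]|[Ec' _]] := mutate_cycle d_gt0 s c o a w (E : ecycle _ (z :: l)).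
  by have := H z (mem_head _ _); rewrite (ear_passes (skew_diag d_gt0 _ s') E).
by rewrite Ec in Ec'.
Qed.

(** The alternative of [mutate_cycle] used the other way: orientedness is given and oddness results.
    No positivity enters, so this stays available for forms that may be indefinite. *)
Lemma odd_mutate B A k : skew_by d B -> companion d B A -> oriented B -> odd_signs B A ->
  (forall i j, i != j -> `|B i j * B j i| < 4) -> oriented (mutate B k) ->
  companion d (mutate B k) (mutate_companion A B k) /\
  odd_signs (mutate B k) (mutate_companion A B k).
Proof.
move=> s c o a w o'; have s' := mutate_skew d_gt0 k s.
split; first exact: mutate_companion_comp (oriented_good d_gt0 s c o a).
move=> z l E; have [[_ //]|[_ [x xZ]]] := mutate_cycle d_gt0 s c o a w (E : ecycle _ (z :: l)).
by rewrite (oriented_passes (skew_sym d_gt0 s') (fun i => skew_diag d_gt0 i s') o').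
Qed.

End Positive.

(** * Companions with the same signs around cycles *)

Section Gauge.
Variables (n : nat) (B : 'M[int]_n) (f : 'I_n -> 'I_n -> int).
Hypothesis sB : sym_support B.
Hypothesis B0 : forall i, B i i = 0.
Hypothesis fC : forall x y, f x y = f y x.
Hypothesis f1 : forall x y, B x y != 0 -> f x y * f x y = 1.
Hypothesis even : forall k l, ear B k l -> cprod f (k :: l) = 1.
Implicit Types (i j u v w x y : 'I_n) (p W : seq 'I_n).

Definition adj_in W : rel 'I_n := fun x y => [&& x \in W, y \in W & B x y != 0].

Lemma adj_in_sym W : symmetric (adj_in W).
Proof. by move=> x y; rewrite /adj_in sB andbCA. Qed.

Lemma adj_path_sub W x p : path (adj_in W) x p -> {subset p <= W}.
Proof.
elim: p x => //= y p IH x /andP[/and3P[_ yW _] /IH H] z.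
by rewrite in_cons => /predU1P[->|/H].
Qed.

Lemma path_shortcut W x p : x \in W -> path (adj_in W) x p -> ~~ induced_path B (x :: p) ->
  exists p', [/\ path (adj_in W) x p', last x p' = last x p & (size p' < size p)%N].
Proof.
elim: p x => [|y p IH] x xW //; rewrite [path _ _ _]/= => /andP[rxy rp].
have -> : induced_path B (x :: y :: p) = [&& induced_path B (y :: p), x \notin y :: p &
    all (fun z => (B x z != 0) == (z == y)) (y :: p)] by [].
have yW : y \in W by case/and3P: rxy.
case: (boolP (induced_path B (y :: p))) => [Hi|/(IH y yW rp)[p' [h1 h2 h3]] _]; last first.
  by exists (y :: p'); split => //=; rewrite rxy.
rewrite andTb negb_and negbK => /orP[xp|/allPn[z zp]].
  move: xp rp; rewrite in_cons => /predU1P[xy|xp].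
    by move: rxy; rewrite xy /adj_in B0 eqxx !andbF.
  case/splitPr: xp => q1 q2; rewrite cat_path /= last_cat /= => /and3P[_ _ rq].
  by exists q2; split => //; rewrite size_cat /=; lia.
move: zp; rewrite in_cons => /predU1P[->|zp].
  by case/and3P: rxy => _ _ ->; rewrite eqxx.
have zy : (z == y) = false.
  by have /andP[h _] := induced_path_uniq Hi; apply/negbTE; apply: contraNneq h => <-.
rewrite /= zy eqbF_neg negbK => bxz; move: zp rp Hi => /splitPr[q1 q2].
rewrite cat_path /= last_cat /= => /and3P[_ /and3P[_ zW _] rq] _.
exists (z :: q2); split => //=; first by rewrite /adj_in xW zW bxz.
by rewrite size_cat /=; lia.
Qed.

Lemma pprod_adj W (e : 'I_n -> int) x p : (forall u, e u * e u = 1) ->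
  {in W &, forall u v, B u v != 0 -> f u v = e u * e v} ->
  path (adj_in W) x p -> pprod f x p = e x * e (last x p).
Proof.
move=> e1 ee; elim: p x => [|y p IH] x /=; first by rewrite e1.
case/andP=> /and3P[xW yW bxy] rp; rewrite (IH _ rp) ee //.
by rewrite -mulrA [e y * _]mulrA e1 mul1r.
Qed.

(** Cutting the path at chords and at further neighbours of [v] leaves an induced path whose ends
    alone see [v]. It closes up to a chordless cycle, where [even] makes the corrections demanded by
    the two ends agree. *)
Lemma gauge_consistent W v (e : 'I_n -> int) u p : v \notin W -> (forall u, e u * e u = 1) ->
  {in W &, forall u v, B u v != 0 -> f u v = e u * e v} ->
  u \in W -> path (adj_in W) u p -> B v u != 0 -> B v (last u p) != 0 ->
  f v u * e u = f v (last u p) * e (last u p).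
Proof.
move=> vW e1 ee; have [m] := ubnP (size p); elim: m u p => // m IH u p.
rewrite ltnS => sp uW rp bu bl; case: (boolP (induced_path B (u :: p))) => [Hi|Hi]; last first.
  have [p' [h1 h2 h3]] := path_shortcut uW rp Hi; rewrite -h2; apply: IH => //.
    exact: leq_trans h3 sp.
  by rewrite h2.
case: p sp rp bl Hi => [//|y p] sp rp bl Hi; set z := last u (y :: p) in bl *.
have uniqp := induced_path_uniq Hi.
have zp : z \in y :: p by rewrite /z /= mem_last.
case: (boolP (has (fun w => (B v w != 0) && (w != z)) (y :: p))) => [/hasP[w wp /andP[bw wz]]|Hn].
  have [q1 [q2 Eq]] : exists q1 q2, y :: p = rcons q1 w ++ q2.
    by case/path.splitP: wp => q1 q2; exists q1, q2.
  have q20 : (0 < size q2)%N.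
    by case: (q2) Eq => // Eq; move: wz; rewrite /z Eq cats0 last_rcons eqxx.
  move: rp sp; rewrite /z Eq cat_path size_cat last_cat last_rcons size_rcons => /andP[r1 r2] sp.
  have wW : w \in W by apply: (adj_path_sub r1); rewrite mem_rcons mem_head.
  have s1 : ((size q1).+1 < m)%N by apply: leq_trans sp; rewrite -addn1 leq_add2l.
  have s2 : (size q2 < m)%N by apply: leq_trans sp; rewrite addSn ltnS leq_addl.
  have := IH u (rcons q1 w); rewrite last_rcons size_rcons => -> //.
  apply: IH => //.
  by move: bl; rewrite /z Eq last_cat last_rcons.
have E : ear B v (u :: y :: p).
  apply/and4P; split => //.
    apply: contraNN vW; rewrite in_cons => /predU1P[-> //|/(adj_path_sub rp)] //.
  apply/allP => w; rewrite in_cons => /predU1P[->|wp]; first by rewrite bu eqxx.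
  rewrite -/z /=; have [->|wz] := eqVneq w z; first by rewrite bl orbT.
  have := hasPn Hn w wp; rewrite wz andbT negbK => /eqP ->; rewrite eqxx orbF.
  by apply/eqP/esym/negbTE; case/andP: uniqp => h _; apply: contraNneq h => <-.
have := even E; rewrite -[cprod _ _]/(f v u * pprod f u (rcons (y :: p) v)) pprod_rcons.
rewrite (pprod_adj e1 ee rp) -/z (fC z v) => Ev.
have a1 := f1 bl; rewrite -[LHS]mulr1 -[in LHS]a1 -[RHS]mul1r -Ev.
have e2 := e1 z; set a := f v u; set b := f v z; set g := e u; set h := e z.
have -> : a * (g * h * b) * (b * h) = a * g * (b * b) * (h * h) by ring.
by rewrite e2 mulr1 mulrA.
Qed.

Lemma gauge_on W : exists e : 'I_n -> int, (forall u, e u * e u = 1) /\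
  {in W &, forall u v, B u v != 0 -> f u v = e u * e v}.
Proof.
elim: W => [|v W [e [e1 ee]]]; first by exists (fun=> 1).
case: (boolP (v \in W)) => vW.
  exists e; split => // x y; rewrite !in_cons => /predU1P[->|xW] /predU1P[->|yW]; exact: ee.
pose P x u := [&& u \in W, B v u != 0 & connect (adj_in W) x u].
(* The correction is constant on components of [W] and dictated by any neighbour of [v] there; a
   component that [v] does not touch keeps its signs. *)
pose eta x := if [pick u | P x u] is Some u then f v u * e u else 1.
have eta1 x : eta x * eta x = 1.
  rewrite /eta; case: pickP => [u /and3P[_ bu _]|_]; last by rewrite mulr1.
  by rewrite mulrACA f1 // e1.
have etaE x y : adj_in W x y -> eta x = eta y.
  move=> xy; rewrite /eta (@eq_pick _ _ (P y)) // => u; rewrite /P.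
  congr [&& _, _ & _]; apply/idP/idP; apply: connect_trans; apply: connect1 => //.
  by rewrite adj_in_sym.
exists (fun x => if x == v then 1 else e x * eta x); split.
  by move=> u; case: ifP; rewrite ?mulr1 // mulrACA e1 eta1.
have key y : y \in W -> B v y != 0 -> f v y = e y * eta y.
  move=> yW bvy; rewrite /eta; case: pickP => [u /and3P[uW bu /connectP[p rp Eu]]|/(_ y)]; last first.
    by rewrite /P yW bvy connect0.
  rewrite Eu in bu *; rewrite -(gauge_consistent vW e1 ee yW rp bvy bu).
  by rewrite mulrCA e1 mulr1.
have nv x : x \in W -> (x == v) = false by move=> xW; apply/negbTE; apply: contraNneq vW => <-.
move=> x y; rewrite !in_cons => /predU1P[->|xW] /predU1P[->|yW] bxy.
- by rewrite B0 eqxx in bxy.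
- by rewrite eqxx mul1r nv // key.
- by rewrite eqxx mulr1 nv // fC key // sB.
- rewrite !nv // (etaE x y); last by rewrite /adj_in xW yW bxy.
  by rewrite mulrACA eta1 mulr1 ee.
Qed.

End Gauge.

Section Uniqueness.
Variables (n : nat) (d : 'I_n -> int).
Hypothesis d_gt0 : forall i, 0 < d i.
Implicit Types (B A : 'M[int]_n) (e : 'I_n -> int).

Lemma pprodM (f g : 'I_n -> 'I_n -> int) x l :
  pprod (fun u v => f u v * g u v) x l = pprod f x l * pprod g x l.
Proof. by elim: l x => [|y l IH] x /=; rewrite ?mulr1 // IH mulrACA. Qed.

(** Around a chordless cycle the products of the two edge signs multiply to [(-1)(-1) = 1], so they
    form a coboundary. *)
Lemma odd_signs_unique B A A' : skew_by d B -> companion d B A -> companion d B A' ->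
  odd_signs B A -> odd_signs B A' ->
  exists e : 'I_n -> int, (forall i, e i * e i = 1) /\ forall i j, A' i j = e i * e j * A i j.
Proof.
move=> s c c' o o'; have sB := skew_sym d_gt0 s; have B0 i := skew_diag d_gt0 i s.
pose f u v := sgn_edge A u v * sgn_edge A' u v.
have [|||e [e1 ee]] := @gauge_on _ B f sB B0 _ _ _ (enum 'I_n).
- by move=> x y; rewrite /f (sgn_edge_sym d_gt0 _ _ c) (sgn_edge_sym d_gt0 _ _ c').
- by move=> x y b; rewrite /f mulrACA (sgn_edge1 d_gt0 s c b) (sgn_edge1 d_gt0 s c' b).
- move=> k l E; rewrite /cprod /f pprodM.
  by have := o _ _ E; have := o' _ _ E; rewrite /cprod => -> ->.
exists e; split => // i j; have [->|ij] := eqVneq i j.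
  by rewrite e1 mul1r; case: c => ->; case: c' => ->.
have [b0|b0] := eqVneq (B i j) 0.
  have /eqP -> : A i j == 0 by rewrite (companion_eq0 ij c) b0.
  by apply/eqP; rewrite mulr0 (companion_eq0 ij c') b0.
rewrite -(ee i j) ?mem_enum // /f /sgn_edge !sgrN mulrNN.
have [_ _ cn] := c; have [_ _ cn'] := c'.
by rewrite {1}[A' i j]numEsg cn' // -cn // normrEsg mulrCA mulrA.
Qed.

Definition gauge (F : realFieldType) e (x : 'I_n -> F) : 'I_n -> F := fun i => (e i)%:~R * x i.

Lemma lin_gauge (F : realFieldType) A A' e (x : 'I_n -> F) i :
  (forall i j, A' i j = e i * e j * A i j) -> lin A' x i = (e i)%:~R * lin A (gauge e x) i.
Proof.
move=> E; rewrite /lin mulr_sumr; apply: eq_bigr => j _; rewrite E /gauge !rmorphM /=; ring.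
Qed.

Lemma qform_gauge (F : realFieldType) A A' e (x : 'I_n -> F) :
  (forall i j, A' i j = e i * e j * A i j) -> qform d A' x = qform d A (gauge e x).
Proof.
move=> E; apply: eq_bigr => i _; rewrite (lin_gauge _ _ E) /gauge; ring.
Qed.

Lemma pd_gauge (F : realFieldType) A A' e : (forall i, e i * e i = 1) ->
  (forall i j, A' i j = e i * e j * A i j) -> pd d F A -> pd d F A'.
Proof.
move=> e1 E p x [i xi]; rewrite (qform_gauge _ E); apply: p; exists i.
rewrite /gauge mulf_neq0 // intr_eq0; apply/eqP => h; have := e1 i; rewrite h mul0r //.
Qed.

End Uniqueness.

(** * Companions rooted at a vertex *)

Section Rooted.
Variables (n : nat) (d : 'I_n -> int).
Hypothesis d_gt0 : forall i, 0 < d i.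
Implicit Types (B A : 'M[int]_n) (i j k u v w x y : 'I_n) (z : 'I_n -> int).

(** The size stays [n]: the deleted vertex becomes isolated, and its diagonal entry 2 in the Cartan
    counterpart does no harm to positivity. *)
Definition delv B k : 'M[int]_n := \matrix_(i, j) if (i == k) || (j == k) then 0 else B i j.

(* The companion of [B] that is adapted to a vertex [k] whose complement is a forest. *)
Definition rooted B k : 'M[int]_n :=
  \matrix_(i, j) if i == j then 2 else if i == k then - B k j
                 else if j == k then B i k else - `|B i j|.

Lemma delvE B k i j : i != k -> j != k -> delv B k i j = B i j.
Proof. by move=> /negbTE ik /negbTE jk; rewrite mxE ik jk. Qed.

Lemma delv_skew B k : skew_by d B -> skew_by d (delv B k).
Proof.
move=> s i j; rewrite !mxE orbC; case: ifP => _; last exact: s.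
by rewrite !mulr0 oppr0.
Qed.

Lemma cartan_companion B : skew_by d B -> companion d B (cartan_counterpart B).
Proof.
move=> s; split => [i|i j|i j ij]; rewrite !mxE ?eqxx //.
  rewrite eq_sym; case: eqVneq => [->//|ij]; rewrite !mulrN; congr (- _).
  have : `|d i * B i j| = `|d j * B j i| by rewrite s normrN.
  by rewrite !normrM !(gtr0_norm (d_gt0 _)).
by rewrite (negbTE ij) normrN normr_id.
Qed.

Lemma rooted_companion B k : skew_by d B -> companion d B (rooted B k).
Proof.
move=> s; split => [i|i j|i j ij]; rewrite !mxE ?eqxx //.
  rewrite [j == i]eq_sym; case: eqVneq => [->//|ij].
  case: (eqVneq i k) => [ik|ik].
    rewrite ik eq_sym in ij; rewrite (negbTE ij) ik; have := s k j; rewrite mulrN; lia.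
  case: (eqVneq j k) => [->|jk]; first by rewrite s mulrN.
  have : `|d i * B i j| = `|d j * B j i| by rewrite s normrN.
  by rewrite !normrM !(gtr0_norm (d_gt0 _)) !mulrN => ->.
rewrite (negbTE ij); case: (eqVneq i k) => [->|ik]; first by rewrite normrN.
by case: (eqVneq j k) => [->//|jk]; rewrite normrN normr_id.
Qed.

(** Positivity with all off-diagonal signs non-positive excludes cycles, so away from [k] the graph
    is a forest. *)
Definition tree_at B k := pd d rat (cartan_counterpart (delv B k)).

Lemma cartan_no_cycle (F : realFieldType) B (S : {set 'I_n}) k : skew_by d B -> k \in S ->
  (forall i, i \in S -> exists a b, [/\ a \in S, b \in S, a != b, B i a != 0 & B i b != 0]) ->
  ~ pd d F (cartan_counterpart B).
Proof.
move=> s kS H; apply: (@pd_balanced _ d d_gt0 F _ S (fun=> 1) k) => //.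
- by move=> i; rewrite mxE eqxx.
- by move=> i j _ _ ji; rewrite mul1r mulr1 mxE eq_sym (negbTE ji) normrN normr_id.
move=> i iS; have [a [b [aS bS ab ba bb]]] := H i iS.
have ia : i != a by apply: contraNneq ba => <-; rewrite (skew_diag d_gt0 _ s).
have ib : i != b by apply: contraNneq bb => <-; rewrite (skew_diag d_gt0 _ s).
exists a, b; rewrite ![_ == i]eq_sym (companion_eq0 ia (cartan_companion s)).
by rewrite (companion_eq0 ib (cartan_companion s)).
Qed.

Lemma cartan_no_ear (F : realFieldType) B k l : skew_by d B ->
  pd d F (cartan_counterpart B) -> ~~ ear B k l.
Proof.
move=> s p; apply/negP => E; have := pd_odd d_gt0 s (cartan_companion s) p E.
set f := sgn_edge _.
have f0 x y : x != y -> 0 <= f x y.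
  by move=> /negbTE xy; rewrite /f /sgn_edge mxE xy opprK sgr_ge0.
have H x l' : uniq (x :: l') -> 0 <= pprod f x l'.
  elim: l' x => // y l' IH x; rewrite cons_uniq => /andP[xl ul].
  rewrite [pprod _ _ _]/= mulr_ge0 ?f0 ?IH //.
  by move: xl; rewrite in_cons negb_or => /andP[].
have /and4P[Hi _ kl _] := E.
move=> h; have : 0 <= cprod f (k :: l); last by rewrite h.
rewrite /cprod pprod_rcons mulr_ge0 ?H //= ?kl ?(induced_path_uniq Hi) //.
by apply: f0; apply: contraNneq kl => <-; apply: ear_last E.
Qed.

Definition arrow B k : rel 'I_n := fun x y => [&& x != k, y != k & 0 < B x y].

(** On a directed closed walk the successor and the predecessor of a vertex lie on differently
    directed edges, hence are distinct; this is all that [cartan_no_cycle] asks for. *)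
Lemma arrow_acyclic B k x p : skew_by d B -> tree_at B k ->
  path (arrow B k) x p -> ~~ arrow B k (last x p) x.
Proof.
move=> s t rp; apply/negP => rl.
have cyc : cycle (arrow B k) (x :: p) by rewrite /= rcons_path rp.
apply: (@cartan_no_cycle rat (delv B k) [set y in x :: p] x (delv_skew k s)) t; first by rewrite inE mem_head.
move=> i; rewrite in_set => iC.
have /and3P[ik nk bn] := next_cycle cyc iC; have /and3P[pk _ bp] := prev_cycle cyc iC.
exists (next (x :: p) i), (prev (x :: p) i); rewrite !in_set mem_next mem_prev iC.
have bp' : B i (prev (x :: p) i) < 0 by rewrite (skew_lt0 d_gt0 _ _ s).
split=> //; last 2 first.
- by rewrite delvE // (gt_eqF bn).
- by rewrite delvE // (lt_eqF bp').
by apply: contraTneq bn => ->; rewrite -leNgt ltW.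
Qed.

Lemma arrow_shortcut B k x p : skew_by d B -> tree_at B k ->
  path (arrow B k) x p -> ~~ induced_path B (x :: p) ->
  exists p', [/\ path (arrow B k) x p', last x p' = last x p & (size p' < size p)%N].
Proof.
move=> s t; elim: p x => [|y p IH] x //; rewrite [path _ _ _]/= => /andP[rxy rp].
have -> : induced_path B (x :: y :: p) = [&& induced_path B (y :: p), x \notin y :: p &
    all (fun v => (B x v != 0) == (v == y)) (y :: p)] by [].
case: (boolP (induced_path B (y :: p))) => [Hi|/(IH y rp)[p' [h1 h2 h3]] _]; last first.
  by exists (y :: p'); split => //=; rewrite rxy.
have /and3P[xk yk bxy] := rxy.
have rp' : path (arrow B k) x (y :: p) by rewrite /= rxy.
rewrite andTb negb_and negbK => /orP[xp|/allPn[z zp]].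
  case/path.splitP: xp rp' => q1 q2; rewrite cat_path rcons_path => /andP[/andP[r1 r2] _].
  by have := arrow_acyclic s t r1; rewrite r2.
move: zp; rewrite in_cons => /predU1P[->|zp].
  by rewrite (gt_eqF bxy) eqxx.
have zy : (z == y) = false.
  by have /andP[h _] := induced_path_uniq Hi; apply/negbTE; apply: contraNneq h => <-.
rewrite /= zy eqbF_neg negbK => bxz; move: zp rp rp' Hi => /splitPr[q1 q2].
rewrite cat_path /= last_cat /= => /and3P[rq1 rz rq] /andP[_ _] _; have /and3P[_ zk _] := rz.
(* A chord along the path is a shortcut; a chord against it would close a directed cycle. *)
have [b|b] : 0 < B x z \/ B x z < 0 by lia.
  exists (z :: q2); split => //=; first by rewrite /arrow xk zk b.
  by rewrite size_cat /= ltnS leq_addl.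
have rc : path (arrow B k) x (y :: rcons q1 z) by rewrite /= rxy rcons_path rq1.
have := arrow_acyclic s t rc; rewrite /= last_rcons /arrow zk xk /=.
by rewrite -(skew_lt0 d_gt0 _ _ s) b.
Qed.

Lemma arrow_path_k B k x p : x != k -> path (arrow B k) x p -> k \notin x :: p.
Proof.
move=> xk; elim: p x xk => [|y p IH] x xk; first by rewrite inE eq_sym.
by rewrite [path _ _ _]/= => /andP[/and3P[_ yk _] /(IH _ yk)]; rewrite [in X in _ -> X]in_cons negb_or eq_sym xk.
Qed.

(* A directed path in the forest between two neighbours of [k] closes up, through [k], to a
   chordless cycle, whose orientation fixes the direction of the last spoke. *)
Lemma arrow_spokes B k w p : skew_by d B -> oriented B -> tree_at B k ->
  path (arrow B k) w p -> p <> [::] -> B k w != 0 -> 0 < B k (last w p) -> False.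
Proof.
move=> s o t; have [m] := ubnP (size p); elim: m w p => // m IH w p.
rewrite ltnS => sp rp p0 bw bl.
have wk : w != k by case: (p) p0 rp => //= a q _ /andP[/and3P[]].
case: (boolP (induced_path B (w :: p))) => [Hi|Hi]; last first.
  have [p' [h1 h2 h3]] := arrow_shortcut s t rp Hi.
  apply: (IH w p' (leq_trans h3 sp) h1 _ bw); last by rewrite h2.
  move=> p'0; move: h2; rewrite p'0 /= => h2.
  move: (rp); case/lastP: (p) p0 h2 => // q e _; rewrite last_rcons => <-.
  by rewrite rcons_path => /andP[r1]; rewrite (negbTE (arrow_acyclic s t r1)).
have uniqp := induced_path_uniq Hi.
have lp : last w p \in p by case: (p) p0 => // a q _; rewrite /= mem_last.
case: (boolP (has (fun y => (B k y != 0) && (y != last w p)) p)) => [/hasP[y yp /andP[by0 yl]]|Hn].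
  have [q1 [q2 Eq]] : exists q1 q2, p = rcons q1 y ++ q2.
    by case/path.splitP: yp => q1 q2; exists q1, q2.
  have q20 : q2 <> [::] by move=> q20; move: yl; rewrite Eq q20 cats0 last_rcons eqxx.
  move: rp sp bl; rewrite Eq cat_path size_cat last_cat last_rcons size_rcons => /andP[r1 r2] sp bl.
  apply: (IH y q2) => //; apply: leq_trans sp; by rewrite addSn ltnS leq_addl.
have E : ear B k (w :: p).
  apply/and4P; split => //; first by case: (p) p0.
    exact: arrow_path_k rp.
  apply/allP => y; rewrite in_cons => /predU1P[->|yp]; first by rewrite bw eqxx.
  rewrite /=; have [->|yl] := eqVneq y (last w p); first by rewrite (gt_eqF bl) orbT.
  have := hasPn Hn y yp; rewrite yl andbT negbK => /eqP ->; rewrite eqxx orbF.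
  by apply/eqP/esym/negbTE; case/andP: uniqp => h _; apply: contraNneq h => <-.
case/lastP: p p0 {sp lp Hn IH} rp bl Hi uniqp E => // p u _; rewrite last_rcons rcons_path.
move=> /andP[rp /and3P[_ uk bu]] bl Hi uniqp E.
have sB := skew_sym d_gt0 s; have B0 i := skew_diag d_gt0 i s.
have uZ : u \in k :: w :: rcons p u by rewrite !in_cons mem_rcons mem_head !orbT.
have pu : passes B (k :: w :: rcons p u) u := oriented_passes sB B0 o (E : ecycle B (_ :: _)) uZ.
have : B u k * B u (last w p) < 0.
  apply: (passes_two pu) => y; rewrite in_cons => /predU1P[->|]; first by left.
  rewrite -rcons_cons mem_rcons in_cons => /predU1P[->|yp]; first by rewrite B0 eqxx.
  by rewrite (induced_path_last sB (l := w :: p) Hi yp) => /eqP ->; right.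
have h1 : B u k < 0 by rewrite (skew_lt0 d_gt0 _ _ s).
have h2 : B u (last w p) < 0 by rewrite (skew_lt0 d_gt0 _ _ s).
by rewrite ltNge ltW // nmulr_rgt0.
Qed.

End Rooted.

(** * Linear systems and the polar form *)

Section Solve.
Variables (n : nat) (d : 'I_n -> int).
Implicit Types (A : 'M[int]_n).

Lemma pd_solve (F : realFieldType) A (b : 'I_n -> F) : pd d F A ->
  exists y : 'I_n -> F, forall i, lin A y i = b i.
Proof.
move=> p; pose M := map_mx (intr : int -> F) A.
have uM : M \in unitmx.
  rewrite unitmxE unitfE -det_tr; apply/det0P => -[v v0 vM].
  have : 0 < qform d A (fun i => v 0 i).
    by apply: p; have /rV0Pn[i vi] := v0; exists i.
  rewrite /qform big1 ?ltxx // => i _; suff -> : lin A (fun j => v 0 j) i = 0 by rewrite mulr0.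
  transitivity ((v *m M^T) 0 i); last by rewrite vM mxE.
  by rewrite mxE; apply: eq_bigr => j _; rewrite !mxE mulrC.
exists (fun i => (invmx M *m \col_j b j) i 0) => i.
have : (M *m (invmx M *m \col_j b j)) i 0 = b i by rewrite mulKVmx // mxE.
by rewrite mxE => <-; apply: eq_bigr => j _; rewrite [M i j]mxE.
Qed.

Lemma int_scale (y : 'I_n -> rat) : exists (N : int) (x : 'I_n -> int),
  0 < N /\ forall i, (x i)%:~R = N%:~R * y i :> rat.
Proof.
exists (\prod_i denq (y i)), (fun i => numq (y i) * \prod_(j | j != i) denq (y j)).
split; first by apply: prodr_gt0 => i _.
move=> i; rewrite [\prod_j denq _](bigD1 i) //= !rmorphM /= numqE; ring.
Qed.

Lemma lin_scale (F : realFieldType) A c (y : 'I_n -> F) i :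
  lin A (fun j => c * y j) i = c * lin A y i.
Proof. by rewrite /lin mulr_sumr; apply: eq_bigr => j _; rewrite mulrCA. Qed.

Lemma linD (F : realFieldType) A (x y : 'I_n -> F) i :
  lin A (fun j => x j + y j) i = lin A x i + lin A y i.
Proof. by rewrite /lin -big_split; apply: eq_bigr => j _; rewrite mulrDr. Qed.

Definition bil (F : realFieldType) A (x y : 'I_n -> F) : F := \sum_i (d i)%:~R * x i * lin A y i.

Lemma bilC (F : realFieldType) A (x y : 'I_n -> F) :
  (forall i j, d i * A i j = d j * A j i) -> bil A x y = bil A y x.
Proof.
move=> sA; rewrite /bil /lin.
under eq_bigr do rewrite mulr_sumr.
rewrite exchange_big; apply: eq_bigr => j _; rewrite mulr_sumr; apply: eq_bigr => i _.
have : (d i)%:~R * (A i j)%:~R = (d j)%:~R * (A j i)%:~R :> F by rewrite -!rmorphM /= sA.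
move=> E; rewrite mulrA [_ * (A i j)%:~R]mulrAC E; ring.
Qed.

Lemma qformD (F : realFieldType) A (x y : 'I_n -> F) : (forall i j, d i * A i j = d j * A j i) ->
  qform d A (fun i => x i + y i) = qform d A x + 2 * bil A x y + qform d A y.
Proof.
move=> sA; have E : bil A y x = bil A x y by rewrite bilC.
rewrite mulr2n mulrDl !mul1r -{2}E /qform /bil -!big_split /=.
by apply: eq_bigr => i _; rewrite linD; ring.
Qed.

End Solve.

Lemma foldl_mutateN n (B : 'M[int]_n) ks : foldl (@mutate n) (- B) ks = - foldl (@mutate n) B ks.
Proof.
elim: ks B => //= k ks IH B; rewrite -IH; congr foldl; apply/matrixP => i j; rewrite !mxE.
by case: ifP => // _; rewrite mulrNN sgrN mulNr opprD.
Qed.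

(** * Mutations at sources of the forest *)

Section Phase.
Variables (n : nat) (d : 'I_n -> int).
Hypothesis d_gt0 : forall i, 0 < d i.
Implicit Types (B A : 'M[int]_n) (i j k u v w x y : 'I_n) (z : 'I_n -> int) (ks : seq 'I_n).

Lemma delv_rooted B B' k : rooted B' k = rooted B k ->
  cartan_counterpart (delv B' k) = cartan_counterpart (delv B k).
Proof.
move=> E; apply/matrixP => i j; rewrite !mxE; case: eqVneq => // ij.
have := congr1 (fun M : 'M_n => M i j) E; rewrite !mxE (negbTE ij).
by case: eqVneq => //= ik; case: eqVneq.
Qed.

Lemma rooted_row B B' k : skew_by d B -> skew_by d B' -> rooted B' k = rooted B k ->
  forall j, B' k j = B k j /\ B' j k = B j k.
Proof.
move=> s s' E j; have [->|jk] := eqVneq j k; first by rewrite !(skew_diag d_gt0 _ s) !(skew_diag d_gt0 _ s').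
have := congr1 (fun M : 'M_n => M k j) E; have := congr1 (fun M : 'M_n => M j k) E.
rewrite !mxE eqxx (negbTE jk) [k == j]eq_sym (negbTE jk) => -> h; split => //; exact: oppr_inj.
Qed.

(** No arrow enters [i], so no directed path runs through it and the mutation merely reverses its
    arrows. As [i] is not joined to [k], the rooted companion sees these only through absolute
    values. *)
Lemma fire B k i : skew_by d B -> i != k -> B i k = 0 -> (forall j, B j i <= 0) ->
  (forall a b, a != i -> b != i -> mutate B i a b = B a b) /\ rooted (mutate B i) k = rooted B k.
Proof.
move=> s ik bik Hi.
have E a b : a != i -> b != i -> mutate B i a b = B a b.
  move=> ai bi; apply: mutate_npos => //; apply: mulr_le0_ge0 => //.
  by rewrite leNgt (skew_lt0 d_gt0 _ _ s) -leNgt.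
split => //; have bki : B k i = 0 by apply/eqP; rewrite (skew_eq0 d_gt0 _ _ s) bik.
have ki : k != i by rewrite eq_sym.
have N a b : `|mutate B i a b| = `|B a b|.
  have [->|ai] := eqVneq a i; first by rewrite mutate_row normrN.
  have [->|bi] := eqVneq b i; first by rewrite mutate_col normrN.
  by rewrite E.
have Ek j : mutate B i k j = B k j.
  have [->|ji] := eqVneq j i; first by rewrite mutate_col bki oppr0.
  by rewrite E.
have Ek' j : mutate B i j k = B j k.
  have [->|ji] := eqVneq j i; first by rewrite mutate_row bik oppr0.
  by rewrite E.
by apply/matrixP => a b; rewrite ![rooted _ _ _ _]mxE N Ek Ek'.
Qed.

Section Class.
Variable P : 'M[int]_n -> Prop.
Hypothesis P_skew : forall B, P B -> skew_by d B.
Hypothesis P_mut : forall B i, P B -> P (mutate B i).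
Hypothesis P_or : forall B, P B -> oriented B.

Lemma P_foldl B ks : P B -> P (foldl (@mutate n) B ks).
Proof. by elim: ks B => //= k ks IH B /(P_mut k)/IH. Qed.

Lemma make_source B k u : P B -> tree_at d B k -> u != k -> 0 < B k u -> exists ks,
  [/\ k \notin ks, rooted (foldl (@mutate n) B ks) k = rooted B k &
      forall j, j != k -> foldl (@mutate n) B ks j u <= 0].
Proof.
have [m] := ubnP #|[set w | connect (arrow B k) w u]|; elim: m B => // m IH B.
rewrite ltnS => Hm pB t uk bku; have s := P_skew pB.
pose anc x := [set w | connect (arrow B k) w x].
case: (boolP [exists j, arrow B k j u]) => [/existsP[j0 rj0]|Hn]; last first.
  exists [::]; split => // j jk /=; move: Hn; rewrite negb_exists => /forallP /(_ j).
  by rewrite /arrow jk uk /= -leNgt.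
have uA : u \in anc u by rewrite inE.
(* An ancestor with the fewest ancestors is a source, since there are no directed cycles. *)
case: (@arg_minnP _ u (fun x => x \in anc u) (fun x => #|anc x|)) => // i iA imin.
have isrc j : ~~ arrow B k j i.
  apply/negP => rji; have jA : j \in anc u.
    by move: iA; rewrite !inE; apply: connect_trans; apply: connect1.
  have := imin j jA; rewrite leqNgt => /negP[]; apply: proper_card; apply/properP; split.
    by apply/subsetP => w; rewrite !inE => h; apply: connect_trans h (connect1 rji).
  exists i; rewrite !inE ?connect0 //; apply/negP => /connectP[p rp Ej].
  by have := arrow_acyclic d_gt0 s t rp; rewrite -Ej rji.
have iu : i != u by apply: contraTneq rj0 => <-; apply: isrc.
have [p rp Ep] : exists2 p, path (arrow B k) i p & u = last i p.
  by apply/connectP; move: iA; rewrite inE.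
have p0 : p <> [::] by move=> p0; move: iu; rewrite Ep p0 eqxx.
have ik : i != k by case: (p) p0 rp => //= a q _ /andP[/and3P[]].
have bki : B k i = 0.
  apply/eqP; case: (eqVneq (B k i) 0) => // b; exfalso.
  by apply: (arrow_spokes d_gt0 s (P_or pB) t rp p0 b); rewrite -Ep.
have bik : B i k = 0 by apply/eqP; rewrite (skew_eq0 d_gt0 _ _ s) bki.
have Hi j : B j i <= 0.
  have [->|jk] := eqVneq j k; first by rewrite bki.
  by have := isrc j; rewrite /arrow jk ik /= -leNgt.
have [E1 E2] := fire s ik bik Hi.
have t' : tree_at d (mutate B i) k by rewrite /tree_at (delv_rooted E2).
have [Ek _] := rooted_row s (P_skew (P_mut i pB)) E2 u.
have bku' : 0 < mutate B i k u by rewrite Ek.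
have r'i b : ~~ arrow (mutate B i) k i b.
  by rewrite /arrow mutate_row oppr_gt0 (skew_lt0 d_gt0 _ _ s) ltNge Hi !andbF.
have sub q w : path (arrow (mutate B i) k) w q -> last w q = u -> path (arrow B k) w q /\ w != i.
  elim: q w => [|a q IHq] w /=; first by move=> _ ->; rewrite eq_sym.
  move=> /andP[rwa rq] El; have [h1 h2] := IHq a rq El.
  have wi : w != i by apply: contraTneq rwa => ->; apply: r'i.
  by split => //; rewrite h1 andbT; move: rwa; rewrite /arrow E1.
have lt : (#|[set w | connect (arrow (mutate B i) k) w u]| < m)%N.
  apply: leq_trans Hm; apply: proper_card; apply/properP; split.
    apply/subsetP => w; rewrite !inE => /connectP[q rq Eq].
    by have [h _] := sub q w rq (esym Eq); apply/connectP; exists q.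
  exists i; first by move: iA; rewrite !inE.
  rewrite inE; apply/negP => /connectP[q rq Eq].
  by have [_] := sub q i rq (esym Eq); rewrite eqxx.
have [ks [h1 h2 h3]] := IH _ lt (P_mut i pB) t' uk bku'.
exists (i :: ks); split; [|by rewrite /= h2 E2|exact: h3].
by rewrite in_cons negb_or eq_sym ik.
Qed.

Definition orth B k z := forall i, i != k -> zlin (rooted B k) z i = 0.
Definition upd z u (c : int) : 'I_n -> int := fun j => if j == u then z u + c else z j.

Lemma zlin2 A z i k u : u != k ->
  zlin A z i = A i k * z k + (A i u * z u + \sum_(j | (j != k) && (j != u)) A i j * z j).
Proof. by move=> uk; rewrite /zlin (bigD1 k) //= (bigD1 u). Qed.

(** The mutation reflects [e_k] in [e_u], and [z'] gives the coordinates of the same vector in the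
    new basis. Being orthogonal to [e_u], this vector pairs with the new [e_k] as with the old
    one. *)
Lemma move_source B k u z : skew_by d B -> u != k -> 0 < B k u ->
  (forall j, j != k -> B j u <= 0) -> orth B k z ->
  let B' := mutate B u in let z' := upd z u (B u k * z k) in
  [/\ cartan_counterpart (delv B' k) = cartan_counterpart (delv B k), orth B' k z' &
      zlin (rooted B' k) z' k = zlin (rooted B k) z k].
Proof.
move=> s uk bku src o B' z'; have ku : k != u by rewrite eq_sym.
have src' j : j != k -> 0 <= B u j.
  by move=> jk; rewrite leNgt (skew_lt0 d_gt0 _ _ s) -leNgt src.
have buk : B u k < 0 by rewrite (skew_lt0 d_gt0 _ _ s).
pose E := rooted B k; pose E' := rooted B' k.
have ET i j : i != k -> j != k -> E' i j = E i j /\ `|B' i j| = `|B i j|.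
  move=> ik jk; rewrite /E' /E ![rooted _ _ _ _]mxE (negbTE ik) (negbTE jk).
  suff -> : `|B' i j| = `|B i j| by [].
  have [->|iu] := eqVneq i u; first by rewrite /B' mutate_row normrN.
  have [->|ju] := eqVneq j u; first by rewrite /B' mutate_col normrN.
  by rewrite /B' mutate_npos // mulr_le0_ge0 ?src ?src'.
have Eku : E' k u = - E k u by rewrite /E' /E ![rooted _ _ _ _]mxE (negbTE ku) eqxx /B' mutate_col.
have Euk : E' u k = - E u k by rewrite /E' /E ![rooted _ _ _ _]mxE (negbTE uk) eqxx /B' mutate_row.
have Ekk : E' k k = E k k by rewrite /E' /E ![rooted _ _ _ _]mxE eqxx.
have Euj j : j != k -> j != u -> E u j = - B u j.
  move=> jk ju; rewrite mxE [u == j]eq_sym (negbTE ju) (negbTE uk) (negbTE jk).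
  by rewrite ger0_norm ?src'.
have Eju j : j != k -> j != u -> E j u = B j u.
  by move=> jk ju; rewrite mxE (negbTE ju) (negbTE uk) (negbTE jk) ler0_norm ?src // opprK.
have Ekj j : j != k -> j != u -> E' k j = E k j - E k u * E u j.
  move=> jk ju; rewrite Euj // /E' /E ![rooted _ _ _ _]mxE eqxx [k == j]eq_sym (negbTE jk) (negbTE ku).
  rewrite /B' mutateE // (gtr0_sg bku) max_l; last by rewrite pmulr_rge0 // src'.
  by ring.
have Ejk j : j != k -> j != u -> E' j k = E j k - E j u * E u k.
  move=> jk ju; rewrite Eju // /E' /E ![rooted _ _ _ _]mxE (negbTE jk) (negbTE uk) eqxx /B' mutateE //.
  have := src j jk; rewrite le_eqVlt => /orP[/eqP ->|h]; first by rewrite sgr0; ring.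
  by rewrite (ltr0_sg h) max_l ?mulN1r // ltW // nmulr_rgt0.
have cT : cartan_counterpart (delv B' k) = cartan_counterpart (delv B k).
  apply/matrixP => i j; rewrite ![cartan_counterpart _ _ _]mxE ![delv _ _ _ _]mxE; case: eqVneq => // ij.
  case: eqVneq => //= ik; case: eqVneq => //= jk; congr (- _).
  by case: (ET i j ik jk).
have z'u : z' u = z u + B u k * z k by rewrite /z' /upd eqxx.
have z'j j : j != u -> z' j = z j by move=> /negbTE ju; rewrite /z' /upd ju.
have Buk : B u k = E u k by rewrite mxE (negbTE uk) eqxx.
have Euu : E u u = 2 by rewrite mxE eqxx.
have Lu := o u uk; rewrite -/E (zlin2 _ _ _ uk) Euu in Lu.
have S i : i != k -> \sum_(j | (j != k) && (j != u)) E' i j * z' j = \sum_(j | (j != k) && (j != u)) E i j * z j.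
  by move=> ik; apply: eq_bigr => j /andP[jk ju]; rewrite (ET i j ik jk).1 z'j.
split => //.
  move=> i ik; rewrite -/E' (zlin2 _ _ _ uk) S // (ET i u ik uk).1 z'u (z'j k ku) Buk.
  have [->|iu] := eqVneq i u; first by rewrite Euk Euu; apply: etrans _ Lu; ring.
  by rewrite Ejk //; apply: etrans _ (o i ik); rewrite -/E (zlin2 _ _ _ uk); ring.
rewrite -/E -/E' (zlin2 E' _ _ uk) (zlin2 E _ _ uk) Ekk Eku z'u (z'j k ku) Buk.
have -> : \sum_(j | (j != k) && (j != u)) E' k j * z' j = \sum_(j | (j != k) && (j != u)) E k j * z j
   - E k u * \sum_(j | (j != k) && (j != u)) E u j * z j.
  rewrite mulr_sumr -sumrB; apply: eq_bigr => j /andP[jk ju]; rewrite Ekj // z'j //; ring.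
move: Lu; set S1 := \sum_(j | _) E u j * z j; set S2 := \sum_(j | _) _ => Lu.
have -> : S1 = - (E u k * z k + 2 * z u).
  by apply/eqP; rewrite -subr_eq0 opprK addrC -addrA; apply/eqP.
by ring.
Qed.

End Class.
End Phase.

(** * Moving the vector orthogonal to the forest *)

Section Steps.
Variables (n : nat) (d : 'I_n -> int).
Hypothesis d_gt0 : forall i, 0 < d i.
Implicit Types (B A : 'M[int]_n) (i j k u v w x y : 'I_n) (z : 'I_n -> int) (ks : seq 'I_n).

Lemma skewN B : skew_by d B -> skew_by d (- B).
Proof. by move=> s i j; rewrite !mxE !mulrN s. Qed.

Lemma earN B k l : ear (- B) k l = ear B k l.
Proof. by apply: eq_ear => u v _ _; rewrite mxE oppr_eq0. Qed.

Lemma orientedN B : oriented B -> oriented (- B).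
Proof. by move=> o k l; rewrite earN => /o; rewrite !mxE mulrNN. Qed.

Lemma mutateN B k : mutate (- B) k = - mutate B k.
Proof. exact: (foldl_mutateN B [:: k]). Qed.

Lemma cartanN B k : cartan_counterpart (delv (- B) k) = cartan_counterpart (delv B k).
Proof.
apply/matrixP => i j; rewrite !mxE; case: eqP => // _; case: ifP => // _; by rewrite normrN.
Qed.

(** Passing to [- B] replaces [e_k] by its negative in the rooted companion. The vector is negated
    as well, so that its coordinate at [k] stays positive. *)
Lemma zlin_rootedN B k z i :
  zlin (rooted (- B) k) (fun j => if j == k then z k else - z j) i =
  if i == k then zlin (rooted B k) z k else - zlin (rooted B k) z i.
Proof.
case: eqVneq => [->|ik]; rewrite /zlin -?sumrN; apply: eq_bigr => j _; rewrite !mxE ?eqxx ?(negbTE ik).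
  rewrite [k == j]eq_sym; case: eqVneq => [->//|jk]; by rewrite mulrNN.
case: (eqVneq i j) => [<-|ij]; first by rewrite (negbTE ik) mulrN.
case: (eqVneq j k) => [->|jk]; first by rewrite mulNr.
by rewrite normrN mulrN.
Qed.

Definition step_spec B k z (u : 'I_n) := exists ks, let B1 := foldl (@mutate n) B ks in
  let z1 := upd z u (B u k * z k) in
  [/\ k \notin ks, cartan_counterpart (delv B1 k) = cartan_counterpart (delv B k),
      orth B1 k z1 & zlin (rooted B1 k) z1 k = zlin (rooted B k) z k].

Lemma out_step (P : 'M[int]_n -> Prop) B k z u :
  (forall B, P B -> skew_by d B) -> (forall B i, P B -> P (mutate B i)) ->
  (forall B, P B -> oriented B) ->
  P B -> tree_at d B k -> u != k -> 0 < B k u -> orth B k z -> step_spec B k z u.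
Proof.
move=> Ps Pm Po pB t uk bku o.
have [ks [h1 h2 h3]] := make_source d_gt0 Ps Pm Po pB t uk bku.
pose B1 := foldl (@mutate n) B ks.
have pB1 : P B1 by apply: P_foldl.
have [r1 r2] := rooted_row d_gt0 (Ps _ pB) (Ps _ pB1) h2 u.
have o1 : orth B1 k z by move=> i ik; rewrite h2; apply: o.
have bku1 : 0 < B1 k u by rewrite r1.
have [m1 m2 m3] := move_source d_gt0 (Ps _ pB1) uk bku1 h3 o1.
rewrite r2 h2 in m2 m3; rewrite (delv_rooted h2) in m1.
exists (rcons ks u); rewrite foldl_rcons -/B1; split => //.
by rewrite mem_rcons in_cons negb_or eq_sym uk.
Qed.

Section Class.
Variable P : 'M[int]_n -> Prop.
Hypothesis P_skew : forall B, P B -> skew_by d B.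
Hypothesis P_mut : forall B i, P B -> P (mutate B i).
Hypothesis P_or : forall B, P B -> oriented B.

Lemma spoke_step B k z u : P B -> tree_at d B k -> u != k -> B k u != 0 -> orth B k z ->
  step_spec B k z u.
Proof.
move=> pB t uk bku o; have [b|b] : 0 < B k u \/ B k u < 0.
- by move: bku; case: (ltgtP (B k u) 0) => // *; [right|left].
- exact: (out_step P_skew P_mut P_or).
(* Incoming spokes of [B] are outgoing spokes of [- B], and the class of negatives inherits the
   three hypotheses. *)
pose P' (C : 'M[int]_n) := P (- C); pose zn := fun j => if j == k then z k else - z j.
have t' : tree_at d (- B) k by rewrite /tree_at cartanN.
have o' : orth (- B) k zn by move=> i ik; rewrite zlin_rootedN (negbTE ik) o // oppr0.
have [|||||ks [h1 h2 h3 h4]] := @out_step P' (- B) k zn u _ _ _ _ t' uk _ o'.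
- by move=> C /P_skew/skewN; rewrite opprK.
- by move=> C i; rewrite /P' -mutateN; apply: P_mut.
- by move=> C /P_or/orientedN; rewrite opprK.
- by rewrite /P' opprK.
- by rewrite mxE oppr_gt0.
pose B1 := foldl (@mutate n) B ks.
rewrite foldl_mutateN -/B1 in h2 h3 h4.
have Ez : forall j, upd zn u ((- B) u k * zn k) j =
    if j == k then upd z u (B u k * z k) k else - upd z u (B u k * z k) j.
  move=> j; rewrite /upd /zn mxE eqxx (negbTE uk) [k == u]eq_sym (negbTE uk).
  have [->|ju] := eqVneq j u; first by rewrite (negbTE uk) mulNr opprD.
  by case: eqP.
have El i : zlin (rooted (- B1) k) (upd zn u ((- B) u k * zn k)) i =
    if i == k then zlin (rooted B1 k) (upd z u (B u k * z k)) k
    else - zlin (rooted B1 k) (upd z u (B u k * z k)) i.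
  by rewrite -zlin_rootedN; apply: eq_bigr => j _; rewrite Ez.
exists ks; split => //; rewrite -/B1.
- by rewrite -cartanN h2 cartanN.
- by move=> i ik; have := h3 i ik; rewrite El (negbTE ik) => /eqP; rewrite oppr_eq0 => /eqP.
- by move: h4; rewrite El eqxx zlin_rootedN eqxx.
Qed.

Lemma spoke_min B k z : P B -> tree_at d B k -> orth B k z -> 0 < z k -> exists ks z1,
  let B1 := foldl (@mutate n) B ks in
  [/\ k \notin ks, cartan_counterpart (delv B1 k) = cartan_counterpart (delv B k), orth B1 k z1 &
  [/\ z1 k = z k, zlin (rooted B1 k) z1 k = zlin (rooted B k) z k &
      forall u, u != k -> B1 k u != 0 -> `|z1 u| <= `|z1 u + B1 u k * z k|]].
Proof.
have [m] := ubnP (\sum_i absz (z i))%N; elim: m B z => // m IH B z.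
rewrite ltnS => Hm pB t o zk.
case: (boolP [exists u, [&& u != k, B k u != 0 & `|z u + B u k * z k| < `|z u|]]); last first.
  rewrite negb_exists => /forallP H; exists [::], z; split => //; split => // u uk bku.
  by have := H u; rewrite uk bku /= -leNgt.
move=> /existsP[u /and3P[uk bku Hu]].
have [ks [h1 h2 h3 h4]] := spoke_step pB t uk bku o.
pose B1 := foldl (@mutate n) B ks; pose z1 := upd z u (B u k * z k).
have z1k : z1 k = z k by rewrite /z1 /upd eq_sym (negbTE uk).
have lt : (\sum_i absz (z1 i) < m)%N.
  apply: leq_trans Hm; rewrite (bigD1 u) //= [X in (_ < X)%N](bigD1 u) //= -addSn leq_add //.
    by rewrite /z1 /upd eqxx; move: Hu; clear; lia.
  by apply: leq_sum => i /negbTE iu; rewrite /z1 /upd iu.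
have t1 : tree_at d B1 k by rewrite /tree_at h2.
have zk1 : 0 < z1 k by rewrite z1k.
have [ks' [z2 [g1 g2 g3 [g4 g5 g6]]]] := IH B1 z1 lt (P_foldl P_mut ks pB) t1 h3 zk1.
exists (ks ++ ks'), z2; rewrite foldl_cat -/B1; split => //.
- by rewrite mem_cat negb_or h1.
- by rewrite g2 h2.
split => //; first by rewrite g4 z1k.
  by rewrite g5 h4.
by move=> v vk bv; have := g6 v vk bv; rewrite z1k.
Qed.

End Class.

Lemma qform_root0 (F : realFieldType) B k (y : 'I_n -> F) : y k = 0 ->
  qform d (rooted B k) y = qform d (cartan_counterpart (delv B k)) y /\
  (forall i, i != k -> lin (rooted B k) y i = lin (cartan_counterpart (delv B k)) y i).
Proof.
move=> yk; have E i : i != k -> lin (rooted B k) y i = lin (cartan_counterpart (delv B k)) y i.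
  move=> ik; apply: eq_bigr => j _; have [->|jk] := eqVneq j k; first by rewrite yk !mulr0.
  by rewrite !mxE (negbTE ik) (negbTE jk).
split => //; apply: eq_bigr => i _; have [->|ik] := eqVneq i k; first by rewrite yk mulr0 !mul0r.
by rewrite E.
Qed.

(** Every vector is a multiple of [z] plus a vector supported on the forest; the two parts are
    orthogonal and the form is positive on each. *)
Lemma rooted_pd B k z : skew_by d B -> tree_at d B k -> orth B k z -> 0 < z k ->
  0 < zlin (rooted B k) z k -> pd d rat (rooted B k).
Proof.
move=> s t o zk ek x xn; have [c1 c2 c3] := rooted_companion d_gt0 k s.
pose zr : 'I_n -> rat := fun i => (z i)%:~R; pose c := x k / zr k.
have zk0 : zr k != 0 by rewrite intr_eq0 gt_eqF.
pose y := fun i => x i - c * zr i; pose cz := fun i => c * zr i.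
have yk : y k = 0 by rewrite /y /c divfK // subrr.
have Ex : qform d (rooted B k) x = qform d (rooted B k) (fun i => cz i + y i).
  have E i : cz i + y i = x i by rewrite /cz /y addrC subrK.
  by apply: eq_bigr => i _; rewrite E; congr (_ * _); apply: eq_bigr => j _; rewrite E.
have lz i : i != k -> lin (rooted B k) cz i = 0.
  by move=> ik; rewrite lin_scale lin_int o // mulr0.
have lk : lin (rooted B k) cz k = c * (zlin (rooted B k) z k)%:~R by rewrite lin_scale lin_int.
have b0 : bil d (rooted B k) cz y = 0.
  rewrite bilC // /bil big1 // => i _; have [->|ik] := eqVneq i k; first by rewrite yk mulr0 mul0r.
  by rewrite lz // mulr0.
rewrite Ex qformD // b0 mulr0 addr0 (qform_root0 B yk).1.
have -> : qform d (rooted B k) cz = (d k * (z k * zlin (rooted B k) z k))%:~R * c ^+ 2.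
  rewrite /qform (bigD1 k) //= big1 ?addr0; last by move=> i ik; rewrite lz // mulr0.
  by rewrite lk /cz /zr !rmorphM /=; ring.
have pos : 0 < (d k * (z k * zlin (rooted B k) z k))%:~R :> rat.
  by rewrite ltr0z !mulr_gt0.
case: (boolP [exists i, y i != 0]) => [/existsP[i yi]|].
  apply: ltr_wpDl; first by rewrite mulr_ge0 ?sqr_ge0 ?ltW.
  by apply: (t y); exists i.
rewrite negb_exists => /forallP H; have y0 i : y i = 0 by apply/eqP; have := H i; rewrite negbK.
rewrite [X in _ + X]big1 ?addr0; last by move=> i _; rewrite y0 mulr0 mul0r.
rewrite mulr_gt0 // exprn_even_gt0 //=; case: xn => i; apply: contraNneq => c0.
by have := y0 i; rewrite /y c0 mul0r subr0 => ->.
Qed.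

Lemma orth_exists B k : tree_at d B k -> exists z, orth B k z /\ 0 < z k.
Proof.
(* The system projects [e_k] away from the forest. Since [k] is isolated in [delv B k], the
   right-hand side 0 there forces [y k = 0]. *)
move=> t; have [y Hy] := pd_solve (fun i => if i == k then 0 else - (B i k)%:~R : rat) t.
have yk : y k = 0.
  have := Hy k; rewrite eqxx /lin (bigD1 k) //= big1 ?addr0.
    by rewrite mxE eqxx => /eqP; rewrite mulf_eq0 intr_eq0 => /eqP.
  by move=> i ik; rewrite !mxE eqxx [k == i]eq_sym (negbTE ik) /= normr0 oppr0 mul0r.
pose x : 'I_n -> rat := fun i => if i == k then 1 else y i.
have [N [z [N0 Hz]]] := int_scale x.
exists z; split.
  move=> i ik; apply/eqP; rewrite -(intr_eq0 rat) -lin_int.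
  have -> : lin (rooted B k) (fun j => (z j)%:~R) i = N%:~R * lin (rooted B k) x i.
    by rewrite -lin_scale; apply: eq_bigr => j _; rewrite Hz.
  rewrite mulf_eq0; apply/orP; right.
  have -> : lin (rooted B k) x i = (B i k)%:~R + lin (rooted B k) y i.
    rewrite /lin (bigD1 k) //= [in RHS](bigD1 k) //= yk mulr0 add0r /x eqxx mulr1.
    rewrite mxE (negbTE ik) eqxx; congr (_ + _); apply: eq_bigr => j /negbTE ->; by [].
  by rewrite (qform_root0 B yk).2 // Hy (negbTE ik) addrN.
by rewrite -(ltr0z rat) Hz /x eqxx mulr1 ltr0z.
Qed.

End Steps.

(** * The class of matrices with bounded mutations *)

Section Finite.
Variables (n : nat) (d : 'I_n -> int).
Hypothesis d_gt0 : forall i, 0 < d i.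
Implicit Types (B A : 'M[int]_n) (i j k u v w x y : 'I_n) (z : 'I_n -> int) (ks l : seq 'I_n).

(** With [y] the forest part of [z], the vector [r] is chosen so that its product with [y] is the
    sum of the [z i]. The form of [y] depends only on [m] and [e], so non-negativity at [y + r]
    bounds the sum from below, uniformly in [B] and [z]. *)
Lemma orth_sum_bound (C0 : 'M[int]_n) k (m e : int) : pd d rat C0 ->
  exists N : int, forall B z, skew_by d B -> cartan_counterpart (delv B k) = C0 -> orth B k z ->
  z k = m -> zlin (rooted B k) z k = e -> 0 < 2 * (\sum_(i | i != k) z i) + N.
Proof.
move=> p; have [r Hr] := pd_solve (fun i => if i == k then 0 else ((d i)%:~R)^-1 : rat) p.
pose c : rat := (- (m * (d k * (e - 2 * m))))%:~R + qform d C0 r.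
exists (Num.bound `|c|)%:Z => B z s EC o zk ek; rewrite -(ltr0z rat).
have [c1 c2 c3] := rooted_companion d_gt0 k s.
pose y : 'I_n -> rat := fun i => if i == k then 0 else (z i)%:~R.
have yk : y k = 0 by rewrite /y eqxx.
have [q1 q2] := qform_root0 d B yk.
have ly i : i != k -> lin (rooted B k) y i = - (rooted B k i k * m)%:~R.
  move=> ik; have := lin_int rat (rooted B k) z i; rewrite o // => h.
  apply/eqP; rewrite -addr_eq0; apply/eqP; apply: etrans _ h.
  rewrite -zk /lin (bigD1 k) //= yk mulr0 add0r [RHS](bigD1 k) //= addrC.
  rewrite rmorphM; congr (_ + _); apply: eq_bigr => j jk; by rewrite /y (negbTE jk).
have qy : qform d C0 y = (- (m * (d k * (e - 2 * m))))%:~R.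
  rewrite -EC -q1 /qform (bigD1 k) //= yk mulr0 mul0r add0r.
  transitivity (\sum_(i | i != k) (- (m * (d k * (rooted B k k i * z i))))%:~R : rat).
    apply: eq_bigr => i ik; rewrite ly // /y (negbTE ik) -!rmorphM -rmorphN -rmorphM /=; congr (_%:~R).
    have := c2 i k => h; have -> : d k * (rooted B k k i * z i) = d i * rooted B k i k * z i by rewrite h; ring.
    by ring.
  rewrite -rmorph_sum sumrN -!mulr_sumr /=; congr (- (m * (d k * _)))%:~R.
  by rewrite -ek /zlin [in RHS](bigD1 k) //= c1 zk; ring.
have by0 : bil d C0 y r = (\sum_(i | i != k) z i)%:~R.
  rewrite /bil (bigD1 k) //= yk mulr0 mul0r add0r rmorph_sum; apply: eq_bigr => i ik.
  rewrite Hr (negbTE ik) /y (negbTE ik) mulrAC divff ?mul1r // intr_eq0 gt_eqF //.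
have sC i j : d i * C0 i j = d j * C0 j i.
  by have [_ h _] := cartan_companion d_gt0 (delv_skew k s); rewrite -EC.
have q0 (x : 'I_n -> rat) : 0 <= qform d C0 x.
  case: (boolP [exists i, x i != 0]) => [/existsP[i xi]|]; first by apply/ltW/p; exists i.
  rewrite negb_exists => /forallP H; rewrite /qform big1 // => i _.
  by have := H i; rewrite negbK => /eqP ->; rewrite mulr0 mul0r.
have := q0 (fun i => y i + r i); rewrite qformD // qy by0 => h.
have b : `|c| < (Num.bound `|c|)%:R by apply: archi_boundP.
have cc : c <= `|c| by apply: ler_norm.
rewrite rmorphD rmorphM /= -pmulrn; move: h b cc; rewrite {1 3}/c.
set t : rat := (\sum_(i | _) _)%:~R; set q := qform _ _ _; set a := (- _)%:~R; clear; lra.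
Qed.

Section Class.
Variable P : 'M[int]_n -> Prop.
Hypothesis P_skew : forall B, P B -> skew_by d B.
Hypothesis P_mut : forall B i, P B -> P (mutate B i).
Hypothesis P_or : forall B, P B -> oriented B.

Definition sink_spec B k z := exists ks z1, let B1 := foldl (@mutate n) B ks in
  [/\ tree_at d B1 k, orth B1 k z1, z1 k = z k, zlin (rooted B1 k) z1 k = zlin (rooted B k) z k &
      forall u, B1 k u <= 0].

(** A move along an outgoing spoke adds the negative number [B u k * z k] to the sum of the forest
    coordinates. By [orth_sum_bound] this cannot go on for ever. *)
Lemma sink_at B k z : P B -> tree_at d B k -> orth B k z -> 0 < z k -> sink_spec B k z.
Proof.
move=> pB t o zk; have [N HN] := @orth_sum_bound _ k (z k) (zlin (rooted B k) z k) t.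
(* The forest form, [z k] and the value at [k] are invariant under the moves; naming them keeps the
   bound [N] fixed throughout the induction. *)
move: (erefl (cartan_counterpart (delv B k))) (erefl (z k)) (erefl (zlin (rooted B k) z k)) HN.
move: {1 3}(cartan_counterpart _) {1 3}(z k) {1 3}(zlin _ _ _) => C0 m0 e0 EC Em0 Ee0 HN.
have [m] := ubnP (absz (2 * (\sum_(i | i != k) z i) + N)).
elim: m B z pB t o zk Em0 Ee0 EC => // m IH B z pB t o zk Em0 Ee0 EC.
rewrite ltnS => Hm; case: (boolP [exists u, 0 < B k u]) => [/existsP[u bku]|]; last first.
  rewrite negb_exists => /forallP H; exists [::], z; split => // u.
  by have := H u; rewrite -leNgt.
have s := P_skew pB.
have uk : u != k by apply: contraTneq bku => ->; rewrite (skew_diag d_gt0 _ s).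
have bku0 : B k u != 0 by rewrite gt_eqF.
have [ks [h1 h2 h3 h4]] := spoke_step d_gt0 P_skew P_mut P_or pB t uk bku0 o.
pose B1 := foldl (@mutate n) B ks; pose z1 := upd z u (B u k * z k).
have pB1 : P B1 := P_foldl P_mut ks pB.
have z1k : z1 k = z k by rewrite /z1 /upd eq_sym (negbTE uk).
have ES : \sum_(i | i != k) z1 i = \sum_(i | i != k) z i + B u k * z k.
  rewrite (bigD1 u) //= [in RHS](bigD1 u) //= /z1 /upd eqxx.
  rewrite (eq_bigr z); last by move=> i /andP[_ /negbTE ->].
  by rewrite addrAC.
have buk : B u k * z k < 0 by rewrite pmulr_llt0 // (skew_lt0 d_gt0 _ _ s).
have EC1 : C0 = cartan_counterpart (delv B1 k) by rewrite h2.
have t1 : tree_at d B1 k by rewrite /tree_at h2.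
have P1 := HN B z s (esym EC) o (esym Em0) (esym Ee0).
have z1k0 : m0 = z1 k by rewrite z1k.
have e1k0 : e0 = zlin (rooted B1 k) z1 k by rewrite h4.
have P2 := HN B1 z1 (P_skew pB1) (esym EC1) h3 (esym z1k0) (esym e1k0).
have zk1 : 0 < z1 k by rewrite z1k.
have lt : (absz (2 * (\sum_(i | i != k) z1 i) + N)%R < m)%N.
  apply: leq_trans Hm; move: P1 P2 buk; rewrite ES; set S := \sum_(i | _) _.
  by set b := B u k * z k; clearbody S b; clear; lia.
have [ks' [z2 [g1 g2 g3 g4 g5]]] := IH B1 z1 pB1 t1 h3 zk1 z1k0 e1k0 EC1 lt.
exists (ks ++ ks'), z2; rewrite foldl_cat -/B1; split => //.
  by rewrite g3 z1k.
by rewrite g4 h4.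
Qed.

End Class.

(** At a sink the off-diagonal entries of the rooted companion involving [k] are all non-negative,
    so negating [e_k] gives the Cartan counterpart. *)
Lemma sink_cartan B k z : skew_by d B -> tree_at d B k -> orth B k z -> 0 < z k ->
  0 < zlin (rooted B k) z k -> (forall u, B k u <= 0) -> pd d rat (cartan_counterpart B).
Proof.
move=> s t o zk ek Hk; have p := rooted_pd d_gt0 s t o zk ek.
apply: (@pd_gauge n d rat (rooted B k) _ (fun i => if i == k then -1 else 1)) p.
  by move=> i; case: ifP.
move=> i j; rewrite !mxE; case: (eqVneq i j) => [<-|ij]; first by case: eqP.
case: (eqVneq i k) => [ik|ik].
  rewrite ik in ij *; rewrite eq_sym (negbTE ij) ler0_norm //; ring.
case: (eqVneq j k) => [->|jk]; last by ring.
rewrite ger0_norm; first by ring.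
by rewrite leNgt (skew_lt0 d_gt0 _ _ s) -leNgt.
Qed.

Lemma pd_back (F : realFieldType) B ks : skew_by d B ->
  pd d F (cartan_counterpart (foldl (@mutate n) B ks)) ->
  exists A, [/\ companion d B A, pd d F A & oriented B].
Proof.
elim: ks B => [|k ks IH] B s /= p.
  exists (cartan_counterpart B); split => //; first exact: cartan_companion.
  by move=> k l E; have := cartan_no_ear d_gt0 k l s p; rewrite E.
have s' := mutate_skew d_gt0 k s; have [A [c pA o]] := IH _ s' p.
have [_ c' p' o'] := oriented_mutate d_gt0 k s' c pA o; rewrite (mutateK _ s) in c' o'.
by exists (mutate_companion A (mutate B k) k).
Qed.

(** Lets the induction run on the size of [U] while matrices keep their size [n]. *)
Definition supp (U : {set 'I_n}) B := forall i j, i \notin U -> B i j = 0.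
Definition bounded B := forall ks i j, i != j ->
  `|foldl (@mutate n) B ks i j * foldl (@mutate n) B ks j i| <= 3.
Definition cls U B := [/\ skew_by d B, supp U B & bounded B].

Lemma supp_col U B i j : skew_by d B -> supp U B -> j \notin U -> B i j = 0.
Proof. by move=> s h jU; apply/eqP; rewrite (skew_eq0 d_gt0 _ _ s) h. Qed.

Lemma supp_mutate U B k : supp U B -> supp U (mutate B k).
Proof.
move=> h i j iU; have [ik|ik] := eqVneq i k; first by rewrite -ik mutate_row h // oppr0.
have [->|jk] := eqVneq j k; first by rewrite mutate_col h // oppr0.
by rewrite mutateE // (h i j iU) (h i k iU) sgr0 mul0r addr0.
Qed.

Lemma cls_mutate U B k : cls U B -> cls U (mutate B k).
Proof.
case=> s h b; split; [exact: mutate_skew|exact: supp_mutate|].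
by move=> ks i j ij; apply: (b (k :: ks)).
Qed.

Lemma delv_mutate B k i : i != k -> mutate (delv B k) i = delv (mutate B i) k.
Proof.
move=> ik; apply/matrixP => a b; rewrite [RHS]mxE.
case: (eqVneq a k) => [ak|ak] /=.
  have [bi|bi] := eqVneq b i; first by rewrite bi mutate_col mxE ak eqxx oppr0.
  by rewrite mutateE // ?mxE ak ?eqxx ?sgr0 ?mul0r ?addr0 // eq_sym.
case: (eqVneq b k) => [bk|bk] /=.
  have [ai|ai] := eqVneq a i; first by rewrite ai mutate_row mxE bk eqxx orbT oppr0.
  rewrite mutateE // ?bk 1?eq_sym //; rewrite ![delv _ _ _ _]mxE !eqxx !orbT mulr0 maxxx mulr0 addr0 //.
by rewrite [LHS]mxE [RHS]mxE !delvE.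
Qed.

Lemma delv_mutate_k B k : mutate (delv B k) k = delv B k.
Proof.
apply/matrixP => a b; rewrite [LHS]mxE; case: ifP => h; first by rewrite !mxE h oppr0.
by rewrite ![delv _ _ _ _]mxE h eqxx !orbT sgr0 mul0r addr0.
Qed.

Lemma delv_foldl B k ks :
  foldl (@mutate n) (delv B k) ks = delv (foldl (@mutate n) B (filter (predC1 k) ks)) k.
Proof.
elim: ks B => //= i ks IH B; have [->|ik] := eqVneq i k; first by rewrite delv_mutate_k IH.
by rewrite delv_mutate // IH.
Qed.

Lemma cls_delv U B k : cls U B -> cls (U :\ k) (delv B k).
Proof.
case=> s h b; split; first exact: delv_skew.
  move=> i j; rewrite !inE negb_and negbK => /orP[/eqP->|iU]; rewrite mxE ?eqxx //.
  by case: ifP => // _; apply: h.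
move=> ks i j ij; rewrite delv_foldl !mxE orbC; case: ifP => _; first by rewrite mul0r.
exact: b.
Qed.

Section Inductive.
Variable m : nat.
Hypothesis IH : forall (U : {set 'I_n}) B, (#|U| <= m)%N -> cls U B ->
  exists ks, pd d rat (cartan_counterpart (foldl (@mutate n) B ks)).
Variable U : {set 'I_n}.
Hypothesis HU : (#|U| <= m.+1)%N.

Lemma delv_pd B u : cls U B -> u \in U ->
  exists A, [/\ companion d (delv B u) A, pd d rat A & oriented (delv B u)].
Proof.
move=> cB uU; have [s _ _] := cls_delv u cB.
have [|ks p] := IH (B := delv B u) (U := U :\ u) _ (cls_delv u cB).
  by move: HU; rewrite (cardsD1 u) uU.
exact: pd_back p.
Qed.

Lemma proper_passes B (z : 'I_n) l u : cls U B -> ear B z l -> u \in U -> u \notin z :: l ->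
  forall x, x \in z :: l -> passes B (z :: l) x.
Proof.
move=> cB E uU ul x xl; have [s _ _] := cls_delv u cB; have [A [_ _ o]] := delv_pd cB uU.
have nu w : w \in z :: l -> w != u by move=> wl; apply: contraNneq ul => <-.
rewrite -(@eq_passes _ (delv B u)); last by move=> y yl; rewrite delvE ?nu.
apply: oriented_passes => //; first exact: skew_sym s.
  by move=> i; apply: skew_diag s.
by rewrite /= (@eq_ear _ _ B) // => a b al bl; rewrite delvE ?nu.
Qed.

(* Mutating at a vertex of the cycle that is already passed through shortens the cycle, so that
   the induction hypothesis applies; on a triangle the bound on the weights does the same job. *)
Lemma one_pass_all B w l : cls U B -> ear B w l -> B w (head w l) * B w (last w l) < 0 ->
  forall x, x \in w :: l -> passes B (w :: l) x.
Proof.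
move=> cB E t2; have [s hU bd] := cB.
have sB := skew_sym d_gt0 s; have B0 i := skew_diag d_gt0 i s.
have bs i j := skew_sg d_gt0 s i j.
have := E; case: l E t2 => [|y l1] E t2; first by case/and4P.
case/and4P=> Hi sl kl _; have /and3P[Hi1 yl1 /allP Hy] := Hi.
rewrite /= in t2; set x := last y l1 in t2.
have l10 : l1 <> [::] by move=> e; rewrite e in sl.
have xl1 : x \in l1 by rewrite /x; case: (l1) l10 => // a l _; rewrite /= mem_last.
have xl : x \in y :: l1 by rewrite inE xl1 orbT.
have yl : y \in y :: l1 by rewrite mem_head.
have nk a : a \in y :: l1 -> a != w by move=> al; apply: contraNneq kl => <-.
have xy : x != y by apply: contraNneq yl1 => <-.
have yx : y != x by rewrite eq_sym.
have adj a : a \in y :: l1 -> (B w a != 0) = (a == y) || (a == x).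
  by move=> al; rewrite (ear_adj E al).
have bky : B w y != 0 by rewrite adj // eqxx.
have bkx : B w x != 0 by rewrite adj // eqxx orbT.
have wU : w \in U by apply: contraNT bky => wU; rewrite hU.
have unatt a : a \in y :: l1 -> a != y -> a != x -> B w a = 0 /\ B a w = 0.
  move=> al ay ax; have : ~~ (B w a != 0) by rewrite adj // negb_or ay ax.
  by rewrite negbK => /eqP h; split => //; apply/eqP; rewrite (skew_eq0 d_gt0 _ _ s) h.
have sk : Num.sg (B w y) * Num.sg (B w x) = -1 by rewrite -sgrM ltr0_sg.
have Hyx : 0 < B y w * B w x by rewrite -sgr_gt0 sgrM (bs w y) mulNr sk.
have Hxy : 0 < B x w * B w y by rewrite -sgr_gt0 sgrM (bs w x) mulNr mulrC sk.
have sgyx : Num.sg (B y w) = Num.sg (B w x).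
  have := sg2 bkx; have : Num.sg (B y w) * Num.sg (B w x) = 1 by rewrite -sgrM gtr0_sg.
  move=> e1 e2; rewrite -[LHS]mulr1 -e2 mulrA e1 mul1r //.
have pk : passes B (w :: y :: l1) w by rewrite (ear_passes (B0 w) E).
case El: l1 => [|h l2] //; have [l20|l20] := eqVneq l2 [::].
  subst l2; have xh : x = h by rewrite /x El.
  rewrite -xh in El *.
  have byx : B y x != 0 by have := Hy x xl1; rewrite El /= eqxx => /eqP.
  have bxy : B x y != 0 by rewrite sB.
  have neg : Num.sg (B y x) = - Num.sg (B y w).
    have [//|h0] := eqVneq (Num.sg (B y x)) (- Num.sg (B y w)).
    have eqs : Num.sg (B y x) = Num.sg (B y w).
      have byw : B y w != 0 by rewrite sB.
      by move: h0; have := sg2 byx; have := sg2 byw; move: (Num.sg _) (Num.sg _) => p q; clear; nia.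
    have eqs' : Num.sg (B x y) = Num.sg (B x w).
      by rewrite (bs y x) eqs sgyx (bs w x).
    have := bd [:: w] y x yx; rewrite /= !mutate_pos ?nk // => bd'; exfalso.
    have big a b : a != b -> 0 < B a w * B w b -> B a b != 0 -> Num.sg (B a b) = Num.sg (B a w) ->
        2 <= `|B a b + Num.sg (B a w) * (B a w * B w b)|.
      move=> ab p0 b0 e; have := numEsg (B a b); rewrite e => ->.
      have a0 : B a w != 0 by apply: contraTneq p0 => ->; rewrite mul0r.
      rewrite -mulrDr normrM normr_sg a0 mul1r ger0_norm; last by rewrite addr_ge0 // ltW.
      by have := norm_ge1 b0; move: p0; clear; lia.
    have h1 := big y x yx Hyx byx eqs; have h2 := big x y xy Hxy bxy eqs'.
    have : 2 * 2 <= `|B y x + Num.sg (B y w) * (B y w * B w x)| * `|B x y + Num.sg (B x w) * (B x w * B w y)|.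
      by apply: ler_pM.
    by rewrite -normrM leNgt (le_lt_trans bd').
  move=> v; rewrite !inE => /or3P[]/eqP ->.
  - by move: pk; rewrite El.
  - apply: (@passes_intro _ _ _ _ w x); rewrite ?inE ?eqxx ?orbT // neg mulrN.
    by rewrite sg2 // sB.
  - apply: (@passes_intro _ _ _ _ w y); rewrite ?inE ?eqxx ?orbT //.
    by rewrite (bs y x) neg opprK (bs w x) -sgyx mulNr sg2 // sB.
have l2l : x \in l2 by rewrite /x El /=; case: (l2) l20 => // a l _; rewrite /= mem_last.
have xh : x != h.
  by move: Hi1; rewrite El => /andP[_ /andP[+ _]]; apply: contraNneq => <-.
have byx : B y x = 0.
  by apply/eqP; rewrite -[_ == 0]negbK (eqP (Hy _ xl1)) El /= xh.
have bxy : B x y = 0 by apply/eqP; rewrite (skew_eq0 d_gt0 _ _ s) byx.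
pose B' := mutate B w.
have byx' : Num.sg (B' y x) = Num.sg (B y w).
  by rewrite /B' mutate_pos ?nk // byx add0r sgrM sgr_id (gtr0_sg Hyx) mulr1.
have bxy' : Num.sg (B' x y) = Num.sg (B x w).
  by rewrite /B' mutate_pos ?nk // bxy add0r sgrM sgr_id (gtr0_sg Hxy) mulr1.
have byx0 : B' y x != 0 by rewrite -sgr_eq0 byx' sgr_eq0 sB.
have sm u v : u \in y :: l1 -> v \in y :: l1 -> ~~ ((u == x) && (v == y)) ->
    ~~ ((u == y) && (v == x)) -> B' u v = B u v.
  move=> ul vl h1 h2; apply: mutate_npos; rewrite ?nk //; move: h1 h2.
  have sq a : B a w * B w a <= 0.
    by rewrite -sgr_le0 sgrM (bs w a) mulNr -expr2 oppr_le0 sqr_ge0.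
  have [->|ux] := eqVneq u x; have [->|vy] := eqVneq v y => //= _.
  - by have [->|vx] := eqVneq v x => _; rewrite ?sq // (unatt v vl vy vx).1 mulr0.
  - by have [->|uy] := eqVneq u y => _; rewrite ?sq // (unatt u ul uy ux).2 mul0r.
  - have [->|uy] := eqVneq u y => /= vx; last by rewrite (unatt u ul uy ux).2 mul0r.
    by rewrite (unatt v vl vy vx).1 mulr0.
have E2 : ear B' y l1.
  have ny a : a \in l1 -> (a == y) = false by move=> al; apply/negbTE; apply: contraNneq yl1 => <-.
  have Hl : induced_path B' l1.
    rewrite (@eq_induced_path _ B' B) // => u v ul vl.
    by rewrite (sm u v) ?inE ?ul ?vl ?orbT // ny ?andbF.
  apply/and4P; split => //; first by rewrite El; case: (l2) l20.
  apply/allP => a al; have [->|ax] := eqVneq a x; first by rewrite byx0 orbT.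
  rewrite (sm y a) ?inE ?eqxx ?al ?orbT ?(negbTE yx) ?(negbTE ax) ?andbF //.
  by rewrite (eqP (Hy _ al)) orbF.
have pB := proper_passes (cls_mutate w cB) E2 wU kl.
move=> v; rewrite -El inE => /orP[/eqP -> //|vl]; apply: (passes_sub (pB v vl)) => a al ba.
case: (boolP ((v == x) && (a == y))) => [/andP[/eqP-> /eqP->]|h1].
  by exists w; rewrite ?mem_head // bxy'.
case: (boolP ((v == y) && (a == x))) => [/andP[/eqP-> /eqP->]|h2].
  by exists w; rewrite ?mem_head // byx'.
by exists a; [rewrite in_cons al orbT|rewrite -(sm v a)].
Qed.

(** Only a cycle filling all of [U] is not covered by deletion. By [one_pass_all] it is passed at
    every vertex or at none. If at none, mutating at [k] merely reverses the two arrows there: the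
    neighbour [head k l] becomes passed, [k] does not, which is a contradiction. *)
Lemma cls_oriented B : cls U B -> oriented B.
Proof.
move=> cB k l E; have [s hU bd] := cB.
have sB := skew_sym d_gt0 s; have B0 i := skew_diag d_gt0 i s.
rewrite -(ear_passes (B0 k) E); have kZ : k \in k :: l by rewrite mem_head.
case: (boolP [exists u, (u \in U) && (u \notin k :: l)]) => [/existsP[u /andP[uU ul]]|Hn].
  exact: proper_passes E uU ul _ kZ.
have UZ u : u \in U -> u \in k :: l.
  by move=> uU; move: Hn; rewrite negb_exists => /forallP /(_ u); rewrite uU negbK.
have any C x : cls U C -> ear C k l -> x \in k :: l -> passes C (k :: l) x -> passes C (k :: l) k.
  move=> cC EC xZ px; have [sC _ _] := cC; have sCs := skew_sym d_gt0 sC.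
  have [l' El' [i Ei]] := ecycle_to sCs (EC : ecycle C (k :: l)) xZ.
  have mem y : (y \in x :: l') = (y \in k :: l) by rewrite -Ei mem_rot.
  rewrite -(passes_mem _ _ mem); apply: one_pass_all => //; last by rewrite mem.
  by rewrite -(ear_passes (skew_diag d_gt0 x sC) El') (passes_mem _ _ mem).
case: (boolP (passes B (k :: l) k)) => // np; exfalso.
have hh := ear_head E; have hl := ear_last E.
move: (np); rewrite (ear_passes (B0 k) E) => nlt.
have gt : 0 < B k (head k l) * B k (last k l).
  by rewrite lt_neqAle eq_sym mulf_neq0 ?(ear_adj_head E) ?(ear_adj_last E) //= leNgt.
pose B1 := mutate B k.
have same a b : a != k -> b != k -> B1 a b = B a b.
  move=> ak bk; apply: mutate_npos => //.
  have nb c : B k c != 0 -> c = head k l \/ c = last k l.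
    move=> bc; have cU : c \in U by apply: contraNT bc => cU; rewrite (supp_col _ s hU cU).
    have := UZ c cU; rewrite in_cons => /predU1P[ck|cl]; first by move: bc; rewrite ck B0 eqxx.
    by move: bc; rewrite (ear_adj E cl) => /orP[/eqP|/eqP]; [left|right].
  have [a0|a0] := eqVneq (B k a) 0.
    have /eqP -> : B a k == 0 by rewrite (skew_eq0 d_gt0 _ _ s) a0.
    by rewrite mul0r.
  have [b0|b0] := eqVneq (B k b) 0; first by rewrite b0 mulr0.
  rewrite -sgr_le0 sgrM (skew_sg d_gt0 s k a) mulNr -sgrM oppr_le0 sgr_ge0.
  case: (nb a a0) => ->; case: (nb b b0) => ->; rewrite -?expr2 ?sqr_ge0 ?(ltW gt) //.
  by rewrite mulrC ltW.
have c1 : cls U B1 by apply: cls_mutate.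
have E1 : ear B1 k l.
  rewrite (@eq_ear _ B1 B) // => a b _ _; have [->|ak] := eqVneq a k.
    by rewrite /B1 mutate_row oppr_eq0.
  have [->|bk] := eqVneq b k; first by rewrite /B1 mutate_col oppr_eq0.
  by rewrite same.
have yZ : head k l \in k :: l by rewrite in_cons hh orbT.
have yk : head k l != k by case/and4P: E => _ _ kl _; apply: contraNneq kl => <-.
have py : passes B1 (k :: l) (head k l).
  have [l' El' [i Ei]] := ecycle_to sB (E : ecycle B (k :: l)) yZ.
  have mem v : (v \in head k l :: l') = (v \in k :: l) by rewrite -Ei mem_rot.
  have npy : ~~ passes B (k :: l) (head k l) by apply: contraNN np => h; apply: any h.
  move: npy; rewrite -(passes_mem _ _ mem) (ear_passes (B0 _) El') -(passes_mem _ _ mem) => npy.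
  have kl' : k \in l' by have := mem k; rewrite !in_cons eqxx eq_sym (negbTE yk).
  have adjk : B (head k l) k != 0 by rewrite sB; apply: ear_adj_head E.
  have ah := ear_adj_head El'; have al := ear_adj_last El'.
  have hl' := ear_head El'; have ll' := ear_last El'.
  have gt' : 0 < B (head k l) (head (head k l) l') * B (head k l) (last (head k l) l').
    by rewrite lt_neqAle eq_sym mulf_neq0 //= leNgt.
  have ne : head (head k l) l' != last (head k l) l'.
    have /and4P[h1 h2 _ _] := El'; case: (l') (induced_path_uniq h1) h2 => // p [|p' q] //=.
    by move=> /andP[h _] _; apply: contraNneq h => ->; rewrite mem_last.
  have sg1 : Num.sg (B (head k l) (head (head k l) l')) * Num.sg (B (head k l) (last (head k l) l')) = 1.
    by rewrite -sgrM gtr0_sg.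
  apply: (@passes_intro _ _ _ _ (head (head k l) l') (last (head k l) l')).
  - by rewrite in_cons hl' orbT.
  - by rewrite in_cons ll' orbT.
  - move: adjk; rewrite (ear_adj El' kl') => /orP[/eqP ek|/eqP ek].
      rewrite -ek in ne sg1 *; rewrite /B1 mutate_col sgrN -/B1 same //; last by rewrite eq_sym.
      by rewrite mulNr sg1.
    rewrite -ek in ne sg1 *; rewrite /B1 mutate_col sgrN -/B1 same //.
    by rewrite mulrN sg1.
have := any B1 _ c1 E1 yZ py; rewrite ear_passes //; last first.
  by apply: skew_diag (mutate_skew d_gt0 k s).
by rewrite /B1 !mutate_row mulrNN ltNge ltW.
Qed.

End Inductive.
End Finite.

(** * Descent on the orthogonal vector *)

Section Descent.
Variables (n : nat) (d : 'I_n -> int).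
Hypothesis d_gt0 : forall i, 0 < d i.
Implicit Types (B A : 'M[int]_n) (i j k u v w : 'I_n) (x y z : 'I_n -> int) (ks l : seq 'I_n).

(** This is why the companion is skew at [k]: every chordless cycle runs through [k], its edges in
    the forest count +1, and the two spokes contribute -1 exactly because the cycle is oriented at
    [k]. *)
Lemma rooted_odd B k : skew_by d B -> oriented B -> tree_at d B k -> odd_signs B (rooted B k).
Proof.
move=> s o t k0 l0 E0; have sB := skew_sym d_gt0 s.
have fT u v : u != k -> v != k -> B u v != 0 -> sgn_edge (rooted B k) u v = 1.
  move=> uk vk b; have uv : u != v by apply: contraNneq b => <-; rewrite (skew_diag d_gt0 _ s).
  by rewrite /sgn_edge mxE (negbTE uv) (negbTE uk) (negbTE vk) opprK gtr0_sg // normr_gt0.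
case: (boolP (k \in k0 :: l0)) => [kZ|kZ]; last first.
  have nk w : w \in k0 :: l0 -> w != k by move=> wl; apply: contraNneq kZ => <-.
  have := cartan_no_ear d_gt0 k0 l0 (delv_skew k s) t; rewrite (@eq_ear _ _ B) ?E0 // => a b al bl.
  by rewrite delvE ?nk.
have [l El [i Ei]] := ecycle_to sB (E0 : ecycle B (k0 :: l0)) kZ.
rewrite -(cprod_rot _ _ i) Ei; have := o _ _ El; have /and4P[Hi _ kl _] := El.
have := ear_adj_head El; have := ear_adj_last El.
case: l {Ei} El Hi kl => [|y l] El Hi kl; first by case/and4P: El.
rewrite /cprod rcons_cons /= pprod_rcons => bl by0 Hlt.
have nk w : w \in y :: l -> w != k by move=> wl; apply: contraNneq kl => <-.
have yk := nk y (mem_head _ _); have lk := nk _ (mem_last y l).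
have -> : pprod (sgn_edge (rooted B k)) y l = 1.
  rewrite (@pprod_ipath _ B _ (fun _ _ => 1)) //; last first.
    by move=> u v ul vl; apply: fT; rewrite nk.
  by elim: (l) y {El Hi kl bl by0 Hlt nk yk lk} => //= a q IH y; rewrite IH mulr1.
rewrite mul1r /sgn_edge !mxE eqxx [k == y]eq_sym (negbTE yk) (negbTE lk) opprK.
by rewrite sgrN (skew_sg d_gt0 s k (last y l)) opprK -sgrM ltr0_sg.
Qed.

Lemma zform_rat A x : (zform d A x)%:~R = qform d A (fun i => (x i)%:~R) :> rat.
Proof. by rewrite qform_int. Qed.

Definition zin A B k x : int := \sum_(i | 0 < B i k) A k i * x i.
(** Coordinates of the same vector in the mutated basis; the integral form of [mutLinv]. *)
Definition zmut A B k x : 'I_n -> int := fun j => if j == k then x k + zin A B k x else x j.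

Lemma zmut_rat A B k x j : (zmut A B k x j)%:~R = mutLinv A B k (fun i => (x i)%:~R) j :> rat.
Proof.
rewrite /zmut /mutLinv; case: ifP => // _; rewrite rmorphD rmorph_sum /=; congr (_ + _).
by apply: eq_bigr => i _; rewrite rmorphM.
Qed.

Lemma zmut_spec A B k x : skew_by d B -> companion d B A ->
  let A' := mutate_companion A B k in let x' := zmut A B k x in
  [/\ zform d A' x' = zform d A x,
      (forall i, zlin A x i = 0) -> forall i, zlin A' x' i = 0 &
      (exists i, x i != 0) -> exists i, x' i != 0].
Proof.
move=> s c A' x'; pose xr : 'I_n -> rat := fun i => (x i)%:~R.
have E j : mutL A B k (fun i => (x' i)%:~R) j = xr j.
  rewrite -(mutLK d_gt0 A k xr s j) /mutL; case: ifP => _.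
    by rewrite zmut_rat; congr (_ - _); apply: eq_bigr => i _; rewrite zmut_rat.
  by rewrite zmut_rat.
have El i : lin A (mutL A B k (fun i => (x' i)%:~R)) i = (zlin A x i)%:~R :> rat.
  by rewrite -lin_int; apply: eq_bigr => j _; rewrite E.
split.
- apply: (@intr_inj rat); rewrite !zform_rat qform_mutate //.
  by apply: eq_bigr => i _; rewrite E; congr (_ * _); apply: eq_bigr => j _; rewrite E.
- move=> H i; apply: (@intr_inj rat); rewrite -lin_int; have [->|ik] := eqVneq i k.
    by rewrite (lin_mutate_k d_gt0) // El H.
  by rewrite (lin_mutate d_gt0) // !El !H mulr0 subr0.
move=> [i xi]; case: (boolP [exists j, x' j != 0]) => [/existsP[j]|]; first by exists j.
rewrite negb_exists => /forallP H; exfalso; have x0 j : x' j = 0 by apply/eqP; have := H j; rewrite negbK.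
have xj j : j != k -> x j = 0 by move=> /negbTE jk; have := x0 j; rewrite /x' /zmut jk.
have xk : x k = 0.
  have := x0 k; rewrite /x' /zmut eqxx /zin big1 ?addr0 // => j bj; rewrite xj ?mulr0 //.
  by apply: contraTneq bj => ->; rewrite (skew_diag d_gt0 _ s).
by move: xi; have [->|ik] := eqVneq i k; rewrite ?xk ?xj ?eqxx.
Qed.

Section Inductive.
Variable m : nat.
Hypothesis IH : forall (U : {set 'I_n}) B, (#|U| <= m)%N -> cls d U B ->
  exists ks, pd d rat (cartan_counterpart (foldl (@mutate n) B ks)).
Variable U : {set 'I_n}.
Hypothesis HU : (#|U| <= m.+1)%N.
Variable k : 'I_n.
Hypothesis kU : k \in U.

Let P := cls d U.
Let P_skew B : P B -> skew_by d B. Proof. by case. Qed.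
Let P_mut B i : P B -> P (mutate B i). Proof. exact: cls_mutate. Qed.
Let P_or B : P B -> oriented B. Proof. exact: (cls_oriented d_gt0 IH HU). Qed.
Let P_wt B : P B -> forall i j, i != j -> `|B i j * B j i| < 4.
Proof. by case=> _ _ b i j ij; have := b [::] i j ij; move: (B i j * B j i); clear; lia. Qed.

(** A mutation changes only the coordinate at its own vertex, so a sequence avoiding [k] keeps
    [x k]. *)
Lemma carry B A x ks : P B -> companion d B A -> odd_signs B A -> k \notin ks -> exists A' x',
  let B' := foldl (@mutate n) B ks in
  [/\ companion d B' A', odd_signs B' A', x' k = x k &
  [/\ zform d A' x' = zform d A x, (forall i, zlin A x i = 0) -> forall i, zlin A' x' i = 0 &
      (exists i, x i != 0) -> exists i, x' i != 0]].
Proof.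
elim: ks B A x => [|i ks IHk] B A x pB c a; first by exists A, x.
rewrite in_cons negb_or => /andP[ki kks].
have [c' a'] := odd_mutate d_gt0 (P_skew pB) c (P_or pB) a (P_wt pB) (P_or (P_mut i pB)).
have [z1 z2 z3] := zmut_spec i x (P_skew pB) c.
have [A2 [x2 [h1 h2 h3 [h4 h5 h6]]]] := IHk _ _ (zmut A B i x) (P_mut i pB) c' a' kks.
exists A2, x2; split => //; first by rewrite h3 /zmut (negbTE ki).
by split => [|/z2/h5|/z3/h6] //; rewrite h4 z1.
Qed.

Lemma retree B : P B -> exists ks, k \notin ks /\ tree_at d (foldl (@mutate n) B ks) k.
Proof.
move=> pB; have [|ks p] := IH (B := delv B k) (U := U :\ k) _ (cls_delv k pB).
  by move: HU; rewrite (cardsD1 k) kU.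
exists (filter (predC1 k) ks); split; first by rewrite mem_filter /= eqxx.
by rewrite /tree_at -delv_foldl.
Qed.

(** An edge between two neighbours of [k] in the same direction would make an unoriented triangle,
    so they form a star. The spare vertex [w] is deleted to obtain a positive companion by
    induction. *)
Lemma star_bound B w (O : {set 'I_n}) : P B -> w \in U -> w != k -> w \notin O -> k \notin O ->
  {in O &, forall u v, 0 < B k u * B k v} -> \sum_(u in O) `|B k u * B u k| <= 3.
Proof.
move=> pB wU wk wO kO HO; have [A [c p _]] := delv_pd d_gt0 IH HU pB wU.
have s := P_skew pB.
have nw u : u \in O -> u != w by move=> uO; apply: contraNneq wO => <-.
have nk u : u \in O -> u != k by move=> uO; apply: contraNneq kO => <-.
have kw : k != w by rewrite eq_sym.
have lt : \sum_(u in O) `|delv B w k u * delv B w u k| < 4.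
  apply: (pd_star d_gt0 c p kO) => u v uO vO uv; rewrite delvE ?nw //; apply/eqP.
  have [//|b] := eqVneq (B u v) 0.
  have h := HO u v uO vO; have b1 : B k u != 0 by apply: contraTneq h => ->; rewrite mul0r.
  have b2 : B k v != 0 by apply: contraTneq h => ->; rewrite mulr0.
  have E : ear B k [:: u; v] by apply: (triangle_ear s) => //; apply: nk.
  by have := P_or pB E; rewrite /= ltNge ltW.
suff -> : \sum_(u in O) `|B k u * B u k| = \sum_(u in O) `|delv B w k u * delv B w u k|.
  by move: lt; move: (\sum_(u in O) _); clear; lia.
by apply: eq_bigr => u uO; rewrite (delvE B kw (nw u uO)) (delvE B (nw u uO) kw).
Qed.

(** Amounts to negating [e_u]. It serves to turn one spoke round when all of them point the same way
    and [star_bound] finds no spare vertex. *)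
Lemma flip_leaf B u z : P B -> u != k -> (forall j, j != k -> B u j = 0) -> tree_at d B k -> orth B k z ->
  let B' := mutate B u in let z' := fun j => if j == u then - z u else z j in
  [/\ tree_at d B' k, orth B' k z', zlin (rooted B' k) z' k = zlin (rooted B k) z k,
      (forall j, B' k j = (if j == u then - B k u else B k j)) &
      forall j, B' j k = (if j == u then - B u k else B j k)].
Proof.
move=> pB uk leaf t o B' z'; have s := P_skew pB; have ku : k != u by rewrite eq_sym.
have leaf' j : j != k -> B j u = 0 by move=> jk; apply/eqP; rewrite (skew_eq0 d_gt0 _ _ s) leaf.
have same a b : a != u -> b != u -> B' a b = B a b.
  move=> au bu; apply: mutate_npos => //; have [ak|ak] := eqVneq a k; last by rewrite leaf' // mul0r.
  have [bk|bk] := eqVneq b k; last by rewrite leaf // mulr0.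
  by rewrite ak bk -sgr_le0 sgrM (skew_sg d_gt0 s u k) mulNr -expr2 oppr_le0 sqr_ge0.
have Bk j : B' k j = (if j == u then - B k u else B k j).
  by case: eqVneq => [->|ju]; [rewrite /B' mutate_col|rewrite same].
have Bk' j : B' j k = (if j == u then - B u k else B j k).
  by case: eqVneq => [->|ju]; [rewrite /B' mutate_row|rewrite same].
have Nrm a b : `|B' a b| = `|B a b|.
  have [->|au] := eqVneq a u; first by rewrite /B' mutate_row normrN.
  have [->|bu] := eqVneq b u; first by rewrite /B' mutate_col normrN.
  by rewrite same.
pose e j : int := if j == u then -1 else 1.
have RE i j : rooted B' k i j * z' j = e i * (rooted B k i j * z j).
  rewrite ![rooted _ _ _ _]mxE Nrm Bk Bk' /z' /e; have [ij|ij] := eqVneq i j.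
    by rewrite ij; case: eqP => [->|_]; ring.
  have [ik|ik] := eqVneq i k.
    rewrite ik (negbTE ku); case: eqP => [->|_]; ring.
  have [jk|jk] := eqVneq j k; first by rewrite jk (negbTE ku); case: eqP => [->|_]; ring.
  have [iu|iu] := eqVneq i u.
    rewrite iu leaf // normr0 oppr0 !mul0r mulr0 //.
  have [ju|ju] := eqVneq j u; last by ring.
  by rewrite ju leaf' // normr0 oppr0 !mul0r mulr0.
have LE i : zlin (rooted B' k) z' i = e i * zlin (rooted B k) z i.
  by rewrite /zlin mulr_sumr; apply: eq_bigr => j _; rewrite RE.
split => //.
- suff E : cartan_counterpart (delv B' k) = cartan_counterpart (delv B k) by rewrite /tree_at E.
  apply/matrixP => i j; rewrite ![cartan_counterpart _ _ _]mxE ![delv _ _ _ _]mxE.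
  by case: eqP => // _; case: ifP => // _; rewrite Nrm.
- by move=> i ik; rewrite LE o // mulr0.
- by rewrite LE /e (negbTE ku) mul1r.
Qed.

Definition spoke_sum B (s : int) := \sum_(u | 0 < s * B k u) `|B k u * B u k|.

Lemma spoke_supp B u : P B -> B k u != 0 -> (u \in U) && (u != k).
Proof.
move=> pB b; have [s h _] := pB; apply/andP; split.
  by apply: contraNT b => uU; rewrite (supp_col d_gt0 _ s h uU).
by apply: contraNneq b => ->; rewrite (skew_diag d_gt0 _ s).
Qed.

Lemma spoke_sum_le3 B (s : int) w : P B -> w \in U -> w != k -> ~~ (0 < s * B k w) ->
  spoke_sum B s <= 3.
Proof.
move=> pB wU wk hw; have -> : spoke_sum B s = \sum_(u in [set u | 0 < s * B k u]) `|B k u * B u k|.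
  by apply: eq_bigl => u; rewrite inE.
apply: (@star_bound _ w) => //; rewrite ?inE //.
  by rewrite (skew_diag d_gt0 _ (P_skew pB)) mulr0.
move=> u v; rewrite !inE => hu hv; have := mulr_gt0 hu hv.
by rewrite mulrACA pmulr_rgt0 // -expr2 exprn_even_gt0 //=; apply: contraTneq hu => ->; rewrite mul0r.
Qed.

Definition short_spokes B z := forall u, u != k -> B k u != 0 -> `|z u| <= `|z u + B u k * z k|.

Lemma short_state B z : P B -> tree_at d B k -> orth B k z -> 0 < z k -> exists B1 z1,
  [/\ P B1, tree_at d B1 k, orth B1 k z1, z1 k = z k &
  [/\ zlin (rooted B1 k) z1 k = zlin (rooted B k) z k, short_spokes B1 z1,
      spoke_sum B1 1 <= 3 & spoke_sum B1 (-1) <= 3]].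
Proof.
move=> pB t o zk.
have [ks [z1 [h1 h2 h3 [h4 h5 h6]]]] := spoke_min d_gt0 P_skew P_mut P_or pB t o zk.
pose B1 := foldl (@mutate n) B ks.
have pB1 : P B1 := P_foldl P_mut ks pB.
have t1 : tree_at d B1 k by rewrite /tree_at h2.
have sh : short_spokes B1 z1 by move=> u uk b; rewrite h4; apply: h6.
(* With at most one vertex besides [k], each direction carries at most one weight, which the
   assumption on entries bounds. *)
have [le1|] := leqP #|U :\ k| 1.
  exists B1, z1; split => //.
  have small s0 : spoke_sum B1 s0 <= 3.
    rewrite /spoke_sum; have sub : {subset [pred u | 0 < s0 * B1 k u] <= U :\ k}.
      move=> u; rewrite inE => hu; rewrite !inE andbC; apply: (spoke_supp pB1).
      by apply: contraTneq hu => ->; rewrite mulr0 ltxx.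
    case: (pickP [pred u | 0 < s0 * B1 k u]) => [u hu|h0]; last by rewrite big_pred0.
    rewrite (big_pred1 u); last first.
      move=> v; apply/idP/eqP => [hv|-> //].
      by apply: (card_le1_eqP le1); apply: sub.
    have uk : u != k by have := sub u hu; rewrite !inE => /andP[].
    have ku : k != u by rewrite eq_sym.
    by have := P_wt pB1 ku; move: (B1 k u * B1 u k); clear; lia.
  by split.
move=> /card_gt1P[u [v [uU vU uv]]]; move: uU vU; rewrite !inE => /andP[uk uU] /andP[vk vU].
pose free s0 := [exists w, [&& w \in U, w != k & ~~ (0 < s0 * B1 k w)]].
have freeP s0 : free s0 -> spoke_sum B1 s0 <= 3.
  by move=> /existsP[w /and3P[w1 w2 w3]]; apply: spoke_sum_le3 w1 w2 w3.
(* Each direction needs a vertex of [U] outside it; if one direction has none, all of [U :\ k] lies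
   on that side. *)
have [/andP[n1 n2]|[s0 [s02 Hall]]] : (free 1 && free (-1)) \/
    exists s0 : int, s0 * s0 = 1 /\ forall w, w \in U -> w != k -> 0 < s0 * B1 k w.
- have nfree s0 : ~~ free s0 -> forall w, w \in U -> w != k -> 0 < s0 * B1 k w.
    by rewrite negb_exists => /forallP h w wU wk; have := h w; rewrite wU wk negbK.
  case: (boolP (free 1)) => [n1|/nfree h]; last by right; exists 1.
  by case: (boolP (free (-1))) => [n2|/nfree h]; [left|right; exists (-1)].
- by exists B1, z1; split => //; split => //; apply: freeP.
have s1 := P_skew pB1; have bku := Hall u uU uk.
(* Neighbours on the same side are not adjacent, so [u] is a leaf. After flipping it, [u] and [v]
   are spare vertices for the two directions. *)
have leaf j : j != k -> B1 u j = 0.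
  move=> jk; apply/eqP; have [//|b] := eqVneq (B1 u j) 0.
  have jU : j \in U.
    by have [_ h _] := pB1; apply: contraNT b => jU; rewrite (supp_col d_gt0 _ s1 h jU).
  have bkj := Hall j jU jk.
  have uj : u != j by apply: contraNneq b => <-; rewrite (skew_diag d_gt0 _ s1).
  have nz w : 0 < s0 * B1 k w -> B1 k w != 0 by move=> hw; apply: contraTneq hw => ->; rewrite mulr0 ltxx.
  have E : ear B1 k [:: u; j] by apply: (triangle_ear s1) => //; apply: nz.
  have := P_or pB1 E; rewrite /= ltNge ltW // -[B1 k u * _]mul1r -s02 mulrACA.
  exact: mulr_gt0.
have [f1 f2 f3 f4 f5] := flip_leaf pB1 uk leaf t1 h3.
pose B2 := mutate B1 u; pose z2 := fun j => if j == u then - z1 u else z1 j.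
have z2k : z2 k = z1 k by rewrite /z2 eq_sym (negbTE uk).
have pB2 : P B2 by apply: P_mut.
have bkv := Hall v vU vk; have vu : v != u by rewrite eq_sym.
have hs s' : s' = 1 \/ s' = -1 -> spoke_sum B2 s' <= 3.
  have [e0|e0] : s0 = 1 \/ s0 = -1 by move/eqP: s02; rewrite -expr2 sqrf_eq1 => /orP[]/eqP; [left|right].
    case=> ->.
      apply: (spoke_sum_le3 pB2 uU uk); rewrite f4 eqxx mulrN oppr_gt0 -leNgt -e0 ltW //.
    apply: (spoke_sum_le3 pB2 vU vk); rewrite f4 (negbTE vu) mulN1r oppr_gt0 -leNgt ltW //.
    by rewrite -[B1 k v]mul1r -e0.
  case=> ->.
    apply: (spoke_sum_le3 pB2 vU vk); rewrite f4 (negbTE vu) mul1r -leNgt ltW //.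
    by move: bkv; rewrite e0 mulN1r oppr_gt0.
  apply: (spoke_sum_le3 pB2 uU uk); rewrite f4 eqxx mulrN oppr_gt0 -leNgt -e0 ltW //.
exists B2, z2; split => //; first by rewrite z2k.
split; [by rewrite f3| |by apply: hs; left|by apply: hs; right].
move=> j jk; rewrite f4 f5 z2k /z2; case: (eqVneq j u) => [_|ju]; last exact: sh.
rewrite oppr_eq0 => b; rewrite normrN mulNr -opprD normrN; exact: sh.
Qed.

Lemma zform_orth B z : orth B k z -> zform d (rooted B k) z = d k * z k * zlin (rooted B k) z k.
Proof.
by move=> o; rewrite /zform (bigD1 k) //= big1 ?addr0 // => i ik; rewrite o // mulr0.
Qed.

(** On a spoke with [B k u * z u] positive, shortness means that twice the absolute value of [z u]
    is at most that of [B u k * z k]. With weights adding up to at most 3, the sums [Q] over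
    outgoing and [I] over incoming spokes are at most [3/2 * z k]; the value at [k] is
    [2 * z k - Q - I]. *)
Lemma spoke_bounds B z : P B -> 0 < z k -> short_spokes B z ->
  spoke_sum B 1 <= 3 -> spoke_sum B (-1) <= 3 ->
  let I := \sum_(u | 0 < B u k) B k u * z u in
  [/\ 2 * I <= 3 * z k, zlin (rooted B k) z k <= 0 -> z k <= 2 * I & - z k <= zlin (rooted B k) z k].
Proof.
move=> pB zk sh S1 S2 I; have s := P_skew pB; have B0 := skew_diag d_gt0 k s.
pose Q := \sum_(u | 0 < B k u) B k u * z u.
have half (p : pred 'I_n) : (forall u, p u -> u != k /\ B k u != 0) ->
    \sum_(u | p u) `|B k u * B u k| <= 3 -> 2 * (\sum_(u | p u) B k u * z u) <= 3 * z k.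
  move=> hp hs; rewrite mulr_sumr; apply: le_trans (_ : (\sum_(u | p u) `|B k u * B u k|) * z k <= _).
    rewrite mulr_suml; apply: ler_sum => u pu; have [uk b] := hp u pu; have hu := sh u uk b.
    have [g0 e0] := skew_sgn d_gt0 k u s.
    case: (ltgtP (B k u) 0) b g0 e0 => // hb _ g0 e0.
      have b2 : 0 < B u k by rewrite (skew_gt0 d_gt0 _ _ s).
      have h2 : - (2 * z u) <= B u k * z k.
        by have := mulr_gt0 b2 zk; move: hu; move: (B u k * z k); clear; lia.
      rewrite normrM (ltr0_norm hb) (gtr0_norm b2) -mulrA.
      have -> : 2 * (B k u * z u) = - B k u * (- (2 * z u)) by ring.
      by rewrite ler_pM2l // oppr_gt0.
    have b2 : B u k < 0 by rewrite -g0.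
    have h2 : 2 * z u <= - B u k * z k.
      have := nmulr_rlt0 (z k) b2; rewrite zk mulNr; move: hu; move: (B u k * z k); clear; lia.
    rewrite normrM (gtr0_norm hb) (ltr0_norm b2) -mulrA mulrCA.
    by rewrite ler_pM2l.
  by rewrite ler_pM2r.
have E1 : spoke_sum B 1 = \sum_(u | 0 < B k u) `|B k u * B u k|.
  by apply: eq_bigl => u; rewrite mul1r.
have E2 : spoke_sum B (-1) = \sum_(u | 0 < B u k) `|B k u * B u k|.
  by apply: eq_bigl => u; rewrite mulN1r oppr_gt0 (skew_lt0 d_gt0 _ _ s).
have nk u : B k u != 0 -> u != k by apply: contraNneq => ->; rewrite B0.
have hQ : 2 * Q <= 3 * z k.
  by apply: half; rewrite -?E1 // => u hu; split; rewrite ?nk // gt_eqF.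
have hI : 2 * I <= 3 * z k.
  apply: half; rewrite -?E2 // => u; rewrite -(skew_lt0 d_gt0 _ _ s) => hu.
  by split; rewrite ?nk // lt_eqF.
have ez : zlin (rooted B k) z k = 2 * z k - Q - I.
  rewrite /zlin (bigD1 k) //= mxE eqxx -addrA; congr (_ + _).
  have -> : - Q - I = - \sum_u B k u * z u.
    rewrite -opprD; congr (- _); rewrite (bigID (fun u => 0 < B k u)) /=; congr (_ + _).
    rewrite (bigID (fun u => 0 < B u k)) /= [X in _ = _ + X]big1 ?addr0.
      apply: eq_bigl => u; rewrite -(skew_lt0 d_gt0 _ _ s) -leNgt.
      by case: ltgtP.
    move=> u /andP[h1 h2]; suff -> : B k u = 0 by rewrite mul0r.
    apply/eqP; rewrite eq_le leNgt h1 /= leNgt (skew_lt0 d_gt0 _ _ s) //.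
  rewrite [in RHS](bigD1 k) //= B0 mul0r add0r -sumrN; apply: eq_bigr => j jk.
  by rewrite mxE eq_sym (negbTE jk) eqxx mulNr.
by split => //; rewrite ez; clear ez; clearbody Q I; clear -hQ hI; lia.
Qed.

Lemma descent_round B z : P B -> tree_at d B k -> orth B k z -> 0 < z k -> zlin (rooted B k) z k <= 0 ->
  - z k <= zlin (rooted B k) z k /\ exists B2 x, [/\ P B2, tree_at d B2 k, 2 * `|x k| <= z k &
    [/\ zform d (rooted B2 k) x = zform d (rooted B k) z,
       zlin (rooted B k) z k = 0 -> forall i, zlin (rooted B2 k) x i = 0 & exists i, x i != 0]].
Proof.
move=> pB t o zk ek; have [B1 [z1 [pB1 t1 o1 zk1 [e1 sh S1 S2]]]] := short_state pB t o zk.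
have s1 := P_skew pB1; have c1 := rooted_companion d_gt0 k s1.
have a1 := rooted_odd s1 (P_or pB1) t1.
have z1k0 : 0 < z1 k by rewrite zk1.
have [b1 b2 b3] := spoke_bounds pB1 z1k0 sh S1 S2.
rewrite e1 zk1 in b1 b2 b3; have {}b2 := b2 ek; split => //.
set I := \sum_(u | _) _ in b1 b2.
have [c2 a2] := odd_mutate d_gt0 s1 c1 (P_or pB1) a1 (P_wt pB1) (P_or (P_mut k pB1)).
have [m1 m2 m3] := zmut_spec k z1 s1 c1; set x1 := zmut _ _ _ _ in m1 m2 m3.
(* Mutation at [k] reflects the sources of the incoming spokes, whose rooted entries are [- B k i];
   with [z k <= 2 * I <= 3 * z k] the coordinate is at least halved. *)
have x1k : x1 k = z k - I.
  rewrite /x1 /zmut eqxx zk1; congr (_ + _); rewrite /zin -sumrN; apply: eq_bigr => i hi.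
  rewrite mxE eqxx; have [ki|_] := eqVneq k i; last by rewrite mulNr.
  by move: hi; rewrite ki (skew_diag d_gt0 _ s1).
have [ks [kks t2]] := retree (P_mut k pB1).
have [A2 [x2 [h1 h2 h3 [h4 h5 h6]]]] := carry x1 (P_mut k pB1) c2 a2 kks.
set B2 := foldl _ _ ks in t2 h1 h2.
have pB2 : P B2 by apply: P_foldl => //; apply: P_mut.
have s2 := P_skew pB2.
(* The carried companion is odd but no longer of rooted shape; signs of basis vectors bring it back
   for the next round. *)
have [e [ee eE]] := odd_signs_unique d_gt0 s2 h1 (rooted_companion d_gt0 k s2) h2 (rooted_odd s2 (P_or pB2) t2).
pose x3 i := e i * x2 i.
have l3 i : zlin (rooted B2 k) x3 i = e i * zlin A2 x2 i.
  rewrite /zlin mulr_sumr; apply: eq_bigr => j _; rewrite eE /x3.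
  have -> : e i * e j * A2 i j * (e j * x2 j) = e i * (A2 i j * x2 j) * (e j * e j) by ring.
  by rewrite ee mulr1.
exists B2, x3; split => //.
  have e1k : `|e k| = 1.
    have := ee k; rewrite -expr2 => /eqP; rewrite sqrf_eq1 => /orP[]/eqP ->; by [].
  rewrite /x3 normrM e1k mul1r h3 x1k; clear x1k; clearbody I; clear -b1 b2; lia.
split.
- transitivity (zform d A2 x2).
    apply: eq_bigr => i _; rewrite l3 /x3.
    have -> : d i * (e i * x2 i) * (e i * zlin A2 x2 i) = d i * x2 i * zlin A2 x2 i * (e i * e i) by ring.
    by rewrite ee mulr1.
  by rewrite h4 m1 (zform_orth o1) (zform_orth o) zk1 e1.
- move=> e0 i; rewrite l3 h5 ?mulr0 //; apply: m2 => j; have [->|jk] := eqVneq j k; last exact: o1.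
  by rewrite e1.
- have [|i xi] := h6; first by apply: m3; exists k; rewrite gt_eqF.
  exists i; rewrite /x3 mulf_neq0 //; apply/eqP => h; have := ee i; by rewrite h mul0r.
Qed.

Lemma tree_zform_gt0 B x : tree_at d B k -> x k = 0 -> (exists i, x i != 0) -> 0 < zform d (rooted B k) x.
Proof.
move=> t xk [i xi]; rewrite -(ltr0z rat) zform_rat.
have [|-> _] := @qform_root0 _ d rat B k (fun i => (x i)%:~R); first by rewrite xk.
by apply: (t (fun i => (x i)%:~R)); exists i; rewrite intr_eq0.
Qed.

(* No vector has a smaller value per squared k-coordinate than the one orthogonal to the forest. *)
Lemma orth_min B (w : 'I_n -> int) x : P B -> tree_at d B k -> orth B k w ->
  x k * x k * zform d (rooted B k) w <= w k * w k * zform d (rooted B k) x.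
Proof.
move=> pB t o; have [c1 c2 c3] := rooted_companion d_gt0 k (P_skew pB).
pose y i := w k * x i - x k * w i.
have yk : y k = 0 by rewrite /y mulrC subrr.
have y0 : 0 <= zform d (rooted B k) y.
  case: (boolP [exists i, y i != 0]) => [/existsP[i yi]|].
    by apply/ltW/tree_zform_gt0 => //; exists i.
  rewrite negb_exists => /forallP H; rewrite /zform big1 // => i _.
  by have := H i; rewrite negbK => /eqP ->; rewrite mulr0 mul0r.
pose wr : 'I_n -> rat := fun i => (x k * w i)%:~R; pose yr : 'I_n -> rat := fun i => (y i)%:~R.
have lw i : lin (rooted B k) wr i = (x k)%:~R * (zlin (rooted B k) w i)%:~R.
  by rewrite -lin_int -lin_scale; apply: eq_bigr => j _; rewrite /wr rmorphM.
have sc (c : int) (v : 'I_n -> int) : zform d (rooted B k) (fun i => c * v i) = c * c * zform d (rooted B k) v.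
  rewrite /zform mulr_sumr; apply: eq_bigr => i _.
  have -> : zlin (rooted B k) (fun i => c * v i) i = c * zlin (rooted B k) v i.
    by rewrite /zlin mulr_sumr; apply: eq_bigr => j _; rewrite mulrCA.
  ring.
rewrite -!sc -(ler_int rat) !zform_rat.
have -> : qform d (rooted B k) (fun i => (w k * x i)%:~R) = qform d (rooted B k) (fun i => wr i + yr i) :> rat.
  have E i : (w k * x i)%:~R = wr i + yr i by rewrite /wr /yr /y -rmorphD /= addrC subrK.
  by apply: eq_bigr => i _; rewrite E; congr (_ * _); apply: eq_bigr => j _; rewrite E.
rewrite qformD // bilC // [bil _ _ _ _]big1 ?mulr0 ?addr0.
  by rewrite lerDl -zform_rat ler0z.
move=> i _; rewrite lw; have [->|ik] := eqVneq i k; first by rewrite /yr yk mulr0 mul0r.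
by rewrite o // mulr0 mulr0.
Qed.

(** The form at [z] is [d k * z k] times the value at [k]. A round keeps it and at least halves the
    coordinate, and by [orth_min] the new orthogonal vector [w] does no worse. So minus the value
    divided by the coordinate grows at least fourfold, while [descent_round] bounds it by 1. *)
Lemma orth_value_bound (N : nat) B z : P B -> tree_at d B k -> orth B k z -> 0 < z k ->
  zlin (rooted B k) z k <= 0 -> 4 ^+ N * - zlin (rooted B k) z k <= z k.
Proof.
elim: N B z => [|N IHN] B z pB t o zk ek.
  by have [h _] := descent_round pB t o zk ek; rewrite mul1r lerNl.
have [_ [B2 [x [pB2 t2 xk [xq _ xn]]]]] := descent_round pB t o zk ek.
have [w [ow wk]] := orth_exists t2.
(* A positive value would make the form positive definite, yet [x] is a nonzero vector with
   non-positive form. *)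
have ew : zlin (rooted B2 k) w k <= 0.
  rewrite leNgt; apply/negP => ew; have p := rooted_pd d_gt0 (P_skew pB2) t2 ow wk ew.
  have [i xi] := xn; have := pd_int p xi; rewrite xq (zform_orth o).
  have le0 : d k * z k * zlin (rooted B k) z k <= 0.
    by apply: mulr_ge0_le0 => //; apply: mulr_ge0; apply: ltW.
  by rewrite ltNge le0.
have hN := IHN B2 w pB2 t2 ow wk ew; have hm := orth_min x pB2 t2 ow.
rewrite xq !zform_orth // in hm; set e := zlin (rooted B k) z k in ek hm *.
set e2 := zlin (rooted B2 k) w k in ew hN hm.
have dk := d_gt0 k.
have h1 : w k * (z k * - e) <= x k * x k * - e2.
  have : 0 <= d k * w k * (x k * x k * - e2 - w k * (z k * - e)).
    by move: hm; rewrite -subr_ge0; congr (0 <= _); ring.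
  by rewrite pmulr_rge0 ?mulr_gt0 // subr_ge0.
have x0 : 0 <= x k * x k by rewrite -expr2 sqr_ge0.
have p4 : 0 < 4 ^+ N :> int by apply: exprn_gt0.
have h2 : w k * (4 ^+ N * (z k * - e)) <= w k * (x k * x k).
  have -> : w k * (4 ^+ N * (z k * - e)) = 4 ^+ N * (w k * (z k * - e)) by ring.
  apply: le_trans (_ : 4 ^+ N * (x k * x k * - e2) <= _); first by rewrite ler_pM2l.
  have -> : 4 ^+ N * (x k * x k * - e2) = x k * x k * (4 ^+ N * - e2) by ring.
  by rewrite [w k * _]mulrC ler_wpM2l.
rewrite ler_pM2l // in h2.
have h3 : 4 * (x k * x k) <= z k * z k.
  have -> : 4 * (x k * x k) = (2 * `|x k|) * (2 * `|x k|).
    have -> : x k * x k = `|x k| * `|x k| by rewrite -normrM ger0_norm.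
    ring.
  by apply: ler_pM; rewrite // mulr_ge0.
rewrite -(ler_pM2l zk); apply: le_trans h3.
have -> : z k * (4 ^+ N.+1 * - e) = 4 * (4 ^+ N * (z k * - e)) by rewrite exprS; ring.
by rewrite ler_pM2l.
Qed.

Lemma orth_value_ge0 B z : P B -> tree_at d B k -> orth B k z -> 0 < z k ->
  0 <= zlin (rooted B k) z k.
Proof.
move=> pB t o zk; rewrite leNgt; apply/negP => ek.
have h := orth_value_bound (absz (z k)) pB t o zk (ltW ek).
have p4 N : N%:Z < 4 ^+ N.
  by elim: N => // N IHN; rewrite exprS; move: IHN; move: (4 ^+ N); clear; lia.
have := p4 (absz (z k)); rewrite gez0_abs ?(ltW zk) // ltNge => /negP[].
apply: le_trans h; have e1 : 1 <= - zlin (rooted B k) z k by move: ek; clear; lia.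
by rewrite ler_peMr // exprn_ge0.
Qed.

Lemma no_radical B x : P B -> tree_at d B k -> (forall i, zlin (rooted B k) x i = 0) ->
  (exists i, x i != 0) -> False.
Proof.
have [N] := ubnP (absz (x k)); elim: N B x => // N IHN B x; rewrite ltnS => hN pB t x0 xn.
have z0 : zform d (rooted B k) x = 0 by rewrite /zform big1 // => i _; rewrite x0 mulr0.
have xk : x k != 0.
  by apply/eqP => xk; have := tree_zform_gt0 t xk xn; rewrite z0 ltxx.
pose y i := if 0 < x k then x i else - x i.
have y0 i : zlin (rooted B k) y i = 0.
  rewrite /y; case: (0 < x k); first exact: x0.
  transitivity (- zlin (rooted B k) x i); last by rewrite x0 oppr0.
  by rewrite /zlin -sumrN; apply: eq_bigr => j _; rewrite mulrN.
have yk : 0 < y k by rewrite /y; case: ifP => //; move: xk; clear; lia.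
have ayk : absz (y k) = absz (x k) by rewrite /y; case: ifP => // _; rewrite abszN.
have oy : orth B k y by move=> i _; apply: y0.
have [|_ [B2 [x2 [pB2 t2 h1 [_ h2 h3]]]]] := descent_round pB t oy yk; first by rewrite y0.
apply: (IHN B2 x2) => //; last exact: h2.
by apply: leq_trans hN; rewrite -ayk; move: h1 yk; clear; lia.
Qed.

Lemma tree_cartan B : P B -> exists ks, pd d rat (cartan_counterpart (foldl (@mutate n) B ks)).
Proof.
move=> pB; have [ks [_ t]] := retree pB; set B1 := foldl _ _ ks in t.
have pB1 : P B1 by apply: P_foldl.
have [z [o zk]] := orth_exists t.
have ek : 0 < zlin (rooted B1 k) z k.
  rewrite lt_neqAle eq_sym orth_value_ge0 // andbT; apply/eqP => e0.
  apply: (@no_radical B1 z) => //; last by exists k; rewrite gt_eqF.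
  by move=> i; have [->|ik] := eqVneq i k; last exact: o.
have [ks' [z2 [g1 g2 g3 g4 g5]]] := sink_at d_gt0 P_skew P_mut P_or pB1 t o zk.
exists (ks ++ ks'); rewrite foldl_cat; apply: (sink_cartan d_gt0 _ g1 g2) => //.
- by apply: P_skew; apply: P_foldl.
- by rewrite g3.
- by rewrite g4.
Qed.

End Inductive.

Theorem bounded_finite (U : {set 'I_n}) B : cls d U B ->
  exists ks, pd d rat (cartan_counterpart (foldl (@mutate n) B ks)).
Proof.
have [m] := ubnP #|U|; elim: m U B => // m IH U B; rewrite ltnS => hU cB.
have [U0|[k kU]] := set_0Vmem U; last first.
  case: m IH hU => [|m] IH hU; first by move: hU; rewrite leqn0 cards_eq0 => /eqP U0; move: kU; rewrite U0 inE.
  apply: (@tree_cartan m _ U hU k kU B cB) => V C hV; exact: IH.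
exists [::] => x [i xi]; have [s h _] := cB.
have E j : lin (cartan_counterpart B) x j = 2 * x j.
  rewrite /lin (bigD1 j) //= mxE eqxx big1 ?addr0 // => a aj.
  by rewrite mxE eq_sym (negbTE aj) h ?U0 ?inE // normr0 oppr0 mul0r.
rewrite /= /qform; under eq_bigr do rewrite E.
rewrite (bigD1 i) //=; apply: ltr_wpDr.
  apply: sumr_ge0 => j _; rewrite mulrCA -!mulrA mulr_ge0 // mulr_ge0 ?ler0z ?(ltW (d_gt0 j)) //.
  by rewrite -expr2 sqr_ge0.
rewrite mulrCA -!mulrA mulr_gt0 // mulr_gt0 ?ltr0z //.
by rewrite -expr2 exprn_even_gt0.
Qed.

End Descent.

(** * Cycle labelings *)

Section Labelings.
Variables (n : nat) (d : 'I_n -> int) (B : 'M[int]_n).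
Hypothesis d_gt0 : forall i, 0 < d i.
Hypothesis s : skew_by d B.
Implicit Types (k x y : 'I_n) (l Z : seq 'I_n) (i j : nat).

Let sB := skew_sym d_gt0 s.
Let B0 x : B x x = 0. Proof. exact: skew_diag. Qed.

Lemma induced_path_nth k l : uniq l ->
  induced_path B l <->
  (forall i j, (i < j < size l)%N -> (B (nth k l i) (nth k l j) != 0) = (j == i.+1)).
Proof.
elim: l => [|x l IH]; first by split => // _ i j; rewrite ltn0 andbF.
rewrite cons_uniq => /andP[xl ul]; have {}IH := IH ul; split.
  move=> /= /and3P[/IH H _ /allP Hx] [|i] [|j] //=; rewrite !ltnS => ij; last exact: H.
  rewrite (eqP (Hx _ (mem_nth k ij))); case: l ij {IH H Hx} xl ul => // y l ij xl ul.
  by rewrite /= -[y]/(nth k (y :: l) 0) nth_uniq.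
move=> H /=; rewrite xl /=; apply/andP; split.
  by apply/IH => i j ij; apply: (H i.+1 j.+1).
apply/allP => y yl; have := H 0%N (index y l).+1; rewrite /= ltnS index_mem yl nth_index // => -> //.
case: l yl {IH H} xl ul => // a l yl xl ul; rewrite eqSS.
apply/eqP; apply/idP/idP => [/eqP h|/eqP -> /=]; last by rewrite eqxx.
by have := nth_index k yl; rewrite h /= => ->.
Qed.

(** Meant for positions [i < j] only: consecutive ones, or the closing pair of first and last. *)
Definition cyc_adj (p i j : nat) := (j == i.+1) || (i == 0%N) && (j == p.-1).

Lemma ear_nth k l : uniq (k :: l) -> (2 < size (k :: l))%N ->
  ear B k l <-> (forall i j, (i < j < size (k :: l))%N ->
    (B (nth k (k :: l) i) (nth k (k :: l) j) != 0) = cyc_adj (size (k :: l)) i j).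
Proof.
rewrite cons_uniq => /andP[kl ul] sl; have sl' : (1 < size l)%N by [].
have l0 : (0 < size l)%N by apply: ltn_trans sl'.
have hd : head k l = nth k l 0 by case: (l).
have la : last k l = nth k l (size l).-1 by rewrite nth_last.
split.
  move=> E; have /and4P[Hi _ _ _] := E; have := (induced_path_nth k ul).1 Hi => H [|i] [|j] //=.
    rewrite ltnS => jl; rewrite (ear_adj E (mem_nth k jl)) /cyc_adj /= hd la eqSS.
    rewrite !nth_uniq ?prednK //; congr (_ || _).
    by rewrite -[in LHS]eqSS prednK.
  by rewrite !ltnS => ij; rewrite H // /cyc_adj orbF eqSS.
move=> H; apply/and4P; split => //.
  apply/(induced_path_nth k ul) => i j ij; have := H i.+1 j.+1; rewrite /= !ltnS => -> //.
  by rewrite /cyc_adj orbF eqSS.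
apply/allP => y yl; have := H 0%N (index y l).+1; rewrite /= ltnS index_mem yl nth_index // => -> //.
have e1 : (y == head k l) = (index y l == 0%N).
  by rewrite hd -{1}(nth_index k yl) nth_uniq ?index_mem.
have e2 : (y == last k l) = ((index y l).+1 == size l).
  rewrite la -{1}(nth_index k yl) nth_uniq ?index_mem ?prednK //.
  by rewrite -[in LHS]eqSS prednK.
by rewrite e1 e2 /cyc_adj eqSS eqxx.
Qed.

Lemma ordS_val p (a : 'I_p) : val (ordS a) = if a.+1 == p then 0%N else a.+1.
Proof.
rewrite /=; case: eqP => [->|ne]; first by rewrite modnn.
by rewrite modn_small //; have := ltn_ord a; lia.
Qed.

Lemma cyc_adj_ordS p (a b : 'I_p) : (2 < p)%N ->
  (b == ordS a) || (a == ordS b) =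
  ((a < b)%N && cyc_adj p a b) || ((b < a)%N && cyc_adj p b a).
Proof.
move=> p3; rewrite -!val_eqE !ordS_val /cyc_adj.
have la := ltn_ord a; have lb := ltn_ord b; rewrite /=.
by case: (eqVneq a.+1 p); case: (eqVneq b.+1 p); lia.
Qed.

Lemma Gamma_adj x y : Gamma B x y || Gamma B y x = (B x y != 0).
Proof. by rewrite /Gamma (skew_gt0 d_gt0 y x s); case: ltgtP. Qed.

Lemma labeling_of_ear k l : ear B k l ->
  cycle_labeling (Gamma B) [set y in k :: l] (fun a : 'I_(size (k :: l)) => nth k (k :: l) a).
Proof.
move=> E; have /and4P[Hi sl kl _] := E.
have uZ : uniq (k :: l) by rewrite /= kl (induced_path_uniq Hi).
have sZ : (2 < size (k :: l))%N by [].
have H := (ear_nth uZ sZ).1 E; set Z := k :: l in uZ sZ H *.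
split => //.
- by move=> a b /eqP; rewrite nth_uniq // => /eqP/val_inj.
- apply/setP => y; rewrite inE; apply/idP/imsetP => [yZ|[a _ ->]]; last exact: mem_nth.
  have iy : (index y Z < size Z)%N by rewrite index_mem.
  by exists (Ordinal iy) => //=; rewrite nth_index.
move=> a b; rewrite Gamma_adj cyc_adj_ordS //.
have la := ltn_ord a; have lb := ltn_ord b.
case: (ltngtP a b) => [ab|ba|/val_inj ->] /=.
- by rewrite orbF H // ab lb.
- by rewrite sB H // ba la.
- by rewrite B0 eqxx.
Qed.

Lemma ear_of_labeling p (c : 'I_p.+1 -> 'I_n) C : cycle_labeling (Gamma B) C c ->
  exists2 l, ear B (c ord0) l & forall y, (y \in c ord0 :: l) = (y \in C).
Proof.
case=> p3 cI CE adj; pose Z := [seq c a | a <- enum 'I_p.+1].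
have [l EZ] : exists l, Z = c ord0 :: l.
  by rewrite /Z enum_ordSl /=; eexists.
have sZ : size Z = p.+1 by rewrite size_map size_enum_ord.
have uZ : uniq Z by rewrite map_inj_uniq ?enum_uniq.
have nZ (a : 'I_p.+1) : nth (c ord0) Z a = c a.
  by rewrite (nth_map ord0) ?size_enum_ord // nth_ord_enum.
exists l; last first.
  move=> y; rewrite -EZ CE; apply/mapP/imsetP => [[a _ ->]|[a _ ->]]; exists a => //.
  by rewrite mem_enum.
rewrite EZ in uZ sZ nZ; apply/ear_nth; rewrite ?sZ // => i j /andP[ij jp].
have ip : (i < p.+1)%N by apply: ltn_trans jp.
have := adj (Ordinal ip) (Ordinal jp); rewrite Gamma_adj cyc_adj_ordS //= ij /=.
by rewrite [(j < i)%N]ltnNge (ltnW ij) orbF -(nZ (Ordinal ip)) -(nZ (Ordinal jp)).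
Qed.

Lemma oriented_iff : oriented B <->
  (forall C : {set 'I_n}, chordless_cycle (Gamma B) C -> cyclically_oriented (Gamma B) C).
Proof.
split=> [o C [p [c L]]|H k l E].
  case: p c L => [|p] c L; first by case: L.
  have [l E mC] := ear_of_labeling L; have [p3 cI CE adj] := L.
  have pass (a : 'I_p.+1) : B (c (ordS a)) (c a) * B (c (ordS a)) (c (ordS (ordS a))) < 0.
    have cC : c (ordS a) \in c ord0 :: l by rewrite mC CE imset_f.
    have pa := oriented_passes sB B0 o (E : ecycle B (_ :: _)) cC.
    apply: (passes_two pa) => y; rewrite mC CE => /imsetP[b _ ->] bb.
    have := adj (ordS a) b; rewrite Gamma_adj bb => /esym /orP[/eqP->|/eqP/(can_inj (@ordSK _)) ->].
      by right.
    by left.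
  have neg (a : 'I_p.+1) : (B (c (ordS a)) (c a) < 0) = (0 < B (c a) (c (ordS a))).
    by rewrite (skew_lt0 d_gt0 _ _ s).
  have step (a : 'I_p.+1) : (0 < B (c a) (c (ordS a))) = (0 < B (c (ordS a)) (c (ordS (ordS a)))).
    rewrite -neg; have := pass a; move: (B (c (ordS a)) (c a)) (B (c (ordS a)) (c (ordS (ordS a)))) => u v.
    case: (ltgtP u 0) => [u0|u0|->]; last by rewrite mul0r.
      by rewrite nmulr_rlt0 // => ->.
    by rewrite pmulr_rlt0 // => v0; rewrite ltNge ltW.
  have const (a : 'I_p.+1) : (0 < B (c a) (c (ordS a))) = (0 < B (c ord0) (c (ordS ord0))).
    have [i] := ubnP (val a); elim: i a => // i IH a; rewrite ltnS => ai.
    have [->//|a0] := eqVneq a ord0.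
    have ap : ((val a).-1 < p.+1)%N by apply: leq_ltn_trans (leq_pred _) (ltn_ord a).
    have a1 : (0 < val a)%N by rewrite lt0n.
    have Ea : ordS (Ordinal ap) = a.
      apply: val_inj; rewrite ordS_val /= prednK //.
      by case: eqP => // h; have := ltn_ord a; rewrite h ltnn.
    by rewrite -{1 2}Ea -step IH //= prednK.
  case: (boolP (0 < B (c ord0) (c (ordS ord0)))) => h0.
    by exists p.+1, c; split => // a; rewrite /Gamma const.
  have rS (a : 'I_p.+1) : ordS (rev_ord (ordS a)) = rev_ord a.
    apply: val_inj; rewrite ordS_val /= !subSS.
    have la := ltn_ord a; have := ordS_val a => /= ->.
    by case: (eqVneq a.+1 p.+1) => h; case: eqVneq => h'; lia.
  (* If the first edge runs backwards, all of them do, and the reversed labeling is cyclically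
     oriented. *)
  exists p.+1, (c \o @rev_ord p.+1); split; last first.
    move=> a /=; rewrite /Gamma -(rS a); set b := rev_ord (ordS a).
    have := const b; rewrite (negbTE h0) => /negbT; rewrite -leNgt le_eqVlt => /orP[/eqP e|].
      have := adj b (ordS b); rewrite Gamma_adj e eqxx => /esym; by rewrite eqxx.
    by rewrite (skew_lt0 d_gt0 _ _ s).
  split => //.
  - by move=> a b /= /cI /rev_ord_inj.
  - rewrite CE; apply/setP => y; apply/imsetP/imsetP => [[a _ ->]|[a _ ->]].
      by exists (rev_ord a) => //=; rewrite rev_ordK.
    by exists (rev_ord a).
  move=> a b /=; rewrite adj orbC.
  have rE (u v : 'I_p.+1) : (rev_ord u == ordS (rev_ord v)) = (v == ordS u).
    by rewrite -(rS u) (inj_eq (can_inj (@ordSK _))) (inj_eq rev_ord_inj) eq_sym.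
  by rewrite !rE.
have L := labeling_of_ear E; have [|p [c [[p3 cI CE adj] Ha]]] := H [set y in k :: l].
  by exists (size (k :: l)), (fun a : 'I_(size (k :: l)) => nth k (k :: l) a).
have : k \in [set y in k :: l] by rewrite inE mem_head.
rewrite {1}CE => /imsetP[a _ ka].
have memC b : c b \in k :: l.
  have : c b \in [set y in k :: l] by rewrite CE imset_f.
  by rewrite in_set.
rewrite -(ear_passes (B0 k) E); apply/andP; split; apply/hasP.
  by exists (c (ordS a)) => //; have := Ha a; rewrite /Gamma -ka.
exists (c (ord_pred a)) => //; have := Ha (ord_pred a); rewrite ord_predK /Gamma -ka.
by rewrite (skew_gt0 d_gt0 _ _ s).
Qed.

End Labelings.

(** * Positivity over different fields *)

Section FieldChange.

Definition ratform (F : realFieldType) n (Q : 'I_n -> 'I_n -> rat) (x : 'I_n -> F) : F :=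
  \sum_i \sum_j ratr (Q i j) * (x i * x j).

(** The Schur complement of the corner entry, which remains after completing the square in the first
    variable. *)
Definition schur n (Q : 'I_n.+1 -> 'I_n.+1 -> rat) (i j : 'I_n) : rat :=
  Q (lift ord0 i) (lift ord0 j) - Q ord0 (lift ord0 i) * Q ord0 (lift ord0 j) / Q ord0 ord0.

Lemma ratform_schur (F : realFieldType) n (Q : 'I_n.+1 -> 'I_n.+1 -> rat) (x : 'I_n.+1 -> F) :
  (forall i j, Q i j = Q j i) -> Q ord0 ord0 != 0 ->
  let a : F := ratr (Q ord0 ord0) in
  let b := \sum_j ratr (Q ord0 (lift ord0 j)) * x (lift ord0 j) in
  ratform Q x = a * (x ord0 + b / a) ^+ 2 + ratform (schur Q) (fun i => x (lift ord0 i)).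
Proof.
move=> sQ Q0 a b; have a0 : a != 0 by rewrite /a fmorph_eq0.
have -> : ratform (schur Q) (fun i => x (lift ord0 i)) =
    \sum_i \sum_j ratr (Q (lift ord0 i) (lift ord0 j)) * (x (lift ord0 i) * x (lift ord0 j)) - b * b / a.
  rewrite {2}/b !mulr_suml -sumrB; apply: eq_bigr => i _.
  rewrite /b mulr_sumr mulr_suml -sumrB; apply: eq_bigr => j _.
  rewrite /schur rmorphB /= !rmorphM /= fmorphV -/a; ring.
rewrite /ratform big_ord_recl big_ord_recl /= -/a.
have -> : \sum_(i < n) ratr (Q ord0 (lift ord0 i)) * (x ord0 * x (lift ord0 i)) = x ord0 * b.
  by rewrite mulr_sumr; apply: eq_bigr => i _; rewrite mulrCA.
under [X in _ + X]eq_bigr => i _ do rewrite big_ord_recl.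
rewrite big_split /=.
have -> : \sum_(i < n) ratr (Q (lift ord0 i) ord0) * (x (lift ord0 i) * x ord0) = x ord0 * b.
  by rewrite mulr_sumr; apply: eq_bigr => i _; rewrite sQ; ring.
by set T := \sum_(i < n) _; field.
Qed.

(* Gram-Schmidt elimination of one variable at a time stays inside the rationals. *)
Lemma ratform_gt0 (F : realFieldType) n (Q : 'I_n -> 'I_n -> rat) :
  (forall i j, Q i j = Q j i) ->
  (forall x : 'I_n -> rat, (exists i, x i != 0) -> 0 < ratform Q x) ->
  forall x : 'I_n -> F, (exists i, x i != 0) -> 0 < ratform Q x.
Proof.
elim: n Q => [|n IH] Q sQ p x nx; first by case: nx => -[].
have a0 : 0 < Q ord0 ord0.
  have := p (fun i => (i == ord0)%:R) (ex_intro _ ord0 (oner_neq0 _)).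
  rewrite /ratform big_ord_recl big_ord_recl [X in _ + X + _]big1 => [|i _]; last first.
    by rewrite !mulr0.
  rewrite big1 => [|i _]; first by rewrite eqxx !mulr1 !addr0 ltr0q.
  by rewrite big1 // => j _; rewrite mul0r mulr0.
have an := lt0r_neq0 a0.
have {}IH := IH (schur Q) _ _ (fun i => x (lift ord0 i)).
rewrite (ratform_schur x sQ an); set b := \sum_j _.
have ra : 0 < ratr (Q ord0 ord0) :> F by rewrite ltr0q.
case: (pickP (fun i => x (lift ord0 i) != 0)) => [i xi|x0].
  apply: ltr_wpDl; first by rewrite mulr_ge0 ?sqr_ge0 ?ltW.
  apply: IH; last by exists i.
    by move=> u v; rewrite /schur (sQ (lift ord0 u)) (mulrC (Q ord0 (lift ord0 u))).
  move=> y [j yj]; pose c := \sum_i ratr (Q ord0 (lift ord0 i)) * y i.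
  (* This value at [ord0] makes the completed square vanish, so the form at [z] is the Schur
     complement at [y]. *)
  pose z i := if unlift ord0 i is Some j then y j else - (c / ratr (Q ord0 ord0)).
  have zl i' : z (lift ord0 i') = y i' by rewrite /z liftK.
  have := p z; rewrite (ratform_schur z sQ an) {2}/z unlift_none.
  have -> : \sum_j ratr (Q ord0 (lift ord0 j)) * z (lift ord0 j) = c.
    by apply: eq_bigr => i' _; rewrite zl.
  rewrite addNr expr0n mulr0 add0r => H.
  have -> : ratform (schur Q) y = ratform (schur Q) (fun i => z (lift ord0 i)).
    by apply: eq_bigr => u _; apply: eq_bigr => v _; rewrite !zl.
  by apply: H; exists (lift ord0 j); rewrite zl.
have {}x0 i : x (lift ord0 i) = 0 by apply/eqP; have := x0 i => /negbFE.
have -> : b = 0 by apply: big1 => i _; rewrite x0 mulr0.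
rewrite mul0r addr0 /ratform big1 => [|i _]; last by rewrite big1 // => j _; rewrite x0 mul0r mulr0.
rewrite addr0 mulr_gt0 // exprn_even_gt0 //=.
by case: nx => i; case: (unliftP ord0 i) => [j ->|->] //; rewrite x0 eqxx.
Qed.

Lemma qform_ratform (F : realFieldType) n (d : 'I_n -> int) (A : 'M[int]_n) (x : 'I_n -> F) :
  qform d A x = ratform (fun i j => (d i * A i j)%:~R) x.
Proof.
apply: eq_bigr => i _; rewrite /lin mulr_sumr; apply: eq_bigr => j _.
by rewrite ratr_int intrM; ring.
Qed.

Lemma pd_rat (F : realFieldType) n (d : 'I_n -> int) (A : 'M[int]_n) :
  (forall i j, d i * A i j = d j * A j i) -> pd d rat A -> pd d F A.
Proof.
move=> sA p x nx; rewrite qform_ratform; apply: ratform_gt0 nx => [i j|y ny].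
  by rewrite sA.
by rewrite -qform_ratform; apply: p.
Qed.

End FieldChange.

(** * Translation between matrix statements and coordinate sums *)

Section Conversions.
Variables (n : nat).
Implicit Types (B A : 'M[int]_n) (d : 'rV[int]_n) (k : 'I_n).

Lemma diag_symE d A : (diag_mx d *m A)^T = diag_mx d *m A <->
  (forall i j, d 0 i * A i j = d 0 j * A j i).
Proof.
rewrite mul_diag_mx; split=> [/matrixP H i j|H]; first by have := H j i; rewrite !mxE.
by apply/matrixP => i j; rewrite !mxE.
Qed.

Lemma skew_symmetrizableP B : skew_symmetrizable B ->
  exists d, (forall i, 0 < d 0 i) /\ skew_by (fun i => d 0 i) B.
Proof.
case=> d [d0 /matrixP H]; exists d; split=> // i j.
by have := H j i; rewrite mul_diag_mx !mxE.
Qed.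

Lemma posdef_pd (F : realFieldType) d A :
  posdef (map_mx (intr : int -> F) (diag_mx d *m A)) <-> pd (fun i => d 0 i) F A.
Proof.
have E (x : 'cV[F]_n) : (x^T *m map_mx intr (diag_mx d *m A) *m x) 0 0 =
    qform (fun i => d 0 i) A (fun i => x i 0).
  rewrite -mulmxA mxE; apply: eq_bigr => i _; rewrite !mxE /lin !mulr_sumr.
  apply: eq_bigr => j _; rewrite mul_diag_mx !mxE intrM; ring.
split=> H x.
  move=> [i xi]; have := H (\col_i x i); rewrite E.
  have -> : qform (fun i => d 0 i) A (fun i => (\col_i x i) i 0) = qform (fun i => d 0 i) A x.
    by apply: eq_bigr => u _; rewrite mxE; congr (_ * _); apply: eq_bigr => v _; rewrite mxE.
  by apply; apply: contra_neq xi => /matrixP/(_ i 0); rewrite !mxE.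
move=> x0; rewrite E; apply: H.
by have /cV0Pn := x0.
Qed.

Lemma positiveP (F : realFieldType) A : positive F A <->
  exists d, [/\ forall i, 0 < d 0 i, forall i j, d 0 i * A i j = d 0 j * A j i &
                pd (fun i => d 0 i) F A].
Proof.
split=> [[d [[d0 /diag_symE sA] /posdef_pd p]]|[d [d0 sA p]]]; exists d => //.
by split; [split=> //; apply/diag_symE|apply/posdef_pd].
Qed.

(* The signs of [B] are those of a skew matrix, so any symmetrizer of a matrix with the
   same absolute values is a skew-symmetrizer of [B]. *)
Lemma skew_by_abs (d d' : 'I_n -> int) B A :
  (forall i, 0 < d i) -> (forall i, 0 < d' i) -> skew_by d' B ->
  (forall i j, d i * A i j = d j * A j i) -> (forall i j, i != j -> `|A i j| = `|B i j|) ->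
  skew_by d B.
Proof.
move=> d0 d0' s sA ab i j; have [->|ij] := eqVneq i j.
  by rewrite (skew_diag d0' j s) !mulr0 oppr0.
have e : d i * `|B i j| = d j * `|B j i|.
  have := congr1 Num.norm (sA i j); rewrite !normrM (gtr0_norm (d0 i)) (gtr0_norm (d0 j)) !ab //.
  by rewrite eq_sym.
have l0 := skew_lt0 d0' j i s; have g0 := skew_gt0 d0' j i s; have z0 := skew_eq0 d0' j i s.
case: (ltgtP (B i j) 0) => h.
- by move: e; rewrite ltr0_norm // gtr0_norm ?g0 // mulrN => <-; rewrite opprK.
- by move: e; rewrite gtr0_norm // ltr0_norm ?l0 // mulrN.
- have /eqP -> : B j i == 0 by rewrite z0 h.
  by rewrite h !mulr0 oppr0.
Qed.

Lemma foldl_mutate_skew (d : 'I_n -> int) B ks : (forall i, 0 < d i) ->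
  skew_by d B -> skew_by d (foldl (@mutate n) B ks).
Proof. by move=> d0; elim: ks B => //= k ks IH B s; apply/IH/mutate_skew. Qed.

Lemma foldl_mutateK (d : 'I_n -> int) B ks : (forall i, 0 < d i) -> skew_by d B ->
  foldl (@mutate n) (foldl (@mutate n) B ks) (rev ks) = B.
Proof.
move=> d0; elim: ks B => //= k ks IH B s; rewrite rev_cons -cats1 foldl_cat IH /=.
  exact: mutateK.
exact: mutate_skew.
Qed.

End Conversions.

Lemma pd_bounded (R : realFieldType) n (d : 'I_n -> int) (B A : 'M[int]_n) :
  (forall i, 0 < d i) -> skew_by d B -> companion d B A -> pd d R A -> oriented B -> bounded B.
Proof.
move=> d0 s c p o ks; elim: ks B A s c p o => [|k ks IH] B A s c p o i j ij /=.
  by have := pd_weight d0 c p ij; rewrite -ltzD1.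
by have [s' c' p' o'] := oriented_mutate d0 k s c p o; apply: IH s' c' p' o' _ _ ij.
Qed.

Theorem theorem1p2 (R : realFieldType) (n : nat) (B : 'M[int]_n)
    (hB : skew_symmetrizable B) :
  let cond_i :=
    exists B0 : 'M[int]_n,
      mutation_equivalent B B0 /\ positive R (cartan_counterpart B0) in
  let cond_ii :=
    forall B' : 'M[int]_n, mutation_equivalent B B' ->
      forall i j : 'I_n, i != j -> `|B' i j * B' j i| <= 3 in
  let cond_iii :=
    (forall C : {set 'I_n},
       chordless_cycle (Gamma B) C -> cyclically_oriented (Gamma B) C) /\
    (exists A : 'M[int]_n, quasi_cartan_companion B A /\ positive R A) in
  (cond_iii <-> cond_i) /\ (cond_iii <-> cond_ii).
Proof.
move=> cond_i cond_ii cond_iii; have [e [e0 sB]] := skew_symmetrizableP hB.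
have iii_ii : cond_iii -> cond_ii.
  case=> H [A [[[_ A2] ab] /positiveP[d [d0 sA p]]]] _ [ks ->].
  have s := skew_by_abs d0 e0 sB sA ab.
  by apply: (pd_bounded d0 s _ p _ ks) => //; apply/(oriented_iff d0 s).
have ii_i : cond_ii -> cond_i.
  move=> H; have cB : cls (fun i => e 0 i) [set: 'I_n] B.
    by split=> // [i j|ks i j]; [rewrite inE|apply: H; exists ks].
  have [ks p] := bounded_finite e0 cB.
  exists (foldl (@mutate n) B ks); split; first by exists ks.
  have [_ sA _] := cartan_companion e0 (foldl_mutate_skew ks e0 sB).
  by apply/positiveP; exists e; split=> //; apply: pd_rat.
have i_iii : cond_i -> cond_iii.
  case=> _ [[ks ->] /positiveP[d [d0 sA p]]].
  (* The symmetrizer of the Cartan counterpart skew-symmetrizes the mutated matrix and, mutating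
     back, also [B], so a single [d] serves throughout. *)
  have sB0 : skew_by (fun i => d 0 i) (foldl (@mutate n) B ks).
    apply: (skew_by_abs d0 e0 (foldl_mutate_skew ks e0 sB) sA) => i j ij.
    by rewrite mxE (negbTE ij) normrN normr_id.
  have s : skew_by (fun i => d 0 i) B.
    by rewrite -(foldl_mutateK ks e0 sB); apply: foldl_mutate_skew.
  have [A [[A2 sA' ab] p' o]] := pd_back d0 s p.
  split; first exact/(oriented_iff d0 s).
  exists A; split; last by apply/positiveP; exists d.
  by split=> //; split=> //; exists d; split=> //; apply/diag_symE.
by split; split=> [?|?]; auto.
Qed.
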